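(* Let $X$ be a real Hilbert space, $0<\alpha<1$, $T>0$. Let $A:X\supset\mathcal{D}(A)\to X$ be a closed densely defined linear operator such that $\{\lambda\in\mathbb{R};\ \lambda>0\}\subset\rho(A)$ and $\lambda\|(\lambda-A)^{-1}\|_{X\to X}\le 1$ for all $\lambda>0$, and let $B:X\to X$ be a bounded linear operator on $X$. Consider $$\partial_t^\alpha(u(t)-a)=Au(t)+Bu(t)\quad\text{for }0<t<T. \qquad ( * )$$ (i) For each $a\in X$, there exists a unique weak solution $u\in L^2(0,T;X)$ to $( * )$, and we can choose a constant $C>0$ such that $$\|u(t)\|_X\le C\|a\|_X\quad\text{for all }a\in X\text{ and almost all }t\in(0,T).$$ (ii) For each $a\in\mathcal{D}(A)$, there exists a unique strong solution $u$ to $( * )$, it satisfies $u,\,Au\in C([0,T];X)$, and we can choose a constant $C>0$ such that $$\|Au(t)\|_X+\|u(t)\|_X\le C(\|Aa\|_X+\|a\|_X)\quad\text{for all }a\in\mathcal{D}(A)\text{ and almost all }t\in(0,T).$$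
   Context: $L^2(0,T;X)$ is the Hilbert space of (classes of) strongly measurable, square-integrable functions $(0,T)\to X$ with scalar product $(v,w)_{L^2(0,T;X)}=\int_0^T (v(t),w(t))_X\,dt$. $\rho(A)$ denotes the resolvent set of $A$. $\mathcal{D}(A)$ carries the graph norm $\|u\|_X+\|Au\|_X$. For a closed densely defined operator $K$ in $X$ (here $K=A+B$ with $\mathcal{D}(A+B)=\mathcal{D}(A)$), the operator $\mathcal{K}$ in $L^2(0,T;X)$ has domain $\mathcal{D}(\mathcal{K})=L^2(0,T;\mathcal{D}(K))$ and acts by $(\mathcal{K}u)(t)=Ku(t)$; $\mathcal{K}^*$ is its adjoint with respect to the scalar product of $L^2(0,T;X)$. For $v\in L^2(0,T;X)$ set $J^\alpha v(t)=\frac{1}{\Gamma(\alpha)}\int_0^t (t-s)^{\alpha-1}v(s)\,ds$; $J^\alpha$ is bounded and injective on $L^2(0,T;X)$. Define $\partial_t^\alpha:=(J^\alpha)^{-1}$ with domain $\mathcal{D}(\partial_t^\alpha)=J^\alpha L^2(0,T;X)=:H_\alpha(0,T;X)$, which is dense in $L^2(0,T;X)$; $(\partial_t^\alpha)^*$ is its adjoint with respect to the scalar product of $L^2(0,T;X)$. With $K=A+B$ and $a$ regarded as a constant function of $t$: Weak solution to $( * )$: $u\in L^2(0,T;X)$ such that $$(u-a,(\partial_t^\alpha)^*\varphi)_{L^2(0,T;X)}=(u,\mathcal{K}^*\varphi)_{L^2(0,T;X)}\quad\text{for all }\varphi\in\mathcal{D}((\partial_t^\alpha)^* )\cap\mathcal{D}(\mathcal{K}^*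 ).$$ Strong solution to $( * )$: $u\in L^2(0,T;\mathcal{D}(A))$ with $u-a\in H_\alpha(0,T;X)$ and $\partial_t^\alpha(u-a)=Au+Bu$ in $L^2(0,T;X)$. Membership in $C([0,T];X)$ means having a representative continuous on $[0,T]$. *)

(* Defs.v *)
From HB Require Import structures.
From mathcomp Require Import all_boot all_order all_algebra.
From mathcomp Require Import all_classical all_reals all_analysis.

Set Implicit Arguments.
Unset Strict Implicit.
Unset Printing Implicit Defensive.

Import Order.TTheory GRing.Theory Num.Theory.
Import numFieldNormedType.Exports.

Local Open Scope classical_set_scope.
Local Open Scope ring_scope.

Section UnboundedOperators.
Context {R : realType} {X : normedModType R}.

(* A linear operator defined on a subspace of [X].  The values of [pl_fun]
   outside [pl_dom] carry no information. *)
Record partial_linear := PartialLinear {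
  pl_dom : set X;
  pl_fun :> X -> X;
  pl_dom0 : pl_dom 0;
  pl_domP : forall (c : R) x y, pl_dom x -> pl_dom y -> pl_dom (c *: x + y);
  pl_funP : forall (c : R) x y, pl_dom x -> pl_dom y ->
    pl_fun (c *: x + y) = c *: pl_fun x + pl_fun y }.

Definition densely_defined (A : partial_linear) : Prop := dense (pl_dom A).

Definition closed_operator (A : partial_linear) : Prop :=
  closed [set p : X * X | pl_dom A p.1 /\ p.2 = A p.1].

Definition bounded_operator (S : X -> X) : Prop :=
  exists M : R, forall x, `|S x| <= M * `|x|.

Definition opnorm (S : X -> X) : R :=
  sup [set `|S x| | x in [set x : X | `|x| <= 1]].

Definition graph_norm (A : partial_linear) (x : X) : R := `|x| + `|A x|.

(* [resolvent A l y] is (l - A)^-1 y, meaningful when l - A is a bijection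
   from the domain of [A] onto [X]. *)
Definition resolvent (A : partial_linear) (l : R) (y : X) : X :=
  xget 0 [set x | pl_dom A x /\ l *: x - A x = y].

Definition in_resolvent_set (A : partial_linear) (l : R) : Prop :=
  (forall y, exists! x, pl_dom A x /\ l *: x - A x = y) /\
  bounded_operator (resolvent A l).

Fact add_bounded_domP (A : partial_linear) (B : {linear X -> X}) (c : R) x y :
  pl_dom A x -> pl_dom A y ->
  A (c *: x + y) + B (c *: x + y) = c *: (A x + B x) + (A y + B y).
Proof.
by move=> Ax Ay; rewrite pl_funP// linearP scalerDr addrACA.
Qed.

Definition add_bounded (A : partial_linear) (B : {linear X -> X}) :
    partial_linear :=
  @PartialLinear (pl_dom A) (fun x => A x + B x) (pl_dom0 A)
    (@pl_domP A) (@add_bounded_domP A B).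

End UnboundedOperators.
Arguments partial_linear {R} X.

Section BochnerIntegral.
Context {R : realType} {X : normedModType R}.
Local Notation mu := (@lebesgue_measure R).

Definition simple (s : R -> X) : Prop :=
  finite_set (range s) /\
  forall x, measurable (s @^-1` [set x] : set (measurableTypeR R)).

(* Strong measurability on [D], up to a null set, of a function with values in
   the subspace [Y] of [X] equipped with the norm [N]. *)
Definition strongly_measurable (Y : set X) (N : X -> R) (D : set R)
    (f : R -> X) : Prop :=
  {ae mu, forall t, D t -> Y (f t)} /\
  exists s : nat -> R -> X,
    (forall n, simple (s n) /\ range (s n) `<=` Y) /\
    {ae mu, forall t, D t -> N (f t - s n t) @[n --> \oo] --> 0}.

Definition simple_integral (D : set R) (s : R -> X) : X :=
  \sum_(x \in range s) fine (mu (D `&` s @^-1` [set x])) *: x.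

Definition is_bochner_integral (D : set R) (f : R -> X) (x : X) : Prop :=
  strongly_measurable setT Num.norm D f /\
  exists s : nat -> R -> X,
    [/\ forall n, simple (s n),
        (\int[mu]_(t in D) `|f t - s n t|%:E)%E @[n --> \oo] --> 0%E &
        simple_integral D (s n) @[n --> \oo] --> x].

(* Equal to 0 when [f] is not Bochner integrable on [D]; [D] is meant to have
   finite measure. *)
Definition bochner_integral (D : set R) (f : R -> X) : X :=
  xget 0 [set x | is_bochner_integral D f x].

End BochnerIntegral.

(* Elements of L^2(0,T;X) are represented by functions R -> X, of which only the
   values on ]0,T[ matter; equality of classes is [ae_eq mu `]0, T[].  Operators
   in L^2(0,T;X) are represented by their graphs, relations compatible with
   this equality. *)
Section L2.
Context {R : realType} {X : normedModType R}.
Local Notation mu := (@lebesgue_measure R).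
Implicit Types (T alpha : R) (u v w f : R -> X).

Definition L2_sub (Y : set X) (N : X -> R) T v : Prop :=
  strongly_measurable Y N `]0, T[%classic v /\
  (\int[mu]_(t in `]0%R, T[) (N (v t) ^+ 2)%:E < +oo)%E.

Definition L2 T v : Prop := L2_sub setT Num.norm T v.

Definition L2_dom (K : partial_linear X) T v : Prop :=
  L2_sub (pl_dom K) (graph_norm K) T v.

Definition eq_L2 T v w : Prop := ae_eq mu `]0, T[%classic v w.

Definition lift_op (K : partial_linear X) T u w : Prop :=
  L2_dom K T u /\ eq_L2 T w (fun t => K (u t)).

Definition Gamma (a : R) : R :=
  (\int[mu]_(t in `]0, +oo[) (t `^ (a - 1) * expR (- t)))%R.

Definition J alpha v : R -> X := fun t =>
  (Gamma alpha)^-1 *: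
    bochner_integral `]0, t[%classic (fun s => (t - s) `^ (alpha - 1) *: v s).

Definition H_ alpha T u : Prop := exists2 v, L2 T v & eq_L2 T u (J alpha v).

(* The graph of the inverse of [J alpha] on L^2(0,T;X). *)
Definition dt alpha T u v : Prop := L2 T v /\ eq_L2 T u (J alpha v).

Definition continuous_repr T u : Prop :=
  exists2 v, {within `[0, T]%classic, continuous v} & eq_L2 T u v.

Variable dot : {dot X for idfun}.

Definition dotL2 T v w : R :=
  (\int[mu]_(t in `]0, T[) dot (v t) (w t))%R.

(* For a densely defined operator with graph [P] in L^2(0,T;X): [phi] is in the
   domain of the adjoint, which maps it to [psi]. *)
Definition adjoint T (P : (R -> X) -> (R -> X) -> Prop) phi psi : Prop :=
  [/\ L2 T phi, L2 T psi &
      forall u w, P u w -> dotL2 T w phi = dotL2 T u psi].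

Definition weak_solution alpha T (K : partial_linear X) (a : X) u : Prop :=
  L2 T u /\
  forall phi psi chi,
    adjoint T (dt alpha T) phi psi -> adjoint T (lift_op K T) phi chi ->
    dotL2 T (fun t => u t - a) psi = dotL2 T u chi.

Definition strong_solution alpha T (A : partial_linear X) (B : X -> X)
    (a : X) u : Prop :=
  [/\ L2_dom A T u, H_ alpha T (fun t => u t - a) &
      dt alpha T (fun t => u t - a) (fun t => A (u t) + B (u t))].

End L2.

(* Main.v *)
(* Idea.  With |B x| <= w |x|, the operator L = A + B - w is m-dissipative, and so
   is its adjoint.  The Volterra equations u = a + J (L_n u + w u) for the Yosida
   approximations L_n = n (P_n - 1), P_n = n (n - L)^-1, are solved by iteration.
   They are stable uniformly in n: a fractional form of Kato's inequality bounds
   |v| for v = a + J f by |a| + J (|f + m v| - m |v|), obtained by discretizing J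
   on a grid, where the log-convexity of the kernel (Kaluza's lemma) makes the
   inverse of the discrete convolution order preserving.  With f = L_n v and m = n
   the correction is nonpositive, and a fractional Gronwall inequality absorbs w.
   Hence the solutions converge uniformly, first for a in D(A), where two
   approximations differ by |P_n L a - P_m L a|, then for all a by density.  The
   limit E(t) a is a strong solution for a in D(A) and a weak one in general.

   Uniqueness of weak solutions is by duality.  The same construction for the
   adjoint operator gives E'(t), and Psi = J (E'( ) x) takes values in the domain
   of the adjoint of A + B, with (A + B)^* Psi = E'( ) x - x.  Testing with
   phi(t) = Psi(s - t) for t < s, and 0 for t >= s, determines the integral of
   (u, x) over ]0, s[ for all s and x, because the fractional integral J and its
   time reversal are adjoint to each other (Fubini). *)

Require Import Defs.
From HB Require Import structures.
Set Warnings "-notation-overridden,-notation-incompatible-prefix".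
From mathcomp Require Import all_boot all_order all_algebra.
From mathcomp Require Import finmap.
From mathcomp Require Import all_classical all_reals all_analysis.
From mathcomp Require Import measurable_realfun.
From mathcomp Require Import ring lra zify.
Import Order.TTheory GRing.Theory Num.Theory.
Import numFieldNormedType.Exports HBNNSimple.
Local Open Scope classical_set_scope.
Local Open Scope ring_scope.

Set Implicit Arguments.
Unset Strict Implicit.
Unset Printing Implicit Defensive.

(** A fractional derivative obeys no chain rule, so no identity for the derivative of |v|^2 is at
    hand from which a bound independent of [n] could be read off. On a grid the comparison becomes
    an algebraic induction, and this is why J is discretized at all.

    The solution family is built from bounded operators, the contractions [P n] and [S], and a few
    identities between them. These pass to Hilbert space adjoints, so the adjoint equation is solved
    although the adjoint of A + B is never formed as an operator and its domain is never shown to be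
    dense: the adjoints of [P n] converge strongly because those operators are contractions and
    [P n] converges.

    Vector-valued integrals are handled by pairing with fixed vectors: the Bochner integral exists
    by the Riesz theorem, and properties of J reduce to the scalar fractional integral. The
    functions that are constructed are continuous, so J converges at every time. Only the graph of
    [dt] involves J of merely square-integrable functions, for which convergence is known almost
    everywhere. *)

Lemma linear_pack (R : pzRingType) (U V : lmodType R) (f : U -> V) :
  linear f -> exists g : {linear U -> V}, g =1 f.
Proof.
move=> lf.
pose L := GRing.isLinear.Build R U V _ f lf.
by exists (HB.pack f L : {linear U -> V}).
Qed.

Lemma cvg_mulr0 (R : realType) (I : Type) (F : set_system I) {FF : Filter F}
    (c : R) (f : I -> R) :
  f @ F --> 0 -> c * f x @[x --> F] --> 0.
Proof.
move=> f0; rewrite -(mulr0 c).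
by apply: cvgM => //; exact: cvg_cst.
Qed.

Lemma cvg_dist0 (R : realType) (X : normedModType R) (I : Type)
    (F : set_system I) {FF : Filter F} (f : I -> X) (l : X) :
  f @ F --> l -> `|f x - l| @[x --> F] --> 0.
Proof. by move=> fl; apply/norm_cvg0P/subr_cvg0. Qed.

(** * Hilbert space preliminaries *)

Section Cauchy.
Context (R : realType) (X : completeNormedModType R).

Lemma cauchy_seq_cvg (u : nat -> X) (b : nat -> R) :
  b n @[n --> \oo] --> 0 -> (forall m n, (m <= n)%N -> `|u m - u n| <= b m) ->
  cvgn u.
Proof.
move=> b0 ub; apply/cauchy_cvgP/cauchy_exP => e e0.
have [N _ hN] : \forall n \near \oo, `|b n| < e.
  by move/cvgrPdist_lt : b0 => /(_ _ e0); apply: filterS => n; rewrite sub0r normrN.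
exists (u N); exists N => // n /= Nn; rewrite -ball_normE /=; apply: le_lt_trans (ub _ _ Nn) _.
by apply: le_lt_trans (ler_norm _) _; apply: hN => /=.
Qed.

(** Picard iteration from 0; used to solve the resolvent equation of A + B. *)
Lemma contraction_fixpoint (f : X -> X) (q : R) : 0 <= q -> q < 1 ->
  (forall x y, `|f x - f y| <= q * `|x - y|) -> exists x, x = f x.
Proof.
move=> q0 q1 fq; pose u n := iter n f 0.
have du n k : `|u n - u (n + k)%N| <= q ^+ n * `|0 - u k|.
  elim: n => [|n IH]; first by rewrite expr0 mul1r.
  rewrite addSn exprS -mulrA; apply: le_trans (fq _ _) _.
  exact: ler_wpM2l.
(* The orbit of 0 stays in a fixed ball, which turns [du] into a Cauchy bound. *)
have bu k : `|0 - u k| <= `|f 0| / (1 - q).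
  rewrite ler_pdivlMr ?subr_gt0 //.
  elim: k => [|k IH]; first by rewrite /u /= subrr normr0 mul0r.
  have q1' : 0 <= 1 - q by rewrite subr_ge0 ltW.
  have -> : 0 - u k.+1 = - f 0 + (f 0 - f (u k)) by rewrite addrA addNr sub0r.
  apply: le_trans (ler_wpM2r q1' (ler_normD _ _)) _.
  rewrite normrN mulrDl.
  have := ler_wpM2r q1' (fq 0 (u k)).
  rewrite -mulrA => /le_trans/(_ (ler_wpM2l q0 IH)); lra.
have cu : cvgn u.
  apply: (@cauchy_seq_cvg u (fun n => q ^+ n * (`|f 0| / (1 - q)))).
    rewrite -(mul0r (`|f 0| / (1 - q))); apply: cvgMl.
    by apply: cvg_expr; rewrite ger0_norm.
  move=> m n mn; rewrite -(subnKC mn); apply: le_trans (du _ _) _.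
  by rewrite ler_wpM2l // exprn_ge0.
have c1 : u n.+1 @[n --> \oo] --> limn u by rewrite (cvg_shiftS u).
have c2 : u n.+1 @[n --> \oo] --> f (limn u).
  apply/cvgrPdist_le => e e0; move/cvgrPdist_le: cu => /(_ _ e0).
  apply: filterS => n hn; apply: le_trans (fq _ _) _.
  by apply: le_trans hn; rewrite ler_piMl // ltW.
by exists (limn u); exact: (cvg_unique _ c1 c2).
Qed.
End Cauchy.

Section Hilbert.
Context (R : realType) (X : completeNormedModType R).
Context (dot : {dot X for idfun}) (norm_dot : forall x : X, `|x| ^+ 2 = dot x x).
Implicit Types (x y z : X).

Lemma dotC x y : dot x y = dot y x.
Proof. by rewrite hermC /= expr0 mul1r. Qed.
Lemma dotDl x y z : dot (x + y) z = dot x z + dot y z.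
Proof. exact: linearDl. Qed.
Lemma dotDr x y z : dot x (y + z) = dot x y + dot x z.
Proof. exact: linearDr. Qed.
Lemma dotBl x y z : dot (x - y) z = dot x z - dot y z.
Proof. exact: linearBl. Qed.
Lemma dotBr x y z : dot x (y - z) = dot x y - dot x z.
Proof. exact: linearBr. Qed.
Lemma dotZl c x y : dot (c *: x) y = c * dot x y.
Proof. exact: linearZl_LR. Qed.
Lemma dotZr c x y : dot x (c *: y) = c * dot x y.
Proof. by rewrite dotC dotZl dotC. Qed.
Lemma dot0l x : dot 0 x = 0.
Proof. exact: linear0l. Qed.
Lemma dot0r x : dot x 0 = 0.
Proof. exact: linear0r. Qed.

Lemma dotNl x y : dot (- x) y = - dot x y.
Proof. exact: linearNl. Qed.

Definition dotE := (dotDl, dotNl, dotZl, dot0l).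

Lemma dot_ge0 x : 0 <= dot x x.
Proof. by rewrite -norm_dot exprn_ge0. Qed.

Lemma dot_le x y : `|dot x y| <= `|x| * `|y|.
Proof.
have [->|x0] := eqVneq x 0; first by rewrite dot0l !normr0 mul0r.
rewrite -(@ler_pXn2r _ 2) ?nnegrE ?mulr_ge0// exprMn !norm_dot.
have xx : 0 < dot x x by rewrite -norm_dot exprn_gt0 // normr_gt0.
have := dot_ge0 (y - (dot x y / dot x x) *: x).
rewrite dotBl !dotBr !dotZl !dotZr (dotC y x) -normrX ger0_norm ?sqr_ge0 //.
rewrite divfK ?gt_eqF // subrr subr0 subr_ge0 mulrAC ler_pdivrMr // -expr2.
by rewrite (mulrC (dot x x)).
Qed.

(** Test with [y = x]. Together with [dot_ext] it reduces estimates and identities between vector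
    integrals to scalar ones. *)
Lemma norm_le_dot x (M : R) : 0 <= M ->
  (forall y, dot x y <= M * `|y|) -> `|x| <= M.
Proof.
move=> M0 h; have := h x; rewrite -norm_dot expr2.
have [->|x0] := eqVneq x 0; first by rewrite normr0.
by rewrite ler_pM2r // normr_gt0.
Qed.

Lemma dot_ext x y : (forall z, dot x z = dot y z) -> x = y.
Proof.
move=> h; apply/eqP; rewrite -subr_eq0 -normr_eq0 -sqrf_eq0 norm_dot.
by rewrite dotBl h subrr.
Qed.

Lemma dot_cvg (I : Type) (F : set_system I) {FF : Filter F} (u v : I -> X) x y :
  u @ F --> x -> v @ F --> y -> dot (u n) (v n) @[n --> F] --> dot x y.
Proof.
move=> ux vy.
apply/subr_cvg0/norm_cvg0P.
apply: (@squeeze_cvgr _ _ _ _ (fun=> 0)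
  (fun n => `|u n - x| * `|v n| + `|x| * `|v n - y|)).
- apply: nearW => n; rewrite normr_ge0 /=.
  have -> : dot (u n) (v n) - dot x y = dot (u n - x) (v n) + dot x (v n - y).
    by rewrite dotBl dotBr; ring.
  by rewrite (le_trans (ler_normD _ _)) // lerD // dot_le.
- exact: cvg_cst.
- have E : (0 : R) = 0 * `|y| + `|x| * 0 by rewrite mul0r mulr0 addr0.
  rewrite [X in _ --> X]E; apply: cvgD; apply: cvgM.
  + by apply/norm_cvg0P/subr_cvg0.
  + exact: cvg_norm.
  + exact: cvg_cst.
  + by apply/norm_cvg0P/subr_cvg0.
Qed.

(** The vector minimizes |y|^2 - 2 f(y): by the parallelogram identity [G2] a minimizing sequence is
    Cauchy, and minimality along all lines through the limit gives the representation. *)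
Lemma riesz (f : X -> R) (M : R) : linear (f : X -> R^o) ->
  (forall x, `|f x| <= M * `|x|) -> exists y, forall x, f x = dot x y.
Proof.
move=> /linear_pack[g gf] fM.
have fD x y : f (x + y) = f x + f y by rewrite -!gf linearD.
have fZ c x : f (c *: x) = c * f x by rewrite -!gf linearZ.
pose G y := dot y y - 2 * f y.
have GM y : - M ^+ 2 <= G y.
  rewrite /G -norm_dot; have := fM y; rewrite ler_norml => /andP[_].
  have := sqr_ge0 (`|y| - M); nra.
have infG : has_inf (range G).
  by split; [exists (G 0), 0|exists (- M ^+ 2) => _ [y _ <-]].
pose I := inf (range G).
have IG y : I <= G y by apply: ge_inf; [case: infG|exists y].
have GI n : exists y, G y < I + n.+1%:R^-1.
  have [_ [y _ <-] ?] := @inf_adherent _ (range G) n.+1%:R^-1 ltac:(by []) infG.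
  by exists y.
have [u Gu] := choice GI.
have G2 y z : dot (y - z) (y - z) = 2 * (G y + G z) - 4 * G (2^-1 *: (y + z)).
  rewrite /G fZ fD dotZl dotZr dotBl !dotBr dotDl !dotDr; by field.
have uC m n : (m <= n)%N -> `|u m - u n| <= Num.sqrt (4 * m.+1%:R^-1).
  move=> mn; rewrite -[leLHS]normr_id -sqrtr_sqr ler_wsqrtr // norm_dot G2.
  have := IG (2^-1 *: (u m + u n)); have := Gu m; have := Gu n.
  have : (n.+1%:R^-1 : R) <= m.+1%:R^-1 by rewrite lef_pV2 ?posrE // ler_nat.
  by move: (n.+1%:R^-1) (m.+1%:R^-1) (G _) (G _) (G _) => p q a b c; lra.
have cu : cvgn u.
  apply: cauchy_seq_cvg uC.
  have -> : (0 : R) = Num.sqrt (4 * 0) by rewrite mulr0 sqrtr0.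
  have h : 4 * n.+1%:R^-1 @[n --> \oo] --> 4 * (0 : R).
    by apply: cvgM; [exact: cvg_cst|exact: cvg_harmonic].
  exact: (cvg_comp _ _ h (@sqrt_continuous R _)).
pose y := limn u; exists y => x.
have fu : f (u n) @[n --> \oo] --> f y.
  apply/subr_cvg0/norm_cvg0P.
  apply: (@squeeze_cvgr _ _ _ _ (fun=> 0) (fun n => M * `|u n - y|)).
  - apply: nearW => n; rewrite normr_ge0 /=.
    have -> : f (u n) - f y = f (u n - y) by rewrite -!gf linearB.
    exact: fM.
  - exact: cvg_cst.
  - by apply: cvg_mulr0; exact: cvg_dist0.
have Gy : G y <= I.
  have c : G (u n) @[n --> \oo] --> G y.
    by apply: cvgB; [exact: dot_cvg|apply: cvgM => //; exact: cvg_cst].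
  have c' : I + n.+1%:R^-1 @[n --> \oo] --> I.
    rewrite -[X in _ --> X]addr0; apply: cvgD; [exact: cvg_cst|exact: cvg_harmonic].
  apply: (ler_cvg_to c c'); apply: nearW => n; exact/ltW.
have V t : 0 <= t ^+ 2 * dot x x + 2 * t * (dot x y - f x).
  have := le_trans Gy (IG (y + t *: x)).
  rewrite /G fD fZ dotDl !dotDr !dotZl !dotZr (dotC y x); lra.
apply/eqP; rewrite -subr_eq0; set d := f x - dot x y.
have -> : (d == 0) = (d ^+ 2 <= 0).
  by rewrite -sqrf_eq0 eq_le sqr_ge0 andbT.
have xx := dot_ge0 x.
(* Close to the optimal t = d / |x|^2; the added 1 covers [x = 0] as well. *)
have := V (d / (1 + dot x x)).
have -> : dot x y - f x = - d by rewrite opprB.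
move: d (dot x x) xx => d xx xx0 V'.
have p : 0 < 1 + xx by lra.
have : 0 <= (d ^+ 2 * (xx - 2 * (1 + xx))) / (1 + xx) ^+ 2.
  by apply: le_trans V' _; rewrite le_eqVlt; apply/orP; left; apply/eqP; field; rewrite gt_eqF.
rewrite pmulr_lge0 ?invr_gt0 ?exprn_gt0 //.
have := sqr_ge0 d; nra.
Qed.

Lemma adjoint_exists (L : {linear X -> X}) (M : R) : 0 <= M ->
  (forall x, `|L x| <= M * `|x|) ->
  exists2 L' : {linear X -> X}, forall x y, dot (L x) y = dot x (L' y) &
    forall y, `|L' y| <= M * `|y|.
Proof.
move=> M0 LM.
have h y : exists z, forall x, dot (L x) y = dot x z.
  apply: (@riesz (fun x => dot (L x) y) (M * `|y|)); first by move=> c a b; rewrite linearP dotDl dotZl.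
  move=> x; apply: le_trans (dot_le _ _) _; rewrite mulrAC ler_wpM2r //.
have [L' L'E] := choice h.
have lL' : linear L'.
  move=> c a b; apply: dot_ext => z; rewrite (dotC _ z) -L'E.
  by rewrite dotDl dotZl !dotDr !dotZr !(dotC _ z) -!L'E.
have [L2 L2E] := linear_pack lL'.
exists L2 => [x y|y]; first by rewrite L2E L'E.
rewrite L2E; apply: norm_le_dot => [|x]; first exact: mulr_ge0.
rewrite dotC -L'E; apply: le_trans (ler_norm _) _; apply: le_trans (dot_le _ _) _.
by rewrite mulrAC ler_wpM2r.
Qed.
End Hilbert.

(** * Convolutions with log-convex sequences *)

Section Convolution.
Context (R : realType) (X : normedModType R).

Definition conv (a : nat -> R) (f : nat -> X) (n : nat) : X :=
  \sum_(j < n.+1) a j *: f (n - j)%N.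

Lemma convD a f g n : conv a (fun n => f n + g n) n = conv a f n + conv a g n.
Proof. by rewrite -big_split; apply: eq_bigr => j _; rewrite scalerDr. Qed.

Lemma conv_cst a (x : X) n : conv a (fun=> x) n = (\sum_(j < n.+1) a j) *: x.
Proof. by rewrite scaler_suml. Qed.
End Convolution.

Lemma convA (R : realType) (X : normedModType R) (a b : nat -> R) (f : nat -> X) n :
  conv a (conv b f) n = conv (conv a (b : nat -> R^o)) f n.
Proof.
rewrite /conv; under eq_bigr do rewrite scaler_sumr.
under [RHS]eq_bigr do rewrite scaler_suml.
transitivity (\sum_(j < n.+1) \sum_(m < n.+1 | (j <= m)%N)
    (a j * b (m - j)%N) *: f (n - m)%N).
  apply: eq_bigr => j _.
  rewrite -(big_mkord xpredT (fun i => a j *: (b i *: f (n - j - i)%N))).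
  rewrite -(big_mkord (fun m => (j <= m)%N)
     (fun m => (a j * b (m - j)%N) *: f (n - m)%N)).
  have jn : (j <= n)%N by rewrite -ltnS.
  rewrite [RHS](big_cat_nat (n := j)) //=; last exact: leqW.
  rewrite [X in _ = X + _]big_nat_cond [X in _ = X + _]big1 ?add0r; last first.
    by move=> i /andP[/andP[_ ij]]; rewrite leqNgt ij.
  rewrite [RHS](_ : _ = \sum_(0 + j <= i < n.+1 | (j <= i)%N)
    (a j * b (i - j)%N) *: f (n - i)%N); last by rewrite add0n.
  rewrite big_addn subSn // big_nat_cond [RHS]big_nat_cond.
  apply: eq_big => i; first by rewrite leq_addl; case: (_ < _)%N => //=; rewrite !andbT; lia.
  by rewrite addnK scalerA subnDA subnAC => _; congr (_ *: f _); lia.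
rewrite (exchange_big_dep xpredT) //=; apply: eq_bigr => m _.
rewrite -(big_mkord (fun i => (i <= m)%N) (fun i => (a i * b (m - i)%N) *: f (n - m)%N)).
rewrite -(big_mkord xpredT (fun i => (a i *: (b (m - i)%N : R^o)) *: f (n - m)%N)).
have mn : (m.+1 <= n.+1)%N by [].
rewrite (big_cat_nat (n := m.+1)) //= [X in _ + X]big_nat_cond [X in _ + X]big1 ?addr0; last first.
  by move=> i /andP[/andP[mi _]]; rewrite leqNgt mi.
by rewrite big_nat_cond [RHS]big_nat_cond; apply: eq_bigl => i; rewrite ltnS andbT; case: (i <= m)%N.
Qed.

(* Kaluza: if [k] is log-convex and nonincreasing, the coefficients [q] of the
   renewal equation k_(n+1) = q_0 k_n + ... + q_n k_0 are nonnegative and their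
   sum is at most 1. *)
Section Kaluza.
Context (R : realType) (k : nat -> R).
Hypothesis k_gt0 : forall n, 0 < k n.
Hypothesis k_noninc : forall n, k n.+1 <= k n.
Hypothesis k_logconvex : forall n, k n.+1 ^+ 2 <= k n * k n.+2.

Lemma renewal_exists : exists q : nat -> R,
  forall n, k n.+1 = conv q (k : nat -> R^o) n.
Proof.
(* [s n] lists the first [n] coefficients; as [k 0] is nonzero, the renewal equation can be solved
   for the next one. *)
pose step (s : seq R) := rcons s
  ((k (size s).+1 - \sum_(j < size s) s`_j * k (size s - j)%N) / k 0%N).
pose s n := iter n step [::].
have szs n : size (s n) = n by elim: n => //= n IH; rewrite size_rcons IH.
have snth n i : (i < n)%N -> (s n)`_i = (s i.+1)`_i.
  elim: n => // n IH; rewrite ltnS leq_eqVlt => /orP[/eqP -> //|i_n].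
  by rewrite [s n.+1]/= nth_rcons szs i_n IH.
exists (fun n => (s n.+1)`_n) => n.
have E : \sum_(i < n) (s i.+1)`_i *: (k (n - i)%N : R^o) =
    \sum_(j < n) (s n)`_j * k (n - j)%N.
  by apply: eq_bigr => i _; rewrite (snth n).
rewrite /conv big_ord_recr E /= nth_rcons szs ltnn eqxx subnn.
by rewrite /GRing.scale /= divfK ?gt_eqF // addrC subrK.
Qed.

Lemma ratio_nondecr m n : (m <= n)%N -> k m.+1 / k m <= k n.+1 / k n.
Proof.
elim: n => [|n IH]; first by rewrite leqn0 => /eqP ->.
rewrite leq_eqVlt => /orP[/eqP -> //|/IH /le_trans]; apply.
rewrite ler_pdivrMr // mulrAC ler_pdivlMr // -expr2 mulrC.
exact: k_logconvex.
Qed.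

Context (q : nat -> R) (kq : forall n, k n.+1 = conv q (k : nat -> R^o) n).

(** Induction. The ratios k_(j+1) / k_j increase, so k_(n+1-i) <= (k_(n+2) / k_(n+1)) k_(n-i).
    Weighted by the nonnegative q_0, ..., q_n and summed, the right sides give k_(n+2), so the
    remaining term q_(n+1) k_0 of the renewal equation is nonnegative. *)
Lemma renewal_ge0 n : 0 <= q n.
Proof.
elim/ltn_ind: n => -[|n] IH.
  have := kq 0; rewrite /conv big_ord1 subnn /GRing.scale /= => k1.
  by rewrite -(pmulr_lge0 _ (k_gt0 0)) -k1 ltW.
have := kq n.+1; rewrite /conv big_ord_recr /= subnn => k2.
rewrite -(pmulr_lge0 _ (k_gt0 0)).
rewrite -[leRHS](addKr (\sum_(i < n.+1) q i *: (k (n.+1 - i)%N : R^o))) -k2.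
rewrite addrC subr_ge0.
apply: le_trans (_ : \sum_(i < n.+1) k n.+2 / k n.+1 * (q i * k (n - i)%N) <= _).
  apply: ler_sum => i _; rewrite /GRing.scale /= mulrCA ler_wpM2l ?IH //.
  have i_n : (i <= n)%N by rewrite -ltnS.
  rewrite subSn // -ler_pdivrMr //; apply: ratio_nondecr.
  exact: leq_trans (leq_subr _ _) _.
rewrite -mulr_sumr (_ : \sum_(i < n.+1) q i * k (n - i)%N = k n.+1); last exact/esym/kq.
by rewrite divfK ?gt_eqF.
Qed.

(** In the renewal equation every k_(n-i) is at least k_(n+1). *)
Lemma renewal_sum n : \sum_(j < n.+1) q j <= 1.
Proof.
rewrite -(ler_pM2l (k_gt0 n.+1)) mulr1 [leRHS]kq mulr_sumr.
apply: ler_sum => i _; rewrite /GRing.scale /= mulrC ler_wpM2l ?renewal_ge0 //.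
have : (n - i <= n.+1)%N by apply: leq_trans (leq_subr _ _) _.
move: (n - i)%N => j; elim: (n.+1) => [|m IH]; first by rewrite leqn0 => /eqP ->.
by rewrite leq_eqVlt => /orP[/eqP -> //|/IH]; apply: le_trans.
Qed.

(** Convolving [W] with [q] turns [k] into its shift, so that F 0, ..., F n enter only through
    earlier values of [W]. *)
Lemma renewal_rec (X : normedModType R) (a : X) (F W : nat -> X) :
  (forall n, W n = a + conv k F n) -> forall n,
  W n.+1 = (1 - \sum_(j < n.+1) q j) *: a + conv q W n + k 0 *: F n.+1.
Proof.
move=> WE n.
have -> : conv q W n = conv q (fun n => a + conv k F n) n.
  by apply: eq_bigr => j _; rewrite WE.
rewrite convD conv_cst convA scalerBl scale1r addrA subrK WE -addrA; congr (_ + _).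
rewrite {1}/conv big_ord_recl subn0 addrC; congr (_ + _).
by apply: eq_bigr => j _; rewrite -kq.
Qed.
End Kaluza.

(* The renewal coefficients write [W n.+1] as a sub-convex combination of [a] and
   the earlier [W j], plus [k 0 *: F n.+1], so that the norms can be compared by
   induction. *)
Lemma discrete_kato (R : realType) (X : normedModType R) (k : nat -> R)
    (mu : R) (a : X) (F W : nat -> X) :
  (forall n, 0 < k n) -> (forall n, k n.+1 <= k n) ->
  (forall n, k n.+1 ^+ 2 <= k n * k n.+2) -> 0 <= mu ->
  (forall n, W n = a + conv k F n) -> forall n,
  `|W n| <= `|a| + conv k (fun n => `|F n + mu *: W n| - mu * `|W n| : R^o) n.
Proof.
move=> k0 kdec klc mu0 WE.
have [q kq] := renewal_exists k0.
have q0 := renewal_ge0 k0 klc kq; have q1 := renewal_sum k0 kdec klc kq.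
pose Q n : R^o := `|F n + mu *: W n| - mu * `|W n|.
pose z n := `|a| + conv k Q n.
have zE n : z n.+1 = (1 - \sum_(j < n.+1) q j) * `|a| + conv q (z : nat -> R^o) n + k 0 * Q n.+1.
  exact: (@renewal_rec _ _ _ kq R^o).
(* Add [(k 0 * mu) *: w] to both sides before taking norms: the factor [1 + k 0 * mu] gained on the
   left produces the term - mu |w|. *)
have step (b : X) (w : X) (v : X) c : w = b + k 0 *: v -> `|b| <= c ->
   `|w| <= c + k 0 * (`|v + mu *: w| - mu * `|w|).
  move=> wE bc.
  have kmu : 0 <= k 0 * mu by rewrite mulr_ge0 // ltW.
  have : `|w + (k 0 * mu) *: w| <= c + k 0 * `|v + mu *: w|.
    have -> : w + (k 0 * mu) *: w = b + k 0 *: (v + mu *: w).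
      by rewrite {1}wE scalerDr scalerA addrA.
    by apply: le_trans (ler_normD _ _) _; rewrite lerD // normrZ gtr0_norm.
  rewrite -{1}(scale1r w) -scalerDl normrZ ger0_norm ?addr_ge0 //; lra.
move=> n; rewrite -/(z n); elim/ltn_ind: n => -[|n] IH.
  rewrite /z /conv big_ord1 subnn; apply: (step a) => //.
  by rewrite WE /conv big_ord1 subnn.
rewrite zE; apply: (step ((1 - \sum_(j < n.+1) q j) *: a + conv q W n)).
  exact: renewal_rec.
apply: le_trans (ler_normD _ _) _; rewrite normrZ ger0_norm ?subr_ge0 // lerD2l.
apply: le_trans (ler_norm_sum _ _ _) _; apply: ler_sum => i _.
by rewrite normrZ ger0_norm // ler_wpM2l // IH // ltnS leq_subr.
Qed.

(** * The kernel of the fractional integral *)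

Section IntegrableReal.
Context d (U : measurableType d) (R : realType) (m : {measure set U -> \bar R}).
Variables (D : set U) (mD : measurable D) (f g : U -> R).
Hypotheses (fi : m.-integrable D (EFin \o f)) (gi : m.-integrable D (EFin \o g)).

Lemma integrableD_EFin : m.-integrable D (EFin \o (fun x => f x + g x)).
Proof. exact: (integrableD mD fi gi). Qed.

Lemma integrableB_EFin : m.-integrable D (EFin \o (fun x => f x - g x)).
Proof. exact: (integrableB mD fi gi). Qed.

Lemma integrableZl_EFin (k : R) : m.-integrable D (EFin \o (fun x => k * f x)).
Proof. exact: (integrableZl mD k fi). Qed.

Lemma integrableZr_EFin (k : R) : m.-integrable D (EFin \o (fun x => f x * k)).
Proof. exact: (integrableZr mD k fi). Qed.
End IntegrableReal.

Section SingularKernel.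
Context (R : realType) (alpha : R).
Hypotheses (alpha_gt0 : 0 < alpha) (alpha_lt1 : alpha < 1).
Local Notation mu := (@lebesgue_measure R).
Implicit Types (a b s t : R).

Definition kernel t s : R := (t - s) `^ (alpha - 1).

(* The integral of [kernel t] over ]a, b[ when a <= b <= t. *)
Definition kernel_mass a b t : R := ((t - a) `^ alpha - (t - b) `^ alpha) / alpha.

Lemma kernel_ge0 t s : 0 <= kernel t s.
Proof. exact: powR_ge0. Qed.

Lemma measurable_kernel t (D : set R) : measurable_fun D (kernel t).
Proof.
apply: (@measurableT_comp _ _ _ _ _ _ (fun x : R => x `^ (alpha - 1))).
  exact: measurable_powR.
exact: measurable_funB.
Qed.

Lemma is_derive_kernel t s : s < t ->
  is_derive s 1 (fun s => - ((t - s) `^ alpha / alpha)) (kernel t s).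
Proof.
move=> st.
have d1 : is_derive (t - s) 1 ((@powR R)^~ alpha) (alpha * (t - s) `^ (alpha - 1)).
  by apply: is_derive1_powR; rewrite subr_gt0.
have d2 : is_derive s 1 (fun s => t - s) (-1).
  by rewrite -(sub0r 1); apply: is_deriveB.
have d3 := @is_derive1_comp R ((@powR R)^~ alpha) (fun s => t - s) s _ _ d1 d2.
have -> : (fun s => - ((t - s) `^ alpha / alpha))
    = - alpha^-1 *: (((@powR R)^~ alpha) \o (fun s => t - s)).
  by apply/funext => x; rewrite -[RHS]/(- alpha^-1 * (t - x) `^ alpha) mulNr mulrC.
rewrite (_ : kernel t s = - alpha^-1 *: ((alpha * (t - s) `^ (alpha - 1)) * -1)).
  exact: is_deriveZ.
rewrite /kernel /GRing.scale /=; field; rewrite gt_eqF //.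
Qed.

Lemma integral_kernel_lt a b t : a < b -> b < t ->
  (\int[mu]_(s in `]a, b[) (kernel t s)%:E = (kernel_mass a b t)%:E)%E.
Proof.
move=> ab bt.
have bt' s : s <= b -> s < t by move=> sb; exact: le_lt_trans sb bt.
rewrite -(integral_itv_bndoo true false); last first.
  by apply/measurable_EFinP; exact: measurable_kernel.
pose F s := - ((t - s) `^ alpha / alpha).
have dF s : s < t -> derivable F s 1.
  by move=> st; have [] := is_derive_kernel st.
have cF s : s < t -> {for s, continuous F}.
  by move=> st; apply/differentiable_continuous; rewrite -derivable1_diffP; exact: dF.
rewrite (@continuous_FTC2 _ (kernel t) F) //.
- by rewrite /F /kernel_mass -EFinB opprK; congr EFin; rewrite addrC mulrBl.
- have ck s : s < t -> {for s, continuous (kernel t)}.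
    move=> st; apply: (@continuous_comp _ _ _ (fun s => t - s) (fun x => x `^ (alpha - 1))).
      by apply: cvgB; [exact: cvg_cst|exact: cvg_id].
    apply/differentiable_continuous; rewrite -derivable1_diffP.
    by apply: derivable_powR; rewrite in_itv /= andbT subr_gt0.
  apply: continuous_in_subspaceT => s; rewrite inE /= in_itv /= => /andP[_ sb].
  exact/ck/bt'.
- split.
  + by move=> s; rewrite in_itv /= => /andP[_ /ltW/bt'/dF].
  + by apply: cvg_at_right_filter; apply: cF; exact/bt'/ltW.
  + by apply: cvg_at_left_filter; apply: cF; exact/bt'.
- move=> s; rewrite in_itv /= => /andP[_ /ltW/bt' st].
  by rewrite derive1E; have [_ ->] := is_derive_kernel st.
Qed.

Lemma integral_kernel a b t : a <= b -> b <= t ->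
  (\int[mu]_(s in `]a, b[) (kernel t s)%:E = (kernel_mass a b t)%:E)%E.
Proof.
rewrite le_eqVlt => /orP[/eqP <- _|ab].
  by rewrite set_itvoo0 // integral_set0 /kernel_mass subrr mul0r.
rewrite le_eqVlt => /orP[/eqP bt|]; last exact: integral_kernel_lt.
subst b.
(* The singular endpoint is approached from below by monotone convergence; [n.+2] rather than [n.+1]
   keeps [a < t - e n], as [integral_kernel_lt] requires. *)
pose e n := (t - a) / n.+2%:R.
have ta : 0 < t - a by rewrite subr_gt0.
have e0 n : 0 < e n by rewrite divr_gt0.
have ea n : e n < t - a by rewrite ltr_pdivrMr // ltr_pMr // ltr1n.
have ce : e n @[n --> \oo] --> 0.
  apply: cvg_mulr0.
  by have := @cvg_harmonic R; rewrite -(cvg_shiftS (@harmonic R)).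
pose F n := `]a, t - e n[%classic.
have hF n : (\int[mu]_(s in F n) (kernel t s)%:E = (kernel_mass a (t - e n) t)%:E)%E.
  apply: integral_kernel_lt; first by have := ea n; lra.
  by have := e0 n; lra.
have UF : \bigcup_i F i = `]a, t[%classic.
  apply/seteqP; split => s.
    move=> [n _]; rewrite /F /= !in_itv /= => /andP[-> /= h].
    by apply: lt_trans h _; rewrite gtrBl.
  rewrite /= in_itv /= => /andP[as_ st].
  have : \forall n \near \oo, `|e n| < t - s.
    move/cvgrPdist_lt: ce => /(_ (t - s)); rewrite subr_gt0 => /(_ st).
    by apply: filterS => n; rewrite sub0r normrN.
  move=> [N _ /(_ N (leqnn _)) /=]; rewrite gtr0_norm // => eN.
  by exists N => //; rewrite /F /= in_itv /= as_ /=; lra.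
have c1 : (\int[mu]_(s in F n) (kernel t s)%:E)%E @[n --> \oo] -->
    (\int[mu]_(s in `]a, t[) (kernel t s)%:E)%E.
  rewrite -UF; apply: ge0_nondecreasing_set_cvg_integral => //.
  - apply/nondecreasing_seqP => n; apply/subsetPset => s.
    rewrite /F /= !in_itv /= => /andP[-> /= h]; apply: lt_le_trans h _.
    rewrite lerD2l lerN2 /e ler_pM2l // lef_pV2 ?posrE // ler_nat //.
  - by move=> n; exact: measurable_itv.
  - by move=> n; apply/measurable_EFinP; exact: measurable_kernel.
  - by move=> n s _; rewrite lee_fin kernel_ge0.
have c2 : (\int[mu]_(s in F n) (kernel t s)%:E)%E @[n --> \oo] --> (kernel_mass a t t)%:E.
  under eq_fun do rewrite hF.
  apply: cvg_EFin; first by apply: nearW.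
  rewrite /kernel_mass; apply: cvgM; last exact: cvg_cst.
  apply: cvgB; first exact: cvg_cst.
  rewrite subrr powR0 ?gt_eqF //.
  have -> : (fun n => (t - (t - e n)) `^ alpha) = (fun x => x `^ alpha) \o e.
    by apply/funext => n /=; rewrite opprB addrC subrK.
  by move/cvg_at_rightP : (powR_cvg0 alpha_gt0); apply; split.
exact: (cvg_unique _ c1 c2).
Qed.


Lemma integrable_kernel a b t : a <= b -> b <= t ->
  mu.-integrable `]a, b[ (EFin \o kernel t).
Proof.
move=> ab bt; apply/integrableP; split.
  by apply/measurable_EFinP; exact: measurable_kernel.
under eq_integral do rewrite /= ger0_norm ?kernel_ge0 //.
by rewrite integral_kernel // ltry.
Qed.

Lemma Rintegral_kernel a b t : a <= b -> b <= t ->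
  \int[mu]_(s in `]a, b[) kernel t s = kernel_mass a b t.
Proof. by move=> ab bt; rewrite /Rintegral integral_kernel. Qed.

Section BoundedFactor.
Variables (a b t : R) (f : R -> R) (M : R).
Hypotheses (ab : a <= b) (bt : b <= t) (mf : measurable_fun setT f).
Hypothesis fM : forall s, a < s < b -> `|f s| <= M.

Lemma integrable_kernelM : mu.-integrable `]a, b[ (EFin \o (fun s => kernel t s * f s)).
Proof.
have := @integrableZr _ _ _ mu _ (measurable_itv `]a, b[) M _ (integrable_kernel ab bt).
apply: le_integrable => //.
  apply/measurable_EFinP; apply: measurable_funM; first exact: measurable_kernel.
  exact: measurable_funS mf.
move=> s; rewrite /= in_itv /= => /fM fs; rewrite lee_fin !normrM.
rewrite ler_wpM2l //; apply: le_trans fs _; exact: ler_norm.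
Qed.

Lemma kernelM_le : `|\int[mu]_(s in `]a, b[) (kernel t s * f s)| <= M * kernel_mass a b t.
Proof.
apply: le_trans (le_normr_Rintegral _ integrable_kernelM) _ => //.
rewrite mulrC -Rintegral_kernel // -RintegralZr //; last exact: integrable_kernel.
apply: le_Rintegral => //.
- exact: (integrable_norm integrable_kernelM).
- exact: (@integrableZr _ _ _ mu _ (measurable_itv `]a, b[) M _ (integrable_kernel ab bt)).
- move=> s; rewrite /= in_itv /= => /fM fs.
  by rewrite normrM ger0_norm ?kernel_ge0 // ler_wpM2l ?kernel_ge0.
Qed.
End BoundedFactor.

Lemma Rintegral_itv_split a b c (g : R -> R) : a <= b -> b <= c ->
  mu.-integrable `]a, c[ (EFin \o g) ->
  \int[mu]_(s in `]a, c[) g s =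
  \int[mu]_(s in `]a, b[) g s + \int[mu]_(s in `]b, c[) g s.
Proof.
rewrite le_eqVlt => /orP[/eqP <-|ab].
  by rewrite (set_itvoo0 a) Rintegral_set0 add0r.
rewrite le_eqVlt => /orP[/eqP <-|bc].
  by rewrite (set_itvoo0 b) Rintegral_set0 addr0.
move=> ig.
have E : `]a, c[%classic = `]a, b[ `|` `[b, c[.
  by rewrite -itv_bndbnd_setU // bnd_simp ltW.
rewrite {1}E Rintegral_setU //; last 2 first.
- by rewrite -E.
- apply/disj_setPS => s [] /=; rewrite !in_itv /= => /andP[_ sb] /andP[bs _].
  by move: (lt_le_trans sb bs); rewrite ltxx.
congr (_ + _); rewrite /Rintegral; congr fine.
rewrite (integral_itv_bndoo true true) //.
apply: (@measurable_int _ _ _ mu).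
apply: (integrableS _ _ _ ig) => //.
by apply: subset_itvr; rewrite bnd_simp ltW.
Qed.


Lemma kernel_noninc s t t' : s < t -> t <= t' -> kernel t' s <= kernel t s.
Proof.
move=> st tt'; rewrite /kernel -(opprB 1 alpha) !powRN lef_pV2 ?posrE ?powR_gt0 ?subr_gt0 //.
  apply: ge0_ler_powR; rewrite ?nnegrE ?subr_ge0 ?(ltW alpha_lt1) //; first exact: ltW.
    by apply: ltW; exact: lt_le_trans tt'.
  by rewrite lerD2r.
exact: lt_le_trans tt'.
Qed.

(* The Riemann-Liouville integral without the factor 1 / Gamma alpha. *)
Definition rl_integral (f : R -> R) t : R := \int[mu]_(s in `]0, t[) (kernel t s * f s).

(** Split at [t]. On ]0, t[ the difference of the two kernels has a constant sign, so its mass is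
    computed exactly; each of the two pieces costs at most M (t' - t)^alpha / alpha. *)
Lemma Jr_holder (f : R -> R) (M : R) t t' : 0 <= t -> t <= t' ->
  measurable_fun setT f -> (forall s, 0 < s < t' -> `|f s| <= M) ->
  `|rl_integral f t' - rl_integral f t| <= 2 * M * ((t' - t) `^ alpha / alpha).
Proof.
move=> t0 tt' mf fM.
have [<-|ntt] := eqVneq t t'.
  by rewrite !subrr powR0 ?gt_eqF // mul0r mulr0 normr0.
have ltt : t < t' by rewrite lt_neqAle ntt.
have M0 : 0 <= M.
  by apply: le_trans (fM ((t + t') / 2) _); [exact: normr_ge0|apply/andP; split; lra].
have fMt s : 0 < s < t -> `|f s| <= M.
  by move=> /andP[s0 st]; apply: fM; rewrite s0 /=; exact: lt_le_trans tt'.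
have fMtt s : t < s < t' -> `|f s| <= M.
  by move=> /andP[s0 st]; apply: fM; rewrite st andbT; exact: le_lt_trans s0.
have i1 := integrable_kernelM t0 tt' mf fMt.
have i2 := integrable_kernelM t0 (lexx t) mf fMt.
have k1 := integrable_kernel t0 tt'.
have k2 := integrable_kernel t0 (lexx t).
rewrite /rl_integral (Rintegral_itv_split t0 tt'); last first.
  exact: (integrable_kernelM (le_trans t0 tt') (lexx _) mf fM).
rewrite addrAC -RintegralB //; apply: le_trans (ler_normD _ _) _.
rewrite -mulrA mulr2n mulrDl !mul1r; apply: lerD.
  apply: le_trans (le_normr_Rintegral _ _) _ => //; first exact: integrableB_EFin.
  apply: le_trans (_ : \int[mu]_(s in `]0, t[) ((kernel t s - kernel t' s) * M) <= _).
    apply: le_Rintegral => //.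
    - apply: (@integrable_norm _ _ _ mu); exact: integrableB_EFin.
    - by apply: integrableZr_EFin => //; exact: integrableB_EFin.
    - move=> s; rewrite /= in_itv /= => /andP[s0 st].
      rewrite -mulrBl normrM distrC [X in X * _]ger0_norm ?subr_ge0 ?kernel_noninc //.
      by rewrite ler_wpM2l ?subr_ge0 ?kernel_noninc // fMt // s0.
  rewrite RintegralZr //; last exact: integrableB_EFin.
  rewrite RintegralB // !Rintegral_kernel // mulrC ler_wpM2l //.
  rewrite /kernel_mass subrr powR0 ?gt_eqF // !subr0 -mulrBl ler_wpM2r ?invr_ge0 ?(ltW alpha_gt0) //.
  have : t `^ alpha <= t' `^ alpha.
    by apply: ge0_ler_powR; rewrite ?nnegrE ?(ltW alpha_gt0) // (le_trans t0).
  lra.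
apply: le_trans (kernelM_le tt' (lexx _) mf fMtt) _.
by rewrite ler_wpM2l // /kernel_mass subrr powR0 ?gt_eqF // subr0.
Qed.

Lemma kernel_mass_add a b c t :
  kernel_mass a b t + kernel_mass b c t = kernel_mass a c t.
Proof. rewrite /kernel_mass; lra. Qed.

(** The kernel is integrated exactly over each cell and only [f] is frozen, at the right endpoint,
    so the singularity does not enter the error. *)
Lemma Jr_grid (f : R -> R) (h e M t : R) (n : nat) : 0 <= h -> t = n.+1%:R * h ->
  measurable_fun setT f ->
  (forall s, 0 < s < t -> `|f s| <= M) ->
  (forall s r, 0 <= s <= t -> 0 <= r <= t -> `|s - r| <= h -> `|f s - f r| <= e) ->
  `|rl_integral f t - \sum_(i < n.+1) kernel_mass (i%:R * h) (i.+1%:R * h) t * f (i.+1%:R * h)|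
    <= e * kernel_mass 0 t t.
Proof.
move=> h0 tE mf fM fe.
have mt m : (m <= n.+1)%N -> m%:R * h <= t by move=> mn; rewrite tE ler_wpM2r // ler_nat.
have m0 m : 0 <= m%:R * h by rewrite mulr_ge0.
have mS m : m%:R * h <= m.+1%:R * h by rewrite ler_wpM2r // ler_nat.
suff H m : (m <= n.+1)%N -> `|\int[mu]_(s in `]0, m%:R * h[) (kernel t s * f s) -
    \sum_(i < m) kernel_mass (i%:R * h) (i.+1%:R * h) t * f (i.+1%:R * h)| <=
    e * kernel_mass 0 (m%:R * h) t by have := H n.+1 (leqnn _); rewrite -tE.
elim: m => [_|m IH mn].
  by rewrite mul0r set_itvoo0 Rintegral_set0 big_ord0 /kernel_mass !subrr mul0r mulr0 normr0.
have fMm s : 0 < s < m.+1%:R * h -> `|f s| <= M.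
  by move=> /andP[s0 st]; apply: fM; rewrite s0 /=; apply: lt_le_trans st _; exact: mt.
have fMm' s : m%:R * h < s < m.+1%:R * h -> `|f s| <= M.
  by move=> /andP[s0 st]; apply: fMm; rewrite st andbT; exact: le_lt_trans s0.
rewrite (Rintegral_itv_split (m0 m) (mS m)); last first.
  by apply: integrable_kernelM fMm => //; exact: mt.
rewrite big_ord_recr /= opprD addrACA -(kernel_mass_add 0 (m%:R * h)) mulrDr.
apply: le_trans (ler_normD _ _) _; apply: lerD; first exact/IH/ltnW.
rewrite -Rintegral_kernel //; last exact: mt.
rewrite -RintegralZr //; last by apply: integrable_kernel => //; exact: mt.
rewrite -RintegralB //; last 2 first.
- by apply: integrable_kernelM fMm' => //; exact: mt.
- apply: integrableZr_EFin => //.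
  by apply: integrable_kernel => //; exact: mt.
under eq_Rintegral do rewrite -mulrBr.
rewrite Rintegral_kernel //; last exact: mt.
apply: kernelM_le => //; first exact: mt.
  exact: measurable_funB.
move=> s /andP[ms sm].
apply: fe.
- apply/andP; split; first exact: le_trans (m0 m) (ltW ms).
  by apply: le_trans (ltW sm) _; exact: mt.
- by rewrite m0; exact: mt.
- have : m.+1%:R * h = m%:R * h + h by rewrite -natr1 mulrDl mul1r.
  by rewrite distrC ger0_norm ?subr_ge0 ?(ltW sm) //; lra.
Qed.


(* The fractional integral is small in norms weighted by exp (- l t), l large:
   this replaces Mittag-Leffler functions. *)
Lemma Jr_expR (T e : R) : 0 <= T -> 0 < e ->
  exists2 l, 0 < l & forall t, 0 <= t <= T ->
    rl_integral (fun s => expR (l * s)) t <= e * expR (l * t).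
Proof.
move=> T0 e0.
(* [d] is the width of the layer below [t] whose kernel mass is [e / 2]. The part before the layer
   is damped by [expR (- (l * d))], and [l] makes it at most [e / 2] too. *)
pose d := (e * alpha / 2) `^ alpha^-1.
have d0 : 0 < d by rewrite powR_gt0 // divr_gt0 // mulr_gt0.
have dE : d `^ alpha / alpha = e / 2.
  rewrite /d -powRrM mulVf ?gt_eqF // powRr1; first by field; rewrite gt_eqF.
  by rewrite divr_ge0 // mulr_ge0 // ltW.
pose K := T `^ alpha / alpha.
have K0 : 0 <= K by rewrite divr_ge0 ?powR_ge0 // ltW.
(* Chosen through [1 + x <= expR x]; the last [+ 1] keeps [l] positive when [T = 0]. *)
pose l := 2 * K / (e * d) + 1.
have l0 : 0 < l.
  by rewrite ltr_wpDl //; apply: divr_ge0; apply: mulr_ge0 => //; exact: ltW.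
have lK : expR (- (l * d)) * K <= e / 2.
  rewrite expRN mulrC ler_pdivrMr ?expR_gt0 //.
  apply: le_trans (_ : e / 2 * (l * d) <= _); last first.
    rewrite ler_wpM2l //; first by apply: divr_ge0 => //; exact: ltW.
    by have := expR_ge1Dx (l * d); lra.
  have -> : e / 2 * (l * d) = K + e / 2 * d.
    by rewrite /l; field; rewrite !gt_eqF.
  by rewrite lerDl; apply: mulr_ge0; [apply: divr_ge0 => //|]; exact: ltW.
exists l => // t /andP[t0 tT].
pose f s := expR (l * s).
have mf : measurable_fun setT f.
  apply: continuous_measurable_fun => s; apply: (@continuous_comp _ _ _ (fun s => l * s) expR).
    exact: mulrl_continuous.
  exact: continuous_expR.
have f_le b s : s <= b -> `|f s| <= f b.
  by move=> sb; rewrite ger0_norm ?expR_ge0 // ler_expR ler_wpM2l // ltW.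
have part a b : 0 <= a -> a <= b -> b <= t ->
    \int[mu]_(s in `]a, b[) (kernel t s * f s) <= f b * kernel_mass a b t.
  move=> a0 ab bt; apply: le_trans (ler_norm _) _; apply: kernelM_le => //.
  by move=> s /andP[_ /ltW sb]; exact: f_le.
have [td|dt] := leP t d.
  apply: le_trans (part 0 t (lexx _) t0 (lexx _)) _.
  rewrite mulrC /f ler_wpM2r ?expR_ge0 // /kernel_mass subrr subr0 powR0 ?gt_eqF // subr0.
  apply: le_trans (_ : d `^ alpha / alpha <= _); last by rewrite dE; lra.
  by rewrite ler_wpM2r ?invr_ge0 ?(ltW alpha_gt0) // ge0_ler_powR ?nnegrE // ltW.
have td0 : 0 <= t - d by rewrite subr_ge0 ltW.
have tdt : t - d <= t by rewrite gerBl ltW.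
rewrite /rl_integral -/f (Rintegral_itv_split td0 tdt); last first.
  by apply: (@integrable_kernelM 0 t t f (f t)) => // s /andP[_ /ltW]; exact: f_le.
have -> : e * expR (l * t) = e / 2 * f t + e / 2 * f t by rewrite /f; lra.
apply: lerD.
  apply: le_trans (part _ _ (lexx _) td0 tdt) _.
  rewrite {1}/f mulrBr expRD mulrC mulrCA -/(f t) mulrC ler_wpM2r ?expR_ge0 //.
  apply: le_trans lK; rewrite mulrC ler_wpM2l ?expR_ge0 // ler_wpM2r ?invr_ge0 ?(ltW alpha_gt0) //.
  rewrite subr0; have := powR_ge0 (t - (t - d)) alpha.
  have : t `^ alpha <= T `^ alpha by rewrite ge0_ler_powR ?nnegrE // ltW.
  lra.
apply: le_trans (part _ _ td0 tdt (lexx _)) _.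
rewrite mulrC ler_wpM2r ?expR_ge0 // -dE /kernel_mass subrr powR0 ?gt_eqF // subr0.
by rewrite opprB addrC subrK.
Qed.

(** The quadrature weight ((n + 1)^alpha - n^alpha) / alpha of the unit cell at distance [n] from
    the singularity. *)
Definition weight (n : nat) : R := kernel_mass 0 1 n.+1%:R.

(** Homogeneity of the kernel: on a uniform grid the weights of [Jr_grid] depend on [n - i] only, so
    the quadrature is a discrete convolution. *)
Lemma kernel_mass_scale (h : R) (i n : nat) : 0 <= h -> (i <= n)%N ->
  kernel_mass (i%:R * h) (i.+1%:R * h) (n.+1%:R * h) = h `^ alpha * weight (n - i).
Proof.
move=> h0 i_n; rewrite /weight /kernel_mass mulrA; congr (_ / _).
rewrite -!mulrBl !powRM ?subr_ge0 ?ler_nat //; last exact: leqW.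
rewrite subr0 -subSn // natrB; last exact: leqW.
have -> : (n.+1%:R - i%:R - 1 : R) = n.+1%:R - i.+1%:R by rewrite -natr1; ring.
by rewrite mulrBr mulrC [X in _ - X]mulrC.
Qed.

Let n1 n : 1 <= n.+1%:R :> R.
Proof. by rewrite ler1n. Qed.

Lemma weightE n : weight n = \int[mu]_(s in `]0, 1[) kernel n.+1%:R s.
Proof. by rewrite Rintegral_kernel. Qed.

Lemma weight_gt0 n : 0 < weight n.
Proof.
rewrite divr_gt0 // subr_gt0 subr0 gt0_ltr_powR // ?nnegrE ?subr_ge0 //.
by rewrite gtrBl.
Qed.

Lemma weight_noninc n : weight n.+1 <= weight n.
Proof.
rewrite !weightE; apply: le_Rintegral => //; try exact: integrable_kernel.
move=> s; rewrite /= in_itv /= => /andP[s0 s1]; apply: kernel_noninc.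
  exact: lt_le_trans (n1 n).
by rewrite ler_nat.
Qed.

(** The kernel is log-convex pointwise since x (x + 2) <= (x + 1)^2. To integrate this quadratic
    condition over the cell it is written in the equivalent linear form 2 q <= l p + r / l for all l
    > 0; afterwards l is the optimal ratio of two weights. *)
Lemma weight_logconvex n : weight n.+1 ^+ 2 <= weight n * weight n.+2.
Proof.
have H l : 0 < l -> 2 * weight n.+1 <= l * weight n + l^-1 * weight n.+2.
  move=> l0; have l0' := ltW l0; rewrite !weightE.
  have ik m : mu.-integrable `]0, 1[ (EFin \o kernel m.+1%:R) by exact: integrable_kernel.
  rewrite -!RintegralZl // -RintegralD //; try exact: integrableZl_EFin.
  apply: le_Rintegral => //; try exact: integrableZl_EFin.
    by apply: integrableD_EFin => //; exact: integrableZl_EFin.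
  move=> s; rewrite /= in_itv /= => /andP[s0 s1].
  rewrite /kernel; set x := n.+1%:R - s.
  have x0 : 0 < x by rewrite subr_gt0; exact: lt_le_trans (n1 n).
  have -> : n.+2%:R - s = x + 1 by rewrite /x -(natr1 n.+1); ring.
  have -> : n.+3%:R - s = x + 2 by rewrite /x -(natr1 n.+2) -(natr1 n.+1); ring.
  clearbody x; set p := x `^ _; set q := (x + 1) `^ _; set r := (x + 2) `^ _.
  have p0 : 0 < p by exact: powR_gt0.
  have qpr : q ^+ 2 <= p * r.
    rewrite /p /q /r -powRM ?(ltW x0) ?addr_ge0 ?(ltW x0) //.
    rewrite expr2 -powRM ?addr_ge0 ?(ltW x0) // -(opprB 1 alpha) !powRN.
    have xx : 0 < x * (x + 2) by rewrite mulr_gt0 // addr_gt0.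
    have yy : 0 < (x + 1) * (x + 1) by rewrite mulr_gt0 // addr_gt0.
    rewrite lef_pV2 ?posrE ?powR_gt0 //.
    apply: ge0_ler_powR; rewrite ?nnegrE ?subr_ge0 ?(ltW alpha_lt1) ?(ltW xx) ?(ltW yy) //; lra.
  have lp : 0 < l * p by rewrite mulr_gt0.
  rewrite -(ler_pM2r lp) [leRHS]mulrDl.
  have -> : l^-1 * r * (l * p) = p * r by field; rewrite gt_eqF.
  have := sqr_ge0 (l * p - q); nra.
have w0 := weight_gt0 n; have w1 := weight_gt0 n.+1.
have := H (weight n.+1 / weight n) (divr_gt0 w1 w0).
rewrite divfK ?gt_eqF // invf_div => h.
have : weight n.+1 <= weight n * weight n.+2 / weight n.+1.
  by rewrite mulrAC; lra.
by rewrite ler_pdivlMr // expr2.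
Qed.

End SingularKernel.

(** * Strong measurability and the Bochner integral *)

Section AeIntegral.
Context d (U : measurableType d) (R : realType) (m : {measure set U -> \bar R}).
Local Open Scope ereal_scope.

(* Unlike the library's [ge0_ae_eq_integral], no measurability is needed: the
   integral of a nonnegative function is a supremum over simple minorants. *)
Lemma ge0_ae_le_integralT (f g : U -> \bar R) :
  (forall x, 0 <= f x) -> (forall x, 0 <= g x) ->
  {ae m, forall x, f x <= g x} -> \int[m]_x f x <= \int[m]_x g x.
Proof.
move=> f0 g0 [N [mN N0 fgN]].
rewrite (ge0_integralTE _ f0); apply: ge_ereal_sup => _ [h hf <-].
pose h' : {nnsfun U >-> R} := proj_nnsfun h (measurableC mN).
have h'E x : h' x = (h x * \1_(~` N) x)%R by [].
have -> : sintegral m h = sintegral m h'.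
  rewrite -!integralT_nnsfun; apply: ge0_ae_eq_integral => //.
  - exact/measurable_EFinP.
  - exact/measurable_EFinP.
  - by move=> x _; rewrite lee_fin.
  - by move=> x _; rewrite lee_fin.
  - exists N; split => // x /= /not_implyP[_]; apply: contra_notP => xN.
    by have := h'E x; rewrite /= indicE mem_set ?mulr1 // => ->.
rewrite (ge0_integralTE _ g0); apply: ereal_sup_ubound; exists h' => // x /=.
have := h'E x; rewrite /= indicE => ->; have [xN|xN] := pselect (N x).
  by rewrite memNset ?mulr0 //=; apply: contrapT.
rewrite mem_set // mulr1; apply: le_trans (hf x) _.
by apply: contrapT => fg; exact/xN/fgN.
Qed.

(** Positive and negative parts are compared by [ge0_ae_le_integralT], so representatives can be
    exchanged without any measurability check. *)
Lemma ae_integral_eq (D : set U) (f g : U -> \bar R) :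
  {ae m, forall x, D x -> f x = g x} ->
  \int[m]_(x in D) f x = \int[m]_(x in D) g x.
Proof.
move=> fg; rewrite integral_mkcond [RHS]integral_mkcond integralE [RHS]integralE.
have E : {ae m, forall x, (f \_ D) x = (g \_ D) x}.
  apply: filterS fg => x fgx; rewrite /patch; case: ifPn => //.
  by rewrite inE; exact: fgx.
by congr (_ - _); apply/eqP; rewrite eq_le; apply/andP; split;
  apply: ge0_ae_le_integralT => //; apply: filterS E => x Ex;
  rewrite ?funeposE ?funenegE Ex.
Qed.

Lemma ae_Rintegral_eq (D : set U) (f g : U -> R) :
  {ae m, forall x, D x -> f x = g x} ->
  (\int[m]_(x in D) f x = \int[m]_(x in D) g x)%R.
Proof.
move=> fg; rewrite /Rintegral; congr fine; apply: ae_integral_eq.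
by apply: filterS fg => x + Dx => /(_ Dx) ->.
Qed.
End AeIntegral.

Section FiniteRange.
Context d (U : measurableType d).

(* [simple] over an arbitrary measurable space and with arbitrary values. *)
Definition fsimple (Y : Type) (s : U -> Y) : Prop :=
  finite_set (range s) /\ forall y, measurable (s @^-1` [set y]).

Lemma fsimple_preimage (Y : Type) (s : U -> Y) (A : set Y) :
  fsimple s -> measurable (s @^-1` A).
Proof.
move=> [fs ms].
have -> : s @^-1` A = \bigcup_(y in range s `&` A) s @^-1` [set y].
  apply/seteqP; split => [x Ax|x [y [_ Ay] /= sxy]]; last by rewrite /= sxy.
  by exists (s x) => //; split => //; exact: imageT.
by apply: fin_bigcup_measurable => //; exact: finite_setIl.
Qed.

Lemma fsimple_map (Y Z : Type) (g : Y -> Z) (s : U -> Y) :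
  fsimple s -> fsimple (g \o s).
Proof.
move=> ss; have [fs _] := ss; split.
  apply: (sub_finite_set (B := g @` range s)); last exact: finite_image.
  by move=> _ [x _ <-]; exists (s x) => //; exact: imageT.
by move=> z; rewrite -[X in measurable X]/(s @^-1` (g @^-1` [set z])); exact: fsimple_preimage.
Qed.

Lemma fsimple_pair (Y Z : Type) (s : U -> Y) (r : U -> Z) :
  fsimple s -> fsimple r -> fsimple (fun x => (s x, r x)).
Proof.
move=> [fs ms] [fr mr]; split.
  apply: sub_finite_set (finite_setX fs fr) => _ [x _ <-]; split; exact: imageT.
move=> [y z].
have -> : (fun x => (s x, r x)) @^-1` [set (y, z)] = s @^-1` [set y] `&` r @^-1` [set z].
  by apply/seteqP; split => x /= [sy rz]; rewrite sy rz.
exact: measurableI.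
Qed.

Lemma fsimple_cst (Y : Type) (y : Y) : fsimple (fun=> y : Y).
Proof.
split; first by apply: sub_finite_set (finite_set1 y) => _ [x _ <-].
move=> z; have [->|zy] := pselect (z = y).
  rewrite (_ : _ @^-1` _ = setT); first exact: measurableT.
  by apply/seteqP; split.
rewrite (_ : _ @^-1` _ = set0); first exact: measurable0.
by apply/seteqP; split => // x /= /esym.
Qed.

Lemma fsimple_measurable (R : realType) (s : U -> R) :
  fsimple s -> measurable_fun setT s.
Proof. by move=> ss _ B mB; rewrite setTI; exact: fsimple_preimage. Qed.

Lemma fsimple_indic (R : realType) (D : set U) : measurable D ->
  fsimple (\1_D : U -> R).
Proof.
move=> mD; split.
  apply: (sub_finite_set (B := [set (0 : R); 1])); last exact: finite_set2.
  by move=> _ [x _ <-]; rewrite indicE; case: (_ \in _); [right|left].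
move=> y; have := @measurable_indic _ _ R setT D mD.
by move=> /(_ measurableT [set y] (measurable_set1 _)); rewrite setTI.
Qed.
End FiniteRange.

Lemma fsimple_comp d d' (U : measurableType d) (V : measurableType d')
    (Y : Type) (s : V -> Y) (phi : U -> V) :
  measurable_fun setT phi -> fsimple s -> fsimple (s \o phi).
Proof.
move=> mphi [fs ms]; split.
  by apply: sub_finite_set fs => _ [x _ <-]; exact: imageT.
move=> y; rewrite comp_preimage -[X in measurable X]setTI.
by apply: mphi => //; exact: measurableT.
Qed.

Lemma fsimple_approx d (U : measurableType d) (R : realType) (k : U -> R) :
  measurable_fun setT k -> exists r : nat -> U -> R,
    (forall n, fsimple (r n)) /\ forall x, r n x @[n --> \oo] --> k x.
Proof.
move=> mk.
have pos (h : U -> R) : measurable_fun setT h -> (forall x, 0 <= h x) ->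
    exists r : nat -> U -> R,
    (forall n, fsimple (r n)) /\ forall x, r n x @[n --> \oo] --> h x.
  move=> mh h0; have mh' : measurable_fun setT (EFin \o h) by exact/measurable_EFinP.
  exists (nnsfun_approx measurableT mh'); split => [n|x].
    split; first exact: fimfunP.
    move=> y; rewrite -[X in measurable X]setTI; exact: measurable_funP.
  have h0' x' : setT x' -> (0 <= (EFin \o h) x')%E by move=> _; rewrite lee_fin.
  by have /fine_cvgP[_] := @cvg_nnsfun_approx _ _ _ _ measurableT _ mh' h0' x I.
have [p [pp pk]] := pos (fun x => Num.max (k x) 0)
  ltac:(exact: measurable_maxr) (fun x => ltac:(by rewrite le_max lexx orbT)).
have [q [qq qk]] := pos (fun x => Num.max (- k x) 0)
  ltac:(apply: measurable_maxr => //; exact: measurableT_comp) (fun x => ltac:(by rewrite le_max lexx orbT)).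
exists (fun n x => p n x - q n x); split => n.
  exact: (fsimple_map (fun p => p.1 - p.2) (fsimple_pair (pp n) (qq n))).
rewrite [X in _ --> X](_ : k n = Num.max (k n) 0 - Num.max (- k n) 0).
  by apply: cvgB.
by rewrite /Num.max; case: ltgtP => h; case: ltgtP => h'; lra.
Qed.

Section SimpleLimit.
Context d (U : measurableType d) (R : realType) (X : normedModType R).

(** Convergence everywhere, over an arbitrary measurable space: such functions can be composed with
    measurable maps, in particular with the projections of the plane, whereas convergence up to a
    null set need not survive composition. *)
Definition simple_limit (f : U -> X) : Prop := exists s : nat -> U -> X,
  (forall n, fsimple (s n)) /\ forall x, s n x @[n --> \oo] --> f x.

Lemma simple_limit_comp d' (V : measurableType d') (f : U -> X) (phi : V -> U) :
  measurable_fun setT phi -> simple_limit f ->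
  exists s : nat -> V -> X,
    (forall n, fsimple (s n)) /\ forall x, s n x @[n --> \oo] --> f (phi x).
Proof.
move=> mphi [s [ss sf]]; exists (fun n => s n \o phi); split => n.
  exact: fsimple_comp.
exact: sf.
Qed.

Lemma simple_limit_cst (x : X) : simple_limit (fun=> x).
Proof. by exists (fun=> fun=> x); split => n; [exact: fsimple_cst|exact: cvg_cst]. Qed.

Lemma simple_limitD f g : simple_limit f -> simple_limit g ->
  simple_limit (fun x => f x + g x).
Proof.
move=> [s [ss sf]] [r [rr rg]]; exists (fun n x => s n x + r n x); split => n.
  exact: (fsimple_map (fun p => p.1 + p.2) (fsimple_pair (ss n) (rr n))).
by apply: cvgD; [exact: sf|exact: rg].
Qed.

Lemma simple_limitN f : simple_limit f -> simple_limit (fun x => - f x).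
Proof.
move=> [s [ss sf]]; exists (fun n x => - s n x); split => n.
  exact: (fsimple_map -%R (ss n)).
by apply: cvgN; exact: sf.
Qed.

Lemma simple_limit_indic f D : measurable D -> simple_limit f ->
  simple_limit (fun x => (\1_D x : R) *: f x).
Proof.
move=> mD [s [ss sf]]; exists (fun n x => (\1_D x : R) *: s n x); split => n.
  exact: (fsimple_map (fun p => p.1 *: p.2) (fsimple_pair (fsimple_indic R mD) (ss n))).
by apply: cvgZr; exact: sf.
Qed.

Lemma simple_limit_scale (k : U -> R) f : measurable_fun setT k ->
  simple_limit f -> simple_limit (fun x => k x *: f x).
Proof.
move=> /fsimple_approx[r [rr rk]] [s [ss sf]].
exists (fun n x => r n x *: s n x); split => n.
  exact: (fsimple_map (fun p => p.1 *: p.2) (fsimple_pair (rr n) (ss n))).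
by apply: cvgZ; [exact: rk|exact: sf].
Qed.

Lemma simple_limit_continuous (f : R -> X) (k : U -> R) :
  continuous f -> measurable_fun setT k -> simple_limit (fun x => f (k x)).
Proof.
move=> cf /fsimple_approx[r [rr rk]].
exists (fun n x => f (r n x)); split => n; first exact: (fsimple_map f (rr n)).
exact: (cvg_comp _ _ (rk n) (cf _)).
Qed.

Lemma simple_limit_norm f : simple_limit f -> measurable_fun setT (fun x => `|f x|).
Proof.
move=> [s [ss sf]]; apply: (@measurable_fun_cvg _ _ _ _ (fun n x => `|s n x|)).
  by move=> n; exact/fsimple_measurable/(fsimple_map Num.norm).
by move=> x _; apply: cvg_norm; exact: sf.
Qed.
End SimpleLimit.

Lemma simple_limit_dot d (U : measurableType d) (R : realType) (X : completeNormedModType R)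
    (dot : {dot X for idfun}) (f g : U -> X) : (forall x : X, `|x| ^+ 2 = dot x x) ->
  simple_limit f -> simple_limit g -> measurable_fun setT (fun x => dot (f x) (g x)).
Proof.
move=> norm_dot [s [ss sf]] [r [rr rg]].
apply: (@measurable_fun_cvg _ _ _ _ (fun n x => dot (s n x) (r n x))).
  move=> n; apply: fsimple_measurable.
  exact: (fsimple_map (fun p => dot p.1 p.2) (fsimple_pair (ss n) (rr n))).
by move=> x _; apply: dot_cvg.
Qed.

Section AeLebesgue.
Context (R : realType).
Local Notation mu := (@lebesgue_measure R).
Implicit Types P Q S : R -> Prop.

Lemma ae_imp P Q : (forall t, P t -> Q t) ->
  {ae mu, forall t, P t} -> {ae mu, forall t, Q t}.
Proof.
by move=> PQ [N [mN N0 h]]; exists N; split => // t /= nQ; apply: h => /PQ.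
Qed.

Lemma ae_imp2 P Q S : (forall t, P t -> Q t -> S t) ->
  {ae mu, forall t, P t} -> {ae mu, forall t, Q t} -> {ae mu, forall t, S t}.
Proof.
move=> PQS nP nQ; apply: (negligibleS _ (negligibleU nP nQ)) => t /= nS.
have [Pt|nPt] := pselect (P t); last by left.
by right => Qt; exact/nS/PQS.
Qed.

Lemma ae_true P : (forall t, P t) -> {ae mu, forall t, P t}.
Proof.
move=> h; exists set0; split; [exact: measurable0|exact: measure0|].
by move=> t /=; apply; exact: h.
Qed.

Lemma lebesgue_integral_ae (D : set R) (f g : R -> \bar R) :
  {ae mu, forall t, D t -> f t = g t} ->
  (\int[mu]_(t in D) f t = \int[mu]_(t in D) g t)%E.
Proof. exact: (ae_integral_eq (m := mu)). Qed.

Lemma lebesgue_Rintegral_ae (D : set R) (f g : R -> R) :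
  {ae mu, forall t, D t -> f t = g t} ->
  \int[mu]_(t in D) f t = \int[mu]_(t in D) g t.
Proof. exact: (ae_Rintegral_eq (m := mu)). Qed.
End AeLebesgue.

Section Bochner.
Context (R : realType) (X : completeNormedModType R).
Context (dot : {dot X for idfun}) (norm_dot : forall x : X, `|x| ^+ 2 = dot x x).
Local Notation mu := (@lebesgue_measure R).
Implicit Types (D : set R) (f g v : R -> X).

Definition simple_limitR (f : R -> X) := @simple_limit _ (measurableTypeR R) R X f.

(** The representative and the simple functions approximating it are set to 0 outside [D] and on the
    exceptional null set. *)
Lemma strongly_measurable_rep D v : measurable D ->
  strongly_measurable setT Num.norm D v ->
  exists2 v', simple_limitR v' & {ae mu, forall t, D t -> v t = v' t}.
Proof.
move=> mD [_ [s [ss [N [mN N0 hN]]]]].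
have mDN : measurable (D `\` N) by exact: measurableD.
exists (fun t => (\1_(D `\` N) t : R) *: v t).
  exists (fun n t => (\1_(D `\` N) t : R) *: s n t); split => [n|t].
    have [sn _] := ss n.
    exact: (fsimple_map (fun p => p.1 *: p.2) (fsimple_pair (fsimple_indic R mDN) sn)).
  rewrite indicE; have [tDN|tDN] := pselect ((D `\` N) t); last first.
    rewrite memNset // scale0r; under eq_fun do rewrite scale0r; exact: cvg_cst.
  rewrite mem_set // scale1r; under eq_fun do rewrite scale1r.
  case: tDN => Dt Nt; apply/subr_cvg0/norm_cvg0P.
  under eq_fun do rewrite distrC.
  by apply: contrapT => h; apply/Nt/hN => /(_ Dt).
exists N; split => // t /= /not_implyP[Dt]; apply: contra_notP => Nt.
by rewrite indicE mem_set // scale1r.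
Qed.

Lemma strongly_measurableI D v v' : simple_limitR v' ->
  {ae mu, forall t, D t -> v t = v' t} -> strongly_measurable setT Num.norm D v.
Proof.
move=> [s [ss sv]] vv'; split; first exact: ae_true.
exists s; split; first by move=> n; split; [exact: ss|].
apply: ae_imp vv' => t h Dt; rewrite h //.
under eq_fun do rewrite distrC.
by apply: cvg_dist0; exact: sv.
Qed.

Lemma Rintegral_sum D (I : Type) (r : seq I) (F : I -> R -> R) : measurable D ->
  (forall i, mu.-integrable D (EFin \o F i)) ->
  mu.-integrable D (EFin \o (fun t => \sum_(i <- r) F i t)) /\
  \int[mu]_(t in D) \sum_(i <- r) F i t = \sum_(i <- r) \int[mu]_(t in D) F i t.
Proof.
move=> mD iF; elim: r => [|i r [IH1 IH2]].
  split; last by rewrite big_nil; under eq_Rintegral do rewrite big_nil; rewrite Rintegral_cst // mul0r.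
  rewrite (_ : EFin \o _ = cst 0%E); first exact: integrable0.
  by apply/funext => t; rewrite /= big_nil.
split; last first.
  rewrite big_cons -IH2 -RintegralD //.
  by apply: eq_Rintegral => t _; rewrite big_cons.
rewrite (_ : (fun t => _) = (fun t => F i t + \sum_(j <- r) F j t)).
  exact: integrableD_EFin.
by apply/funext => t; rewrite big_cons.
Qed.

Lemma simple_integral_dot D (s : R -> X) y : measurable D -> (mu D < +oo)%E ->
  simple s ->
  mu.-integrable D (EFin \o (fun t => dot (s t) y)) /\
  dot (simple_integral D s) y = \int[mu]_(t in D) dot (s t) y.
Proof.
move=> mD Dfin [fs ms].
pose F x t := dot x y * \1_(s @^-1` [set x]) t.
have iI x : mu.-integrable D (EFin \o (\1_(s @^-1` [set x]) : R -> R)).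
  apply: measurable_bounded_integrable => //.
  exists 1; split; first exact: num_real.
  move=> M M1 t _ /=; rewrite indicE; apply: le_trans (ltW M1).
  by case: (_ \in _); rewrite /= ?normr1 ?normr0.
have iF x : mu.-integrable D (EFin \o F x) by exact: integrableZl_EFin.
have sE t : dot (s t) y = \sum_(x <- fset_set (range s)) F x t.
  rewrite (bigD1_seq (s t)) ?fset_uniq //=; last first.
    by rewrite in_fset_set // inE; exact: imageT.
  rewrite /F indicE mem_set // mulr1 big1 ?addr0 // => x xs.
  by rewrite indicE memNset ?mulr0 //= => sx; rewrite sx eqxx in xs.
have [i1 i2] := Rintegral_sum (fset_set (range s)) mD iF.
split; first by rewrite (_ : (fun t => _) = (fun t => \sum_(x <- fset_set (range s)) F x t)) //; apply/funext.
under eq_Rintegral do rewrite sE.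
rewrite i2 /simple_integral fsbig_finite //=.
rewrite (big_morph (fun x => dot x y) (fun a b => dotDl dot a b y) (dot0l dot y)).
apply: eq_bigr => x _; rewrite dotZl /F RintegralZl //.
by rewrite /Rintegral integral_indic // setIC mulrC.
Qed.

Lemma simple_limitR_norm_integrable D f : measurable D -> simple_limitR f ->
  (\int[mu]_(t in D) `|f t|%:E < +oo)%E ->
  mu.-integrable D (EFin \o (fun t => `|f t|)).
Proof.
move=> mD sf fi; apply/integrableP; split.
  by apply/measurable_EFinP; apply: measurable_funTS; exact: simple_limit_norm.
by under eq_integral do rewrite /= normr_id.
Qed.

Lemma simple_limitR_dot_integrable D f y : measurable D -> simple_limitR f ->
  (\int[mu]_(t in D) `|f t|%:E < +oo)%E ->
  mu.-integrable D (EFin \o (fun t => dot (f t) y)).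
Proof.
move=> mD sf fi.
have i1 := simple_limitR_norm_integrable mD sf fi.
have := integrableZr_EFin (m := mu) mD i1 `|y|; apply: le_integrable => //.
  apply/measurable_EFinP; apply: measurable_funTS.
  by apply: (simple_limit_dot norm_dot sf); exact: simple_limit_cst.
by move=> t Dt /=; rewrite lee_fin [leRHS]ger0_norm ?mulr_ge0 //; exact: dot_le.
Qed.

Lemma integral_dot_le D f y : measurable D -> simple_limitR f ->
  (\int[mu]_(t in D) `|f t|%:E < +oo)%E ->
  `|\int[mu]_(t in D) dot (f t) y| <= (\int[mu]_(t in D) `|f t|) * `|y|.
Proof.
move=> mD sf fi.
have i1 := simple_limitR_norm_integrable mD sf fi.
have i2 := simple_limitR_dot_integrable y mD sf fi.
apply: le_trans (le_normr_Rintegral (mu := mu) mD i2) _.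
rewrite -RintegralZr //; apply: le_Rintegral => //.
- exact: (integrable_norm i2).
- exact: integrableZr_EFin.
- by move=> t _; exact: dot_le.
Qed.

Lemma integral_norm_ae D f g : {ae mu, forall t, D t -> f t = g t} ->
  (\int[mu]_(t in D) `|f t|%:E = \int[mu]_(t in D) `|g t|%:E)%E.
Proof. by move=> fg; apply: lebesgue_integral_ae; apply: ae_imp fg => t h Dt; rewrite h. Qed.

Lemma simple_limitRB f g : simple_limitR f -> simple_limitR g -> simple_limitR (fun t => f t - g t).
Proof. by move=> sf sg; apply: simple_limitD => //; exact: simple_limitN. Qed.

Lemma simple_limitR_simple (s : R -> X) : simple s -> simple_limitR s.
Proof. by move=> ss; exists (fun=> s); split => [_|t]; [exact: ss|exact: cvg_cst]. Qed.

Lemma simple_integral_dist D f s y : measurable D -> (mu D < +oo)%E ->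
  simple_limitR f -> (\int[mu]_(t in D) `|f t|%:E < +oo)%E -> simple s ->
  (\int[mu]_(t in D) `|f t - s t|%:E)%E \is a fin_num ->
  `|dot (simple_integral D s) y - \int[mu]_(t in D) dot (f t) y| <=
    fine (\int[mu]_(t in D) `|f t - s t|%:E) * `|y|.
Proof.
move=> mD Dfin sf fi ss fn.
have [i1 ->] := simple_integral_dot y mD Dfin ss.
have i2 := simple_limitR_dot_integrable y mD sf fi.
have iN : (\int[mu]_(t in D) `|f t - s t|%:E < +oo)%E by rewrite ltey_eq fn.
rewrite distrC -(RintegralB (mu := mu) mD i2 i1).
under eq_Rintegral do rewrite -dotBl.
by apply: integral_dot_le => //; apply: simple_limitRB => //; exact: simple_limitR_simple.
Qed.

(** Both sides are limits of the paired simple integrals. As the right side does not mention the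
    approximating sequence, the Bochner integral is unique, and the value selected by [xget] can be
    computed weakly. *)
Lemma is_bochner_dot D f x y : measurable D -> (mu D < +oo)%E ->
  (\int[mu]_(t in D) `|f t|%:E < +oo)%E -> is_bochner_integral D f x ->
  dot x y = \int[mu]_(t in D) dot (f t) y.
Proof.
move=> mD Dfin fi [sm [s [ss sf sx]]].
have [f' sf' ff'] := strongly_measurable_rep mD sm.
rewrite (integral_norm_ae ff') in fi.
rewrite (lebesgue_Rintegral_ae (g := fun t => dot (f' t) y)); last first.
  by apply: ae_imp ff' => t h Dt; rewrite h.
have {}sf : (\int[mu]_(t in D) `|f' t - s n t|%:E)%E @[n --> \oo] --> 0%E.
  have E n : (\int[mu]_(t in D) `|f t - s n t|%:E = \int[mu]_(t in D) `|f' t - s n t|%:E)%E.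
    by apply: (@integral_norm_ae D (fun t => f t - s n t)); apply: ae_imp ff' => t h Dt; rewrite h.
  by move: sf; under eq_fun do rewrite E.
have c1 : dot (simple_integral D (s n)) y @[n --> \oo] --> dot x y.
  by apply: dot_cvg => //; exact: cvg_cst.
suff c2 : dot (simple_integral D (s n)) y @[n --> \oo] --> \int[mu]_(t in D) dot (f' t) y.
  exact: (cvg_unique _ c1 c2).
move/fine_cvgP : sf => [fin sf].
apply/subr_cvg0/norm_cvg0P.
apply: (@squeeze_cvgr _ _ _ _ (fun=> 0) (fun n => fine (\int[mu]_(t in D) `|f' t - s n t|%:E)%E * `|y|)).
- by apply: filterS fin => n fn; rewrite normr_ge0 /=; exact: simple_integral_dist.
- exact: cvg_cst.
- by rewrite -(mul0r `|y|); apply: cvgM => //; exact: cvg_cst.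
Qed.

(** The value is given by the Riesz theorem, applied to the bounded functional that integrates
    [dot (f' t) y]; dominated convergence then shows that the integrals of truncated simple
    functions tend to it. *)
Lemma bochner_exists D f : measurable D -> (mu D < +oo)%E ->
  strongly_measurable setT Num.norm D f ->
  (\int[mu]_(t in D) `|f t|%:E < +oo)%E -> exists x, is_bochner_integral D f x.
Proof.
move=> mD Dfin sm fi.
have [f' sf' ff'] := strongly_measurable_rep mD sm.
have fi' : (\int[mu]_(t in D) `|f' t|%:E < +oo)%E by rewrite -(integral_norm_ae ff').
have [s [ss sf]] := sf'.
(* [s n] is cut off where it exceeds 2 |f'|. Pointwise convergence survives, since the bound holds
   eventually wherever f' is nonzero, and 3 |f'| dominates the error. *)
pose E n := [set t : measurableTypeR R | `|s n t| <= 2 * `|f' t|].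
pose r n t : X := (\1_(E n) t : R) *: s n t.
have ms n : measurable_fun setT (fun t => `|s n t|).
  by apply: fsimple_measurable; exact: (fsimple_map Num.norm (ss n)).
have mf := simple_limit_norm sf'.
have rr n : simple (r n).
  have mE : measurable (E n).
    have := measurable_fun_ler (ms n) (measurable_funM (measurable_cst (2 : R)) mf).
    by move=> /(_ measurableT [set true] ltac:(by [])); rewrite setTI.
  exact: (fsimple_map (fun p => p.1 *: p.2) (fsimple_pair (fsimple_indic R mE) (ss n))).
have rE n t : `|s n t| <= 2 * `|f' t| -> r n t = s n t.
  by move=> h; rewrite /r indicE mem_set // scale1r.
have r0 n t : ~ `|s n t| <= 2 * `|f' t| -> r n t = 0.
  by move=> h; rewrite /r indicE memNset // scale0r.
have r_le n t : `|r n t| <= 2 * `|f' t|.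
  have [h|h] := pselect (`|s n t| <= 2 * `|f' t|); first by rewrite rE.
  by rewrite r0 // normr0 mulr_ge0.
have rf t : r n t @[n --> \oo] --> f' t.
  have [f0|f0] := eqVneq (f' t) 0.
    rewrite f0 (_ : (fun n => r n t) = fun=> 0); first exact: cvg_cst.
    apply/funext => n; apply/eqP; rewrite -normr_le0; apply: le_trans (r_le n t) _.
    by rewrite f0 normr0 mulr0.
  apply: cvg_trans (sf t); apply: near_eq_cvg.
  have nf : 0 < `|f' t| by rewrite normr_gt0.
  have /cvgrPdist_lt/(_ _ nf) := sf t.
  apply: filterS => n h; rewrite rE //.
  by have := ler_normB (f' t) (f' t - s n t); rewrite opprB addrC subrK; lra.
have i1 := simple_limitR_norm_integrable mD sf' fi'.
have mr n : measurable_fun D (fun t => `|f' t - r n t|%:E).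
  apply/measurable_EFinP; apply: measurable_funTS; apply: simple_limit_norm.
  by apply: simple_limitRB => //; exact: simple_limitR_simple.
have fr0 : (\int[mu]_(t in D) `|f' t - r n t|%:E)%E @[n --> \oo] --> 0%E.
  have [] := @dominated_convergence _ _ _ mu D mD (fun n t => `|f' t - r n t|%:E)
    (cst 0%E) (EFin \o (fun t => 3 * `|f' t|)) mr (measurable_cst _).
  - apply: ae_true => t _; apply: cvg_EFin; first by apply: nearW.
    apply/norm_cvg0P; rewrite -(subrr (f' t)); apply: cvgB; first exact: cvg_cst.
    exact: rf.
  - exact: (integrableZl_EFin (m := mu) mD i1).
  - apply: ae_true => t n _; rewrite /= normr_id lee_fin.
    by apply: le_trans (ler_normB _ _) _; have := r_le n t; lra.
  by move=> _ _; rewrite integral0.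
have fr0' := fr0; move/fine_cvgP : fr0' => [fin fr1].
have [x xE] : exists x, forall y, \int[mu]_(t in D) dot (f' t) y = dot y x.
  apply: (@riesz _ _ _ norm_dot _ (\int[mu]_(t in D) `|f' t|)).
    move=> c y z; rewrite -[RHS]/(c * (\int[mu]_(t in D) dot (f' t) y) + \int[mu]_(t in D) dot (f' t) z).
    rewrite -(RintegralZl (mu := mu)) //; last exact: simple_limitR_dot_integrable.
    rewrite -(RintegralD (mu := mu)) //; last 2 first.
    + by apply: (integrableZl_EFin (m := mu)) => //; exact: simple_limitR_dot_integrable.
    + exact: simple_limitR_dot_integrable.
    by apply: eq_Rintegral => t _; rewrite dotDr dotZr.
  by move=> y; exact: integral_dot_le.
exists x; split => //; exists r; split => //.
  move: fr0; apply: cvg_trans; apply: near_eq_cvg; apply: nearW => n.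
  by apply: (@integral_norm_ae D (fun t => f' t - r n t)); apply: ae_imp ff' => t h Dt; rewrite h.
apply/subr_cvg0/norm_cvg0P.
apply: (@squeeze_cvgr _ _ _ _ (fun=> 0) (fun n => fine (\int[mu]_(t in D) `|f' t - r n t|%:E)%E)) => //.
- apply: filterS fin => n fn; rewrite normr_ge0 /=.
  apply: (norm_le_dot norm_dot); first by apply: fine_ge0; exact: integral_ge0.
  move=> y; rewrite dotBl (dotC _ x) -xE; apply: le_trans (ler_norm _) _.
  exact: simple_integral_dist.
- exact: cvg_cst.
Qed.

Lemma bochner_dot D f y : measurable D -> (mu D < +oo)%E ->
  strongly_measurable setT Num.norm D f ->
  (\int[mu]_(t in D) `|f t|%:E < +oo)%E ->
  dot (bochner_integral D f) y = \int[mu]_(t in D) dot (f t) y.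
Proof.
move=> mD Dfin sm fi; apply: is_bochner_dot => //.
have [x xP] := bochner_exists mD Dfin sm fi.
exact: (@xgetPex _ 0 [set x | is_bochner_integral D f x] (ex_intro _ x xP)).
Qed.

End Bochner.

(** * Fractional integrals of continuous functions *)

Section Continuous.
Context (R : realType) (X : normedModType R).
Implicit Types (v : R -> X) (T : R).

(* Composition with [clamp T] extends functions on [0, T] to the line. *)
Definition clamp T t : R := Num.max 0 (Num.min t T).

Lemma clamp_itv T t : 0 <= T -> 0 <= clamp T t <= T.
Proof. by move=> T0; rewrite /clamp le_max lexx /= ge_max T0 /= ge_min lexx orbT. Qed.

Lemma clamp_id T t : 0 <= t <= T -> clamp T t = t.
Proof. by move=> /andP[t0 tT]; rewrite /clamp min_l // max_r. Qed.

Lemma clamp_dist T s t : `|clamp T s - clamp T t| <= `|s - t|.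
Proof.
have H x y : clamp T x - clamp T y <= `|x - y|.
  rewrite lerBlDr /clamp ge_max; apply/andP; split.
    by rewrite addr_ge0 // le_max lexx.
  rewrite -lerBlDl le_max; apply/orP; right; rewrite le_min; apply/andP; split.
    have := ler_norm (x - y); have : Num.min x T <= x by rewrite ge_min lexx.
    lra.
  have : Num.min x T <= T by rewrite ge_min lexx orbT.
  by have := normr_ge0 (x - y); lra.
by rewrite ler_norml H andbT lerNl opprB distrC H.
Qed.

Lemma continuous_bounded v T : continuous v ->
  exists2 M, 0 <= M & forall s, 0 <= s <= T -> `|v s| <= M.
Proof.
move=> cv; have [T0|T0] := leP 0 T; last first.
  by exists 0 => // s /andP[s0 sT]; move: (le_trans s0 sT); rewrite leNgt T0.
have c : {within `[0, T], continuous (fun s => `|v s|)}.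
  by apply: continuous_subspaceT => s; apply: cvg_norm; exact: cv.
have [c0 _ cM] := EVT_max T0 c.
by exists `|v c0| => // s sT; apply: cM; rewrite in_itv.
Qed.

Lemma continuous_unif v T e : continuous v -> 0 < e ->
  exists2 d, 0 < d & forall s r, 0 <= s <= T -> 0 <= r <= T ->
    `|s - r| <= d -> `|v s - v r| <= e.
Proof.
move=> cv e0.
pose P d x := forall r, `|x - r| <= d -> `|v x - v r| <= e.
have e2 : 0 < e / 2 by rewrite divr_gt0.
have /compact_near_coveringP/(_ _ (0^'+) P) := @segment_compact R 0 T.
case=> [x _|d /= d0 dP].
  have /cvgrPdist_lt/(_ _ e2)/nbhs_ballP[d /= d0 dP] := cv x.
  have d2 : 0 < d / 2 by rewrite divr_gt0.
  exists (ball x (d / 2), [set h | h < d / 2]).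
    split => /=; first exact: nbhsx_ballx.
    by apply: nbhs_right_lt.
  move=> [y h] /= [xy hd] r yr.
  have -> : v y - v r = (v x - v r) - (v x - v y) by rewrite opprB [RHS]addrC addrA subrK.
  have vy : `|v x - v y| < e / 2.
    by apply: dP; rewrite -ball_normE /=; move: xy; rewrite -ball_normE /=; lra.
  have vr : `|v x - v r| < e / 2.
    apply: dP; rewrite -ball_normE /=; move: xy; rewrite -ball_normE /=.
    have := ler_normD (x - y) (y - r); rewrite addrA subrK; lra.
  by apply: le_trans (ler_normB _ _) _; lra.
exists (d / 2) => [|s r s0T r0T sr]; first by rewrite divr_gt0.
apply: (dP (d / 2)) => //=.
  by rewrite sub0r normrN gtr0_norm ?divr_gt0 // ltr_pdivrMr // ltr_pMr // ltr1n.
by rewrite divr_gt0.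
Qed.

Lemma unif_limit_continuous (u : nat -> R -> X) v (b : nat -> R) :
  (forall n, continuous (u n)) -> (forall n t, `|u n t - v t| <= b n) ->
  b n @[n --> \oo] --> 0 -> continuous v.
Proof.
move=> cu ub b0 t; apply/cvgrPdist_lt => e e0.
have e3 : 0 < e / 3 by rewrite divr_gt0.
have [N _ /(_ N (leqnn _))] : \forall n \near \oo, `|0 - b n| < e / 3.
  by move/cvgrPdist_lt: b0; exact.
rewrite /= sub0r normrN => bN.
have := cu N t; move/cvgrPdist_lt => /(_ _ e3); apply: filterS => s h.
have -> : v t - v s = - (u N t - v t) + (u N t - u N s) + (u N s - v s).
  by rewrite opprB -!addrA !addKr.
have := ub N t; have := ub N s; have := ler_norm (b N).
have := ler_normD (- (u N t - v t) + (u N t - u N s)) (u N s - v s).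
have := ler_normD (- (u N t - v t)) (u N t - u N s); rewrite normrN.
lra.
Qed.
End Continuous.

Section FractionalIntegral.
Context (R : realType) (X : completeNormedModType R).
Context (dot : {dot X for idfun}) (norm_dot : forall x : X, `|x| ^+ 2 = dot x x).
Context (alpha : R) (alpha_gt0 : 0 < alpha) (alpha_lt1 : alpha < 1).
Context (Gamma_gt0 : 0 < Gamma alpha).
Local Notation mu := (@lebesgue_measure R).
Local Notation Jr := (rl_integral alpha).
Local Notation J := (@J R X alpha).
Local Notation c := (Gamma alpha)^-1.
Implicit Types (f g : R -> R) (u v w : R -> X).

Let c_ge0 : 0 <= c. Proof. by rewrite invr_ge0 ltW. Qed.

Lemma Jr_integrable f t : continuous f -> 0 <= t ->
  mu.-integrable `]0, t[ (EFin \o (fun s => kernel alpha t s * f s)).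
Proof.
move=> cf t0; have [M M0 fM] := @continuous_bounded R R^o f t cf.
apply: (integrable_kernelM alpha_gt0 (M := M)) => //.
  exact: continuous_measurable_fun.
by move=> s /andP[s0 st]; apply: fM; rewrite !ltW.
Qed.

Lemma JrD f g t : continuous f -> continuous g -> 0 <= t ->
  Jr (fun s => f s + g s) t = Jr f t + Jr g t.
Proof.
move=> cf cg t0; rewrite /rl_integral -(RintegralD (mu := mu)) //; try exact: Jr_integrable.
by apply: eq_Rintegral => s _; rewrite mulrDr.
Qed.

Lemma JrZ f k t : continuous f -> 0 <= t -> Jr (fun s => k * f s) t = k * Jr f t.
Proof.
move=> cf t0; rewrite /rl_integral -(RintegralZl (mu := mu)) //; last exact: Jr_integrable.
by apply: eq_Rintegral => s _; rewrite mulrCA.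
Qed.

Lemma Jr_le f g t : continuous f -> continuous g -> 0 <= t ->
  (forall s, 0 <= s <= t -> f s <= g s) -> Jr f t <= Jr g t.
Proof.
move=> cf cg t0 fg; apply: (le_Rintegral (mu := mu)) => //; try exact: Jr_integrable.
move=> s; rewrite /= in_itv /= => /andP[s0 st].
by rewrite ler_wpM2l ?kernel_ge0 // fg // !ltW.
Qed.

Lemma Jr_cst k t : 0 <= t -> Jr (fun=> k) t = k * (t `^ alpha / alpha).
Proof.
move=> t0; rewrite /rl_integral (RintegralZr (mu := mu)) //; last exact: integrable_kernel.
rewrite Rintegral_kernel // mulrC /kernel_mass subrr powR0 ?gt_eqF //.
by rewrite !subr0.
Qed.

Lemma Jr_cst_le k t T : 0 <= k -> 0 <= t <= T ->
  Jr (fun=> k) t <= k * (T `^ alpha / alpha).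
Proof.
move=> k0 /andP[t0 tT]; rewrite Jr_cst // ler_wpM2l // ler_wpM2r ?invr_ge0 ?(ltW alpha_gt0) //.
by rewrite ge0_ler_powR ?nnegrE ?(ltW alpha_gt0) // (le_trans t0).
Qed.

Lemma continuous_dot v y : continuous v -> continuous (fun s => dot (v s) y).
Proof. by move=> cv s; apply: (dot_cvg norm_dot); [exact: cv|exact: cvg_cst]. Qed.

Lemma continuous_norm v : continuous v -> continuous (fun s => `|v s|).
Proof. by move=> cv s; apply: cvg_norm; exact: cv. Qed.

Lemma itv_fin (a b : R) : (mu `]a, b[ < +oo)%E.
Proof. by rewrite lebesgue_measure_itv /=; case: ifP => _; rewrite ?ltry // -EFinD ltry. Qed.

(** For continuous [v] the integral converges absolutely, so [J] takes its genuine value and not the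
    default of [xget]; linearity and bounds of [J] all come from this identity. *)
Lemma J_dot v t y : continuous v -> 0 <= t ->
  dot (J v t) y = c * Jr (fun s => dot (v s) y) t.
Proof.
move=> cv t0; rewrite /Defs.J dotZl; congr (_ * _).
have sl : simple_limitR (fun s => (t - s) `^ (alpha - 1) *: v s).
  apply: simple_limit_scale; first exact: (@measurable_kernel R alpha t).
  by apply: (simple_limit_continuous cv).
rewrite (bochner_dot norm_dot) //.
- by apply: eq_Rintegral => s _; rewrite dotZl.
- exact: itv_fin.
- by apply: (strongly_measurableI sl); exact: ae_true.
- have := Jr_integrable (continuous_norm cv) t0.
  move=> /integrableP[_]; apply: le_lt_trans; rewrite le_eqVlt; apply/orP; left; apply/eqP.
  apply: eq_integral => s _; rewrite /= normrZ.
  by congr EFin; rewrite normrM normr_id.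
Qed.

Lemma J_norm v t : continuous v -> 0 <= t -> `|J v t| <= c * Jr (fun s => `|v s|) t.
Proof.
move=> cv t0.
have nn : 0 <= c * Jr (fun s => `|v s|) t.
  rewrite mulr_ge0 //; apply: Rintegral_ge0 => s _.
  by rewrite mulr_ge0 ?kernel_ge0.
apply: (norm_le_dot norm_dot) => // y.
rewrite J_dot // -mulrA ler_wpM2l // mulrC -JrZ //; last exact: continuous_norm.
apply: Jr_le => //; first exact: continuous_dot.
  by move=> s; apply: cvgM; [exact: cvg_cst|exact: continuous_norm].
move=> s _; rewrite mulrC; apply: le_trans (ler_norm _) _; exact: dot_le.
Qed.

Lemma JD u v t : continuous u -> continuous v -> 0 <= t ->
  J (fun s => u s + v s) t = J u t + J v t.
Proof.
move=> cu cv t0.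
have cuv : continuous (fun s => u s + v s) by move=> s; apply: cvgD; [exact: cu|exact: cv].
apply: (dot_ext norm_dot) => y.
rewrite [LHS](J_dot y cuv t0) dotDl (J_dot y cu t0) (J_dot y cv t0) -mulrDr.
rewrite -(JrD (continuous_dot cu) (continuous_dot cv) t0).
by congr (_ * _); apply: eq_Rintegral => s _; rewrite dotDl.
Qed.

Lemma JZ k v t : continuous v -> 0 <= t -> J (fun s => k *: v s) t = k *: J v t.
Proof.
move=> cv t0.
have ckv : continuous (fun s => k *: v s) by move=> s; apply: cvgZr; exact: cv.
apply: (dot_ext norm_dot) => y; rewrite [LHS](J_dot y ckv t0) [RHS]dotZl (J_dot y cv t0).
rewrite [RHS]mulrCA -(JrZ k (continuous_dot cv) t0).
by congr (_ * _); apply: eq_Rintegral => s _; rewrite dotZl.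
Qed.

Lemma JB u v t : continuous u -> continuous v -> 0 <= t ->
  J (fun s => u s - v s) t = J u t - J v t.
Proof.
move=> cu cv t0.
have cnv : continuous (fun s => -1 *: v s) by move=> s; apply: cvgZr; exact: cv.
rewrite -scaleN1r -(JZ (-1) cv t0) -(JD cu cnv t0).
by congr (Defs.J alpha _ t); apply/funext => s; rewrite scaleN1r.
Qed.

Lemma lipschitz_continuous (L : {linear X -> X}) (M : R) :
  (forall x, `|L x| <= M * `|x|) -> continuous L.
Proof.
move=> LM x; apply/subr_cvg0/norm_cvg0P.
apply: (@squeeze_cvgr _ _ _ _ (fun=> 0) (fun z => M * `|z - x|)).
- by apply: nearW => z; rewrite normr_ge0 /= -linearB.
- exact: cvg_cst.
- by apply: cvg_mulr0; apply: cvg_dist0; exact: cvg_id.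
Qed.

(** Pairing with [y] moves [L] to the other side as its adjoint, so no approximation by simple
    functions is needed. *)
Lemma J_linear (L : {linear X -> X}) (M : R) v t : 0 <= M ->
  (forall x, `|L x| <= M * `|x|) -> continuous v -> 0 <= t ->
  J (fun s => L (v s)) t = L (J v t).
Proof.
move=> M0 LM cv t0; have [L' LL' _] := adjoint_exists norm_dot M0 LM.
have cLv : continuous (fun s => L (v s)).
  move=> s; apply: (@continuous_comp _ _ _ v L); first exact: cv.
  exact: (lipschitz_continuous LM).
apply: (dot_ext norm_dot) => y; rewrite [LHS](J_dot y cLv t0) LL' (J_dot (L' y) cv t0).
by congr (_ * _); apply: eq_Rintegral => s _; rewrite LL'.
Qed.

Lemma J_holder v M t t' : continuous v -> 0 <= M -> 0 <= t -> t <= t' ->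
  (forall s, 0 <= s <= t' -> `|v s| <= M) ->
  `|J v t' - J v t| <= c * (2 * M * ((t' - t) `^ alpha / alpha)).
Proof.
move=> cv M0 t0 tt' vM.
have nn : 0 <= (t' - t) `^ alpha / alpha by rewrite divr_ge0 ?powR_ge0 ?(ltW alpha_gt0).
apply: (norm_le_dot norm_dot) => [|y]; first by rewrite mulr_ge0 // mulr_ge0 // mulr_ge0.
have t'0 := le_trans t0 tt'; rewrite dotBl (J_dot y cv t'0) (J_dot y cv t0).
rewrite -mulrBr -[leRHS]mulrA ler_wpM2l //; apply: le_trans (ler_norm _) _.
have -> : 2 * M * ((t' - t) `^ alpha / alpha) * `|y| =
    2 * (M * `|y|) * ((t' - t) `^ alpha / alpha) by ring.
apply: Jr_holder => //.
  by apply: continuous_measurable_fun; exact: continuous_dot.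
move=> s /andP[s0 st]; apply: le_trans (dot_le norm_dot _ _) _.
by rewrite ler_wpM2r // vM // !ltW.
Qed.

(** The Hölder estimate on [0, T]; the clamp extends the function to the line, because continuity is
    required there in what follows. *)
Lemma J_clamp_continuous v T : 0 <= T -> continuous v ->
  continuous (fun t => J v (clamp T t)).
Proof.
move=> T0 cv t; have [M M0 vM] := continuous_bounded T cv.
have H s r : 0 <= s <= T -> 0 <= r <= T ->
    `|J v s - J v r| <= c * (2 * M * (`|s - r| `^ alpha / alpha)).
  move=> /andP[s0 sT] /andP[r0 rT]; have [sr|/ltW rs] := leP s r.
    rewrite distrC (distrC s) (ger0_norm (x := r - s)) ?subr_ge0 //.
    apply: J_holder => // q /andP[q0 qr]; apply: vM; rewrite q0 /=; exact: le_trans rT.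
  rewrite ger0_norm ?subr_ge0 //.
  apply: J_holder => // q /andP[q0 qr]; apply: vM; rewrite q0 /=; exact: le_trans sT.
apply/subr_cvg0/norm_cvg0P.
apply: (@squeeze_cvgr _ _ _ _ (fun=> 0) (fun s => (c * (2 * M) / alpha) * (`|s - t| `^ alpha))).
- apply: nearW => s; rewrite normr_ge0 /=.
  apply: le_trans (H _ _ (clamp_itv _ T0) (clamp_itv _ T0)) _.
  have -> : c * (2 * M * (`|clamp T s - clamp T t| `^ alpha / alpha)) =
    (c * (2 * M) / alpha) * (`|clamp T s - clamp T t| `^ alpha) by ring.
  apply: ler_wpM2l; first by rewrite !mulr_ge0 // invr_ge0 ltW.
  by apply: ge0_ler_powR; rewrite ?nnegrE ?(ltW alpha_gt0) //; exact: clamp_dist.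
- exact: cvg_cst.
- apply: cvg_mulr0.
  apply/cvgrPdist_lt => e e0.
  have e1 : 0 < e `^ alpha^-1 by exact: powR_gt0.
  have /cvgrPdist_lt/(_ _ e1) : s @[s --> t] --> t by exact: cvg_id.
  apply: filterS => s; rewrite distrC sub0r normrN => h; rewrite (ger0_norm (powR_ge0 _ _)).
  rewrite -[ltRHS](@powRr1 _ e) ?(ltW e0) // -(mulVf (x := alpha)) ?gt_eqF // powRrM.
  by apply: gt0_ltr_powR; rewrite ?nnegrE ?powR_ge0.
Qed.
End FractionalIntegral.

(** * The fractional Kato and Gronwall inequalities *)

Section Volterra.
Context (R : realType) (X : completeNormedModType R).
Context (dot : {dot X for idfun}) (norm_dot : forall x : X, `|x| ^+ 2 = dot x x).
Context (alpha : R) (alpha_gt0 : 0 < alpha) (alpha_lt1 : alpha < 1).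
Context (Gamma_gt0 : 0 < Gamma alpha) (T : R) (T_gt0 : 0 < T).
Local Notation mu := (@lebesgue_measure R).
Local Notation Jr := (rl_integral alpha).
Local Notation J := (@J R X alpha).
Local Notation c := (Gamma alpha)^-1.
Implicit Types (phi : R -> R) (u v w f : R -> X).

Let c_ge0 : 0 <= c. Proof. by rewrite invr_ge0 ltW. Qed.
Let T_ge0 : 0 <= T. Proof. exact: ltW. Qed.

Lemma Jr_conv phi (h e t : R) (n : nat) : 0 <= h -> t = n.+1%:R * h -> continuous phi ->
  (forall s r, 0 <= s <= t -> 0 <= r <= t -> `|s - r| <= h -> `|phi s - phi r| <= e) ->
  `|Jr phi t - conv (fun j => h `^ alpha * weight alpha j) (fun m => phi (m.+1%:R * h) : R^o) n|
    <= e * (t `^ alpha / alpha).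
Proof.
move=> h0 tE cphi phie.
have t0 : 0 <= t by rewrite tE mulr_ge0.
have [M M0 phiM] := @continuous_bounded R R^o phi t cphi.
have mass0 : kernel_mass alpha 0 t t = t `^ alpha / alpha.
  by rewrite /kernel_mass subrr powR0 ?gt_eqF // !subr0.
have := @Jr_grid R alpha alpha_gt0 phi h e M t n h0 tE (continuous_measurable_fun cphi)
  (fun s => ltac:(move=> /andP[s0 st]; apply: phiM; rewrite !ltW //)) phie.
rewrite mass0; congr (`|_ - _| <= _); rewrite /conv.
(* Cells are counted from 0 in the quadrature and from the singularity [t] in the convolution. *)
rewrite (reindex_inj rev_ord_inj) /=; apply: eq_bigr => i _.
have i_n : (i <= n)%N by rewrite -ltnS.
rewrite subSS tE kernel_mass_scale ?leq_subr //.
by rewrite subKn.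
Qed.

Lemma J_conv f (h e t : R) (n : nat) : 0 <= h -> t = n.+1%:R * h -> continuous f -> 0 <= e ->
  (forall s r, 0 <= s <= t -> 0 <= r <= t -> `|s - r| <= h -> `|f s - f r| <= e) ->
  `|J f t - conv (fun j => c * (h `^ alpha * weight alpha j)) (fun m => f (m.+1%:R * h)) n|
    <= c * (e * (t `^ alpha / alpha)).
Proof.
move=> h0 tE cf e0 fe.
have t0 : 0 <= t by rewrite tE mulr_ge0.
have K0 : 0 <= t `^ alpha / alpha by rewrite divr_ge0 ?powR_ge0 ?(ltW alpha_gt0).
apply: (norm_le_dot norm_dot) => [|y]; first by rewrite mulr_ge0 // mulr_ge0.
rewrite dotBl J_dot //.
have -> : dot (conv (fun j => c * (h `^ alpha * weight alpha j)) (fun m => f (m.+1%:R * h)) n) y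
   = c * conv (fun j => h `^ alpha * weight alpha j) (fun m => dot (f (m.+1%:R * h)) y : R^o) n.
  rewrite /conv (big_morph (fun x => dot x y) (fun a b => dotDl dot a b y) (dot0l dot y)) mulr_sumr.
  by apply: eq_bigr => i _; rewrite dotZl -mulrA.
rewrite -mulrBr -[leRHS]mulrA ler_wpM2l //; apply: le_trans (ler_norm _) _.
rewrite mulrAC; apply: (@Jr_conv (fun s => dot (f s) y)) => //.
  exact: continuous_dot.
move=> s r s0 r0 sr; rewrite -dotBl; apply: le_trans (dot_le norm_dot _ _) _.
by rewrite ler_wpM2r // fe.
Qed.

(* If f = m (P v - v) with |P v| <= |v|, as for a Yosida approximation, then the
   integrand on the right is nonpositive: this is the estimate for dissipative
   operators, independent of m. *)
Lemma fractional_kato v f (a : X) (m : R) : continuous f -> continuous v -> 0 <= m ->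
  (forall t, 0 <= t <= T -> v t = a + J f t) ->
  forall t, 0 <= t <= T ->
  `|v t| <= `|a| + c * Jr (fun s => `|f s + m *: v s| - m * `|v s|) t.
Proof.
move=> cf cv m0 vE t /andP[t0 tT].
pose q s := `|f s + m *: v s| - m * `|v s|.
have cq : continuous q.
  move=> s; apply: cvgB; last by apply: cvgM; [exact: cvg_cst|apply: cvg_norm; exact: cv].
  by apply: cvg_norm; apply: cvgD; [exact: cf|apply: cvgZr; exact: cv].
have [->|tn0] := eqVneq t 0.
  rewrite vE ?lexx //= (_ : J f 0 = 0); last first.
    apply: (dot_ext norm_dot) => y; rewrite J_dot // dot0l /rl_integral set_itvoo0 Rintegral_set0 mulr0 //.
  by rewrite addr0 /rl_integral set_itvoo0 Rintegral_set0 mulr0 addr0.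
have tp : 0 < t by rewrite lt_neqAle eq_sym tn0.
have [K KE] : exists K, K = t `^ alpha / alpha by exists (t `^ alpha / alpha).
have K0 : 0 <= K by rewrite KE divr_ge0 ?powR_ge0 ?(ltW alpha_gt0).
have cK0 : 0 <= c * K by rewrite mulr_ge0.
(* Error budget per unit of [e]: the quadrature of [f] at the last node, the quadrature of [q], and
   the replacement of [W] by [v] inside [Q], which costs 2 m times the first error and is summed
   against the total mass [c * K]. *)
pose C := c * K + c * K + 2 * m * (c * K) * (c * K).
have C0 : 0 <= C.
  by rewrite /C; apply: addr_ge0; [apply: addr_ge0|rewrite !mulr_ge0].
suff H e : 0 < e -> `|v t| <= `|a| + c * Jr q t + e * C.
  apply/ler_addgt0Pr => e e0; apply: le_trans (H (e / (C + 1)) _) _.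
    by rewrite divr_gt0 // ltr_wpDl.
  rewrite lerD2l mulrAC ler_pdivrMr ?ltr_wpDl // ler_wpM2l ?(ltW e0) //; lra.
move=> e0; have e0' := ltW e0.
have [d1 d10 d1P] := continuous_unif t cf e0.
have [d2 d20 d2P] := @continuous_unif R R^o q t e cq e0.
have [n hn] : exists n : nat, t / n.+1%:R <= Num.min d1 d2.
  have dd : 0 < Num.min d1 d2 by rewrite lt_min d10.
  exists (Num.truncn (t / Num.min d1 d2)).
  rewrite ler_pdivrMr // mulrC -ler_pdivrMr //; apply: ltW.
  exact: truncnS_gt.
pose h := t / n.+1%:R.
have h0 : 0 <= h by rewrite divr_ge0.
have hp : 0 < h by rewrite divr_gt0.
have tE : t = n.+1%:R * h by rewrite /h mulrC divfK.
have hd1 : h <= d1 by apply: le_trans hn _; rewrite ge_min lexx.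
have hd2 : h <= d2 by apply: le_trans hn _; rewrite ge_min lexx orbT.
pose k j := c * (h `^ alpha * weight alpha j).
have k0 j : 0 < k j.
  apply: mulr_gt0; first by rewrite invr_gt0.
  by apply: mulr_gt0; [exact: powR_gt0|exact: weight_gt0].
have kdec j : k j.+1 <= k j.
  rewrite /k ler_wpM2l // ler_wpM2l ?powR_ge0 //; exact: weight_noninc.
have klc j : k j.+1 ^+ 2 <= k j * k j.+2.
  rewrite /k [leLHS](_ : _ = (c * h `^ alpha) ^+ 2 * weight alpha j.+1 ^+ 2); last by ring.
  rewrite [leRHS](_ : _ = (c * h `^ alpha) ^+ 2 * (weight alpha j * weight alpha j.+2)); last by ring.
  by rewrite ler_wpM2l ?sqr_ge0 // weight_logconvex.
pose F i := f (i.+1%:R * h); pose W i := a + conv k F i.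
have := discrete_kato k0 kdec klc m0 (fun n => erefl (W n)) n.
set Q := fun n0 : nat => _ => WQ.
have mt i : (i <= n)%N -> 0 <= i.+1%:R * h <= t.
  by move=> i_n; rewrite mulr_ge0 //= tE ler_wpM2r // ler_nat.
have pow_le i : (i <= n)%N -> (i.+1%:R * h) `^ alpha / alpha <= K.
  move=> /mt/andP[i0 it]; rewrite KE ler_wpM2r ?invr_ge0 ?(ltW alpha_gt0) //.
  by rewrite ge0_ler_powR ?nnegrE // ltW.
have vW i : (i <= n)%N -> `|v (i.+1%:R * h) - W i| <= c * (e * K).
  move=> i_n; have /andP[i0 it] := mt _ i_n.
  rewrite vE ?i0 ?(le_trans it) // /W opprD addrACA subrr add0r.
  apply: le_trans (@J_conv f h e _ i h0 erefl cf e0' _) _.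
    move=> s r /andP[s0 sl] /andP[r0 rl] sr; apply: d1P; rewrite ?s0 ?r0 /=;
      [exact: le_trans it|exact: le_trans it|exact: le_trans hd1].
  by rewrite ler_wpM2l // ler_wpM2l // pow_le.
have Qq i : (i <= n)%N -> Q i <= q (i.+1%:R * h) + 2 * m * (c * (e * K)).
  move=> i_n; have := vW _ i_n; rewrite distrC => vWi.
  rewrite /Q /q -/(F i).
  have e1 : `|F i + m *: W i| <= `|F i + m *: v (i.+1%:R * h)| + m * `|W i - v (i.+1%:R * h)|.
    rewrite -{3}(ger0_norm m0) -normrZ; apply: le_trans (ler_normD _ _).
    by rewrite -addrA -scalerDr (addrC (v _)) subrK.
  have e2 : m * `|v (i.+1%:R * h)| <= m * `|W i| + m * `|W i - v (i.+1%:R * h)|.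
    by rewrite -mulrDr ler_wpM2l //; have := ler_normB (W i) (W i - v (i.+1%:R * h)); rewrite subKr.
  have e3 : m * `|W i - v (i.+1%:R * h)| <= m * (c * (e * K)) by rewrite ler_wpM2l.
  lra.
have convle (g g' : nat -> R^o) : (forall i, (i <= n)%N -> g i <= g' i) -> conv k g n <= conv k g' n.
  move=> gg; apply: ler_sum => i _; rewrite /GRing.scale /= ler_wpM2l ?(ltW (k0 _)) //.
  by apply: gg; rewrite leq_subr.
have cQ : conv k Q n <= c * Jr q t + c * (e * K) + 2 * m * (c * (e * K)) * (c * K).
  apply: le_trans (convle Q (fun i => q (i.+1%:R * h) + 2 * m * (c * (e * K))) Qq) _.
  rewrite (convD k (fun i => q (i.+1%:R * h) : R^o) (fun=> 2 * m * (c * (e * K)) : R^o)).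
  have kc (g : nat -> R^o) : conv k g n = c * conv (fun j => h `^ alpha * weight alpha j) g n.
    by rewrite /conv mulr_sumr; apply: eq_bigr => i _; rewrite /GRing.scale /= mulrA.
  apply: lerD.
    rewrite kc -mulrDr ler_wpM2l // -lerBlDl.
    apply: le_trans (ler_norm _) _; rewrite distrC KE; apply: Jr_conv => //.
    by move=> s r s0 r0 sr; apply: d2P => //; exact: le_trans hd2.
  rewrite conv_cst /GRing.scale /= mulrC ler_wpM2l //.
    by rewrite !mulr_ge0.
  (* The quadrature is exact on constants, so the weights add up to [K]. *)
  have := @Jr_conv (fun=> 1) h 0 t n h0 tE (fun=> ltac:(exact: cvg_cst))
    (fun s r _ _ _ => ltac:(by rewrite subrr normr0)).
  rewrite mul0r normr_le0 subr_eq0 Jr_cst // mul1r -KE => /eqP ->.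
  rewrite /conv mulr_sumr le_eqVlt; apply/orP; left; apply/eqP.
  by apply: eq_bigr => j _; rewrite /GRing.scale /= mulr1.
have v1 : `|v t| <= `|W n| + c * (e * K).
  by have := vW n (leqnn _); rewrite -tE; have := ler_normD (v t - W n) (W n); rewrite subrK; lra.
by move: WQ; rewrite /C; lra.
Qed.

Lemma continuous_expRM l : continuous (fun s : R => expR (l * s)).
Proof.
move=> s; apply: (@continuous_comp _ _ _ (fun s => l * s) expR).
  exact: mulrl_continuous.
exact: continuous_expR.
Qed.

(** Evaluate the inequality at a maximum point of phi(t) exp(- l t). For [l] large, [Jr_expR] lets
    the integral term absorb at most half of a positive maximum, so the maximum is at most [2 * b].
    The constant depends on neither [phi] nor [b]. *)
Lemma fractional_gronwall (k : R) : 0 <= k ->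
  exists2 C, 0 < C & forall phi b, continuous phi -> 0 <= b ->
    (forall t, 0 <= t <= T -> phi t <= b + k * (c * Jr phi t)) ->
    forall t, 0 <= t <= T -> phi t <= C * b.
Proof.
move=> k0.
have kc0 : 0 <= k * c by rewrite mulr_ge0.
(* [e] is chosen for [k * c * e <= 2^-1]; the added 1 avoids dividing by 0 when [k = 0]. *)
have [e eE e0] : exists2 e, e = (2 * (k * c + 1))^-1 & 0 < e.
  by exists (2 * (k * c + 1))^-1 => //; rewrite invr_gt0 mulr_gt0 // ltr_wpDl.
have kce : k * c * e <= 2^-1.
  by rewrite eE ler_pdivrMr ?mulr_gt0 ?ltr_wpDl //; lra.
have [l l0 lP] := Jr_expR alpha_gt0 T_ge0 e0.
have l0' := ltW l0.
exists (2 * expR (l * T)); first by rewrite mulr_gt0 ?expR_gt0.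
move=> phi b cphi b0 phiE.
pose psi t := phi t * expR (- (l * t)).
have cpsi : {within `[0, T], continuous psi}.
  have ce : continuous (fun x : R => expR (- (l * x))).
    have -> : (fun x : R => expR (- (l * x))) = (fun x => expR (- l * x)).
      by apply/funext => x; rewrite mulNr.
    exact: continuous_expRM.
  by apply: continuous_subspaceT => s; apply: cvgM; [exact: cphi|exact: ce].
have [t0 t0T psiM] := EVT_max T_ge0 cpsi.
rewrite in_itv /= in t0T; have /andP[t00 t0T'] := t0T.
have phi_le s : 0 <= s <= T -> phi s <= psi t0 * expR (l * s).
  move=> sT; have := psiM s; rewrite in_itv /= => /(_ sT); rewrite {1}/psi.
  by rewrite expRN ler_pdivrMr ?expR_gt0.
have psi_le : psi t0 <= 2 * b.
  have [psi0|psi0] := leP (psi t0) 0; first by apply: le_trans psi0 _; rewrite mulr_ge0.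
  have J1 : Jr phi t0 <= psi t0 * (e * expR (l * t0)).
    apply: le_trans (_ : Jr (fun s => psi t0 * expR (l * s)) t0 <= _).
      apply: Jr_le => //; first by move=> s; apply: cvgM; [exact: cvg_cst|exact: continuous_expRM].
      move=> s /andP[s0 st]; apply: phi_le; rewrite s0 /=; exact: le_trans t0T'.
    rewrite JrZ //; last exact: continuous_expRM.
    by rewrite ler_wpM2l ?(ltW psi0) // lP.
  have E1 : psi t0 <= b * expR (- (l * t0)) + psi t0 * (k * c * e).
    have -> : b * expR (- (l * t0)) + psi t0 * (k * c * e) =
       (b + k * (c * (psi t0 * (e * expR (l * t0))))) * expR (- (l * t0)).
      have EE : expR (l * t0) * expR (- (l * t0)) = 1 by rewrite -expRD subrr expR0.
      rewrite [RHS]mulrDl; congr (_ + _).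
      transitivity (psi t0 * (k * c * e) * (expR (l * t0) * expR (- (l * t0)))).
        by rewrite EE mulr1.
      ring.
    rewrite {1}/psi ler_wpM2r ?expR_ge0 //; apply: le_trans (phiE _ t0T) _.
    by rewrite lerD2l ler_wpM2l // ler_wpM2l.
  have E3 : b * expR (- (l * t0)) <= b.
    by rewrite ler_piMr // -expR0 ler_expR oppr_le0 mulr_ge0.
  have := ler_wpM2l (ltW psi0) kce; lra.
move=> t tT; apply: le_trans (phi_le _ tT) _; have /andP[_ tT'] := tT.
apply: le_trans (ler_wpM2r (expR_ge0 _) psi_le) _.
rewrite mulrAC ler_wpM2r //  ler_wpM2l // ler_expR ler_wpM2l //.
Qed.

(** No integrability is assumed: both integrands have the same set of Bochner integrals, hence the
    same selected or default value. *)
Lemma J_ae u v t : {ae mu, forall s, 0 < s < t -> u s = v s} -> J u t = J v t.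
Proof.
move=> uv; rewrite /Defs.J; congr (_ *: _); rewrite /bochner_integral.
have H (w w' : R -> X) x : {ae mu, forall s, 0 < s < t -> w s = w' s} ->
    is_bochner_integral `]0, t[ (fun s => (t - s) `^ (alpha - 1) *: w s) x ->
    is_bochner_integral `]0, t[ (fun s => (t - s) `^ (alpha - 1) *: w' s) x.
  move=> ww' [[_ [s [ss sw]]] [r [rr rw rx]]]; split.
    split; first exact: ae_true.
    exists s; split => //; apply: ae_imp2 sw ww' => q + + q0t => /(_ q0t) + qw.
    by rewrite qw //; move: q0t; rewrite /= in_itv.
  exists r; split => //.
  apply: cvg_trans rw; apply: near_eq_cvg; apply: nearW => n.
  apply: lebesgue_integral_ae; apply: ae_imp ww' => q + q0t.
  by rewrite /= in_itv /= in q0t => /(_ q0t) ->.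
congr (xget 0 _); apply/seteqP; split => x /=; apply: H => //.
by apply: ae_imp uv => s h st; rewrite h.
Qed.

(** Picard iteration in a norm with exponential weight: [Jr_expR] provides the exponent for which
    every step gains a factor 1/2. The iterates are clamped in time, so that bounds on [0, T] hold
    on the whole line. *)
Lemma volterra_exists (K : {linear X -> X}) (k : R) (a : X) : 0 <= k ->
  (forall x, `|K x| <= k * `|x|) ->
  exists u, [/\ continuous u, forall t, u t = u (clamp T t) &
    forall t, 0 <= t <= T -> u t = a + J (fun s => K (u s)) t].
Proof.
move=> k0 Kk; have cK := lipschitz_continuous Kk.
have cKv v : continuous v -> continuous (fun s => K (v s)).
  by move=> cv s; apply: (@continuous_comp _ _ _ v K); [exact: cv|exact: cK].
pose Phi u t := a + J (fun s => K (u s)) (clamp T t).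
have cPhi u : continuous u -> continuous (Phi u).
  move=> cu t; apply: cvgD; first exact: cvg_cst.
  by apply: (J_clamp_continuous norm_dot alpha_gt0 alpha_lt1 Gamma_gt0 T_ge0); exact: cKv.
pose u n := iter n Phi (fun=> a).
have uS n t : u n.+1 t = Phi (u n) t by [].
have cu n : continuous (u n).
  by elim: n => [|n IH]; [move=> t; exact: cvg_cst|exact: cPhi].
have kc0 : 0 <= k * c by rewrite mulr_ge0.
have [e eE e0] : exists2 e, e = (2 * (k * c + 1))^-1 & 0 < e.
  by exists (2 * (k * c + 1))^-1 => //; rewrite invr_gt0 mulr_gt0 // ltr_wpDl.
have kce : k * c * e <= 2^-1.
  by rewrite eE ler_pdivrMr ?mulr_gt0 ?ltr_wpDl //; lra.
have [l l0 lP] := Jr_expR alpha_gt0 T_ge0 e0.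
have l0' := ltW l0.
have cK' n : continuous (fun s => K (u n s)) by exact: cKv.
have [D D0 Dle] := continuous_bounded T (cu 1%N).
have d n t : 0 <= t <= T -> `|u n.+1 t - u n t| <= (D + `|a|) * 2^-1 ^+ n * expR (l * t).
  elim: n t => [|n IH] t tT.
    rewrite expr0 mulr1; apply: le_trans (ler_normB _ _) _.
    apply: le_trans (_ : (D + `|a|) * 1 <= _); first by rewrite mulr1 lerD // Dle.
    by rewrite ler_wpM2l ?addr_ge0 // -expR0 ler_expR mulr_ge0 //; case/andP: tT.
  have /andP[t0 tT'] := tT.
  have -> : u n.+2 t - u n.+1 t = J (fun s => K (u n.+1 s - u n s)) t.
    rewrite [u n.+2 t]uS [u n.+1 t]uS /Phi clamp_id // opprD addrACA subrr add0r.
    rewrite -(JB norm_dot alpha_gt0); [|exact: cK'|exact: cK'|exact: t0].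
    by congr (Defs.J alpha _ t); apply/funext => s; rewrite linearB.
  have cd : continuous (fun s => u n.+1 s - u n s) by move=> s; apply: cvgB; exact: cu.
  apply: le_trans (J_norm norm_dot alpha_gt0 Gamma_gt0 (cKv _ cd) t0) _.
  set M := (D + `|a|) * 2^-1 ^+ n in IH.
  have M0 : 0 <= M by rewrite mulr_ge0 ?addr_ge0 ?exprn_ge0.
  apply: le_trans (_ : c * Jr (fun s => k * M * expR (l * s)) t <= _).
    rewrite ler_wpM2l //; apply: Jr_le => //.
    - by apply: continuous_norm; exact: cKv.
    - by move=> s; apply: cvgM; [exact: cvg_cst|exact: continuous_expRM].
    - move=> s /andP[s0 st]; apply: le_trans (Kk _) _; rewrite -mulrA ler_wpM2l //.
      by apply: IH; rewrite s0 /=; exact: le_trans tT'.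
  rewrite JrZ //; last exact: continuous_expRM.
  apply: le_trans (_ : c * (k * M * (e * expR (l * t))) <= _).
    apply: ler_wpM2l => //; apply: ler_wpM2l; first exact: mulr_ge0.
    exact: lP.
  rewrite [leRHS](_ : _ = M * expR (l * t) * 2^-1); last by rewrite /M exprSr; ring.
  rewrite [leLHS](_ : _ = M * expR (l * t) * (k * c * e)); last by ring.
  by apply: ler_wpM2l => //; apply: mulr_ge0 => //; exact: expR_ge0.
have ucl n t : u n t = u n (clamp T t).
  case: n => [|n]; first by [].
  by rewrite [LHS]uS [RHS]uS /Phi (clamp_id (clamp_itv t T_ge0)).
(* The tail of the geometric series of the increments: [B n - B n.+1] bounds one increment, and the
   sum telescopes in [dB]. *)
pose B n := (D + `|a|) * expR (l * T) * 2 * 2^-1 ^+ n.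
have BS n : B n.+1 = B n - (D + `|a|) * expR (l * T) * 2^-1 ^+ n.
  by rewrite /B exprSr; field.
have dB n m t : `|u n t - u (n + m)%N t| <= B n - B (n + m)%N.
  elim: m => [|m IH]; first by rewrite addn0 !subrr normr0.
  rewrite addnS BS.
  have -> : u n t - u (n + m).+1 t = (u n t - u (n + m)%N t) - (u (n + m).+1 t - u (n + m)%N t).
    by rewrite opprB addrA subrK.
  apply: le_trans (ler_normB _ _) _; rewrite opprB [leRHS]addrA [leRHS]addrAC; apply: lerD => //.
  rewrite (ucl (n + m).+1) (ucl (n + m)%N); apply: le_trans (d _ _ (clamp_itv _ T_ge0)) _.
  rewrite mulrAC ler_wpM2r ?exprn_ge0 // ler_wpM2l ?addr_ge0 // ler_expR ler_wpM2l //.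
  by case/andP: (clamp_itv t T_ge0).
have B_ge0 n : 0 <= B n by rewrite !mulr_ge0 ?exprn_ge0 ?expR_ge0 ?addr_ge0.
have B0 : B n @[n --> \oo] --> 0.
  by apply: cvg_mulr0; apply: cvg_expr; rewrite ger0_norm // invf_lt1 // ltr1n.
have dB' n m t : (n <= m)%N -> `|u n t - u m t| <= B n.
  by move=> nm; rewrite -(subnKC nm); apply: le_trans (dB _ _ _) _; rewrite gerBl.
have cvu t : cvgn (u ^~ t) by apply: (cauchy_seq_cvg B0) => n m; exact: dB'.
pose U t := limn (u ^~ t).
have uU n t : `|u n t - U t| <= B n.
  have cc : `|u n t - u m t| @[m --> \oo] --> `|u n t - U t|.
    by apply: cvg_norm; apply: cvgB; [exact: cvg_cst|exact: cvu].
  apply: (ler_cvg_to cc (cvg_cst (B n))); exists n => // m /= nm; exact: dB'.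
have cU : continuous U by exact: (unif_limit_continuous cu uU).
exists U; split => // [t|t tT].
  by rewrite /U; congr (limn _); apply/funext => n; exact: ucl.
have /andP[t0 tT'] := tT.
have c1 : u n.+1 t @[n --> \oo] --> U t by rewrite (cvg_shiftS (u ^~ t)); exact: cvu.
have c2 : u n.+1 t @[n --> \oo] --> a + J (fun s => K (U s)) t.
  apply/subr_cvg0/norm_cvg0P.
  apply: (@squeeze_cvgr _ _ _ _ (fun=> 0) (fun n => (c * (k * (T `^ alpha / alpha))) * B n)).
  - apply: nearW => n; rewrite normr_ge0 /=.
    rewrite /Phi clamp_id // opprD addrACA subrr add0r -(JB norm_dot alpha_gt0);
      [|exact: cK'|exact: cKv|exact: t0].
    have -> : (fun s => K (u n s) - K (U s)) = (fun s => K (u n s - U s)).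
      by apply/funext => s; rewrite linearB.
    have cd : continuous (fun s => u n s - U s) by move=> s; apply: cvgB; [exact: cu|exact: cU].
    apply: le_trans (J_norm norm_dot alpha_gt0 Gamma_gt0 (cKv _ cd) t0) _.
    rewrite -mulrA ler_wpM2l //.
    apply: le_trans (_ : Jr (fun=> k * B n) t <= _).
      apply: Jr_le => //; first by apply: continuous_norm; exact: cKv.
        by move=> s; exact: cvg_cst.
      by move=> s _; apply: le_trans (Kk _) _; rewrite ler_wpM2l.
    rewrite mulrAC; apply: Jr_cst_le => //; exact: mulr_ge0.
  - exact: cvg_cst.
  - exact: cvg_mulr0.
exact: (cvg_unique _ c1 c2).
Qed.

End Volterra.

Lemma uniform_cauchy_limit (R : realType) (X : completeNormedModType R)
    (u : nat -> R -> X) :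
  (forall n, continuous (u n)) ->
  (forall e, 0 < e -> exists N, forall n m t, (N <= n)%N -> (N <= m)%N ->
     `|u n t - u m t| <= e) ->
  exists2 U : R -> X, continuous U &
    forall e, 0 < e -> exists N, forall n t, (N <= n)%N -> `|u n t - U t| <= e.
Proof.
move=> cu uC.
have cvu t : cvgn (u ^~ t).
  apply/cauchy_cvgP/cauchy_exP => e e0.
  have e2 : 0 < e / 2 by rewrite divr_gt0.
  have [N NP] := uC _ e2.
  exists (u N t); exists N => // n /= Nn; rewrite -ball_normE /=.
  by apply: le_lt_trans (NP N n t (leqnn _) Nn) _; rewrite ltr_pdivrMr // ltr_pMr // ltr1n.
pose U t := limn (u ^~ t).
have uU e : 0 < e -> exists N, forall n t, (N <= n)%N -> `|u n t - U t| <= e.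
  move=> /uC[N NP]; exists N => n t Nn.
  have cc : `|u n t - u m t| @[m --> \oo] --> `|u n t - U t|.
    by apply: cvg_norm; apply: cvgB; [exact: cvg_cst|exact: cvu].
  apply: (ler_cvg_to cc (cvg_cst e)); exists N => // m /= Nm; exact: NP.
exists U => //.
(* A choice of indices with an explicit rate, as [unif_limit_continuous] requires. *)
have hr n : 0 < (n.+1%:R^-1 : R) by [].
have [f fP] := choice (fun n => uU _ (hr n)).
apply: (@unif_limit_continuous _ _ (fun n => u (f n)) U (fun n => n.+1%:R^-1)).
- by move=> n; exact: cu.
- by move=> n t; exact: fP.
- exact: cvg_harmonic.
Qed.

(** * The solution family *)

(* With R(l) = (l - L)^-1 for an m-dissipative L, [P n] is n.+1 R(n.+1) and [S] is
   R(1), so that L S = S - 1 and [yosidaS] reads n.+1 (P n - 1) S = P n L S.  The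
   equation solved is dt (u - a) = (L + w) u. *)
Section Yosida.
Context (R : realType) (X : completeNormedModType R).
Context (dot : {dot X for idfun}) (norm_dot : forall x : X, `|x| ^+ 2 = dot x x).
Context (alpha : R) (alpha_gt0 : 0 < alpha) (alpha_lt1 : alpha < 1).
Context (Gamma_gt0 : 0 < Gamma alpha) (T : R) (T_gt0 : 0 < T).
Context (w : R) (w_ge0 : 0 <= w).
Context (P : nat -> {linear X -> X}) (S : {linear X -> X}).
Hypothesis P_le : forall n x, `|P n x| <= `|x|.
Hypothesis S_le : forall x, `|S x| <= `|x|.
Hypothesis PP : forall n m x, P n (P m x) = P m (P n x).
Hypothesis PS : forall n x, P n (S x) = S (P n x).
Hypothesis yosidaS : forall n x, n.+1%:R *: (P n (S x) - S x) = P n (S x - x).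
Hypothesis P_cvg : forall x, P n x @[n --> \oo] --> x.
Local Notation J := (@J R X alpha).
Local Notation c := (Gamma alpha)^-1.
Local Notation kappa := (T `^ alpha / alpha).

Let c_ge0 : 0 <= c. Proof. by rewrite invr_ge0 ltW. Qed.

Let kappa_ge0 : 0 <= kappa. Proof. by rewrite divr_ge0 ?powR_ge0 ?(ltW alpha_gt0). Qed.
Let T_ge0 : 0 <= T. Proof. exact: ltW. Qed.

Lemma J_bound (v : R -> X) (H t : R) : continuous v -> 0 <= H -> 0 <= t <= T ->
  (forall s, 0 <= s <= T -> `|v s| <= H) -> `|J v t| <= c * (H * kappa).
Proof.
move=> cv H0 /andP[t0 tT] vH.
apply: le_trans (J_norm norm_dot alpha_gt0 Gamma_gt0 cv t0) _; rewrite ler_wpM2l //.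
apply: le_trans (_ : rl_integral alpha (fun=> H) t <= _).
  apply: Jr_le => //; first exact: continuous_norm.
    by move=> s; exact: cvg_cst.
  by move=> s /andP[s0 st]; rewrite vH // s0 /=; exact: le_trans tT.
by apply: Jr_cst_le => //; rewrite t0.
Qed.

(** Solving [yosidaS] for [P N x] shows that this vector lies in the range of [S], and it converges
    to [x]. *)
Lemma range_S_dense (x : X) (e : R) : 0 < e -> exists y, `|x - S y| <= e.
Proof.
move=> e0; have /cvgrPdist_le/(_ _ e0)[N _ /(_ N (leqnn _)) /= h] := @P_cvg x.
exists (P N x - N.+1%:R *: P N x + N.+1%:R *: x); apply: le_trans h.
rewrite le_eqVlt; apply/orP; left; apply/eqP; congr (`| _ - _ |).
rewrite linearD linearB !linearZ /= -!PS; apply: (dot_ext norm_dot) => z.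
have := congr1 (fun y => dot y z) (yosidaS N x).
by rewrite (linearB (P N)) !(dotE dot); move: (N.+1%:R : R) => M h; lra.
Qed.

Lemma yosida_exists n : exists2 K : {linear X -> X},
  forall x, K x = n.+1%:R *: (P n x - x) + w *: x &
  forall x, `|K x| <= (2 * n.+1%:R + w) * `|x|.
Proof.
have lK : linear (fun x => n.+1%:R *: (P n x - x) + w *: x).
  move=> k x y; apply: (dot_ext norm_dot) => z.
  by rewrite linearP !(dotE dot); ring.
have [K KE] := linear_pack lK; exists K => // x; rewrite KE.
apply: le_trans (ler_normD _ _) _; rewrite mulrDl !normrZ (ger0_norm w_ge0) lerD2r.
rewrite normr_nat (mulrC 2) -mulrA ler_wpM2l //.
by apply: le_trans (ler_normB _ _) _; have := P_le n x; lra.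
Qed.

Section Approximants.
Variables (K : nat -> {linear X -> X}).
Hypothesis KE : forall n x, K n x = n.+1%:R *: (P n x - x) + w *: x.
Hypothesis K_le : forall n x, `|K n x| <= (2 * n.+1%:R + w) * `|x|.
Variable C : R.
Hypothesis C_gt0 : 0 < C.
Hypothesis gronwall : forall phi b, continuous phi -> 0 <= b ->
  (forall t, 0 <= t <= T -> phi t <= b + w * (c * rl_integral alpha phi t)) ->
  forall t, 0 <= t <= T -> phi t <= C * b.
Let C_ge0 : 0 <= C. Proof. exact: ltW. Qed.
Let kn_ge0 n : 0 <= 2 * n.+1%:R + w. Proof. by rewrite addr_ge0 // mulr_ge0. Qed.
Let cK n v : continuous v -> continuous (fun s : R => K n (v s)).
Proof.
move=> cv s; apply: (@continuous_comp _ _ _ v (K n)); first exact: cv.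
exact: (lipschitz_continuous (K_le n)).
Qed.

(** Kato's inequality for f = K n v + h with m = n + 1: then f + m v = m P n v + w v + h, the bound
    |P n v| <= |v| cancels m |v|, and w |v| + H is left for Gronwall's inequality. Neither step
    depends on [n]. *)
Lemma yosida_stable n (v h : R -> X) (a : X) (H : R) : continuous v -> continuous h ->
  0 <= H -> (forall s, 0 <= s <= T -> `|h s| <= H) ->
  (forall t, 0 <= t <= T -> v t = a + J (fun s => K n (v s) + h s) t) ->
  forall t, 0 <= t <= T -> `|v t| <= C * (`|a| + c * (H * kappa)).
Proof.
move=> cv ch H0 hH vE; apply: gronwall; first exact: continuous_norm.
  by rewrite addr_ge0 // mulr_ge0 // mulr_ge0.
move=> t tT; have /andP[t0 tT'] := tT.
have cf : continuous (fun s => K n (v s) + h s).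
  by move=> s; apply: cvgD; [exact: cK|exact: ch].
have kato := fractional_kato norm_dot alpha_gt0 alpha_lt1 Gamma_gt0 T_gt0 cf cv (ler0n R n.+1) vE tT.
apply: le_trans kato _.
rewrite -addrA lerD2l.
have cn : continuous (fun s => `|v s|) by exact: continuous_norm.
have cst_c : continuous (fun _ : R => H : R) by move=> s; exact: cvg_cst.
have cwn : continuous (fun s => w * `|v s|) by move=> s; apply: cvgM; [exact: cvg_cst|exact: cn].
apply: le_trans (_ : c * rl_integral alpha (fun s => H + w * `|v s|) t <= _).
  rewrite ler_wpM2l //; apply: Jr_le => //.
  - move=> s; apply: cvgB; last by apply: cvgM; [exact: cvg_cst|exact: cn].
    by apply: cvg_norm; apply: cvgD; [exact: cf|apply: cvgZr; exact: cv].
  - by move=> s; apply: cvgD; [exact: cst_c|exact: cwn].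
  - move=> s /andP[s0 st].
    have sT : 0 <= s <= T by rewrite s0 /=; exact: le_trans tT'.
    rewrite KE.
    have -> : n.+1%:R *: (P n (v s) - v s) + w *: v s + h s + n.+1%:R *: v s =
       n.+1%:R *: P n (v s) + (w *: v s + h s).
      by apply: (dot_ext norm_dot) => z; rewrite !(dotE dot); ring.
    have e1 := ler_normD (n.+1%:R *: P n (v s)) (w *: v s + h s).
    have e2 := ler_normD (w *: v s) (h s).
    rewrite !normrZ (ger0_norm w_ge0) in e1 e2.
    have e3 := hH _ sT.
    have e4 : `|n.+1%:R : R| * `|P n (v s)| <= n.+1%:R * `|v s|.
      by rewrite normr_nat ler_wpM2l.
    lra.
rewrite JrD // JrZ // mulrDr; apply: lerD.
  by rewrite ler_wpM2l //; apply: Jr_cst_le.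
by rewrite mulrCA.
Qed.

Lemma yosida_uniq n u v : continuous u -> continuous v ->
  (forall t, 0 <= t <= T -> u t - v t = J (fun s => K n (u s - v s)) t) ->
  forall t, 0 <= t <= T -> u t = v t.
Proof.
move=> cu cv uvE t tT.
have cd : continuous (fun s => u s - v s) by move=> s; apply: cvgB; [exact: cu|exact: cv].
have cst0 : continuous (fun _ : R => 0 : X) by move=> s; exact: cvg_cst.
have := @yosida_stable n (fun s => u s - v s) (fun=> 0) 0 0 cd cst0 (lexx _)
  (fun s _ => ltac:(by rewrite normr0)) _ t tT.
rewrite normr0 mul0r mulr0 addr0 mulr0 normr_le0 subr_eq0 => h; apply/eqP; apply: h.
move=> s sT; rewrite add0r (uvE _ sT); congr (Defs.J alpha _ s).
by apply/funext => r; rewrite addr0.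
Qed.

Variable e : nat -> X -> R -> X.
Hypothesis e_cont : forall n a, continuous (e n a).
Hypothesis e_clamp : forall n a t, e n a t = e n a (clamp T t).
Hypothesis eE : forall n a t, 0 <= t <= T -> e n a t = a + J (fun s => K n (e n a s)) t.

(** Linearity of the approximate solutions and their commutation with other operators are both
    obtained by recognizing a second solution of the same equation. *)
Let e_ext n a (v : R -> X) : continuous v -> (forall t, v t = v (clamp T t)) ->
  (forall t, 0 <= t <= T -> v t = a + J (fun s => K n (v s)) t) ->
  forall t, e n a t = v t.
Proof.
move=> cv vc vE t; rewrite e_clamp vc; apply: (@yosida_uniq n) => //; last exact: clamp_itv.
move=> s sT; have /andP[s0 _] := sT.
rewrite (eE n a sT) (vE _ sT) opprD addrACA subrr add0r.
rewrite -(JB norm_dot alpha_gt0); [|exact/cK/e_cont|exact: cK|exact: s0].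
by congr (Defs.J alpha _ s); apply/funext => r; rewrite linearB.
Qed.

Let e_linear n t : linear (fun a => e n a t).
Proof.
move=> k a b; apply: (@e_ext n (k *: a + b) (fun t => k *: e n a t + e n b t)).
- by move=> s; apply: cvgD; [apply: cvgZr|]; exact: e_cont.
- by move=> s; rewrite !(e_clamp _ _ s).
- move=> s sT; have /andP[s0 _] := sT.
  rewrite (eE n a sT) (eE n b sT).
  have -> : (fun r => K n (k *: e n a r + e n b r)) =
      (fun r => k *: K n (e n a r) + K n (e n b r)).
    by apply/funext => r; rewrite linearP.
  have cke : continuous (fun r => K n (e n a r)) by exact/cK/e_cont.
  rewrite (JD norm_dot alpha_gt0); [|by move=> r; apply: cvgZr; exact: cke|exact/cK/e_cont|exact: s0].
  rewrite (JZ norm_dot alpha_gt0); [|exact: cke|exact: s0].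
  by rewrite scalerDr addrACA.
Qed.

Let e_comm n (L : {linear X -> X}) (M : R) a t : 0 <= M ->
  (forall x, `|L x| <= M * `|x|) -> (forall x, L (K n x) = K n (L x)) ->
  e n (L a) t = L (e n a t).
Proof.
move=> M0 LM LK; apply: (@e_ext n (L a) (fun t => L (e n a t))).
- move=> s; apply: (@continuous_comp _ _ _ (e n a) L); first exact: e_cont.
  exact: (lipschitz_continuous LM).
- by move=> s; rewrite (e_clamp _ _ s).
- move=> s sT; have /andP[s0 _] := sT.
  rewrite (eE n a sT) linearD; congr (_ + _).
  rewrite -(J_linear norm_dot alpha_gt0 M0 LM); [|exact/cK/e_cont|exact: s0].
  by congr (Defs.J alpha _ s); apply/funext => r; rewrite LK.
Qed.

Let e_le n a t : `|e n a t| <= C * `|a|.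
Proof.
have cst0 : continuous (fun _ : R => 0 : X) by move=> s; exact: cvg_cst.
have := @yosida_stable n (e n a) (fun=> 0) a 0 (@e_cont n a) cst0 (lexx _)
  (fun s _ => ltac:(by rewrite normr0)) _ (clamp T t) (clamp_itv t T_ge0).
rewrite -e_clamp mul0r mulr0 addr0; apply => s sT.
rewrite {1}(eE n a sT); congr (_ + _); congr (Defs.J alpha _ s).
by apply/funext => r; rewrite addr0.
Qed.

Let z b := S b - b + w *: S b.
Let KS n b : K n (S b) = P n (S b - b) + w *: S b.
Proof. by rewrite KE yosidaS. Qed.

Let KK n m x : K n (K m x) = K m (K n x).
Proof.
rewrite !KE; apply: (dot_ext norm_dot) => y.
rewrite !(linearD, linearN, linearZ) /= !(PP n m) !(dotE dot).
move: (n.+1%:R : R) (m.+1%:R : R) => a b.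
ring.
Qed.

Let SK n x : S (K n x) = K n (S x).
Proof.
rewrite !KE; apply: (dot_ext norm_dot) => y.
by rewrite !(linearD, linearN, linearZ) /= !PS !(dotE dot); ring.
Qed.

Let S_le1 x : `|S x| <= 1 * `|x|. Proof. by rewrite mul1r. Qed.

Let e_sub n t x y : e n (x - y) t = e n x t - e n y t.
Proof. by rewrite [x - y]addrC -scaleN1r [LHS]e_linear scaleN1r addrC. Qed.

(** The difference solves the equation of index [n] with source (K n - K m) e m (S b). As [e m]
    commutes with both operators and K n (S b) - K m (S b) = P n (S b - b) - P m (S b - b), the
    source is small by [P_cvg], although the bound on [K n] grows with [n]. *)
Let yosida_dist n m b t : `|e n (S b) t - e m (S b) t| <=
  C * (c * (C * `|P n (S b - b) - P m (S b - b)| * kappa)).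
Proof.
have cst0 : continuous (fun _ : R => 0 : X) by move=> s; exact: cvg_cst.
pose h s := e m (P n (S b - b) - P m (S b - b)) s.
rewrite (e_clamp n) (e_clamp m).
have cd : continuous (fun s => e n (S b) s - e m (S b) s).
  by move=> s; apply: cvgB; exact: e_cont.
have := @yosida_stable n (fun s => e n (S b) s - e m (S b) s) h 0
  (C * `|P n (S b - b) - P m (S b - b)|) cd (@e_cont m _) _ (fun s _ => e_le m _ s) _
  (clamp T t) (clamp_itv t T_ge0).
rewrite normr0 add0r; apply; first exact: mulr_ge0.
move=> s sT; have /andP[s0 _] := sT; rewrite add0r (eE n (S b) sT) (eE m (S b) sT).
rewrite opprD addrACA subrr add0r.
rewrite -(JB norm_dot alpha_gt0); [|exact/cK/e_cont|exact/cK/e_cont|exact: s0].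
congr (Defs.J alpha _ s); apply/funext => r.
rewrite linearB -addrA; congr (_ + _).
have eM n' : e m (K n' (S b)) r = K n' (e m (S b) r).
  by apply: (e_comm _ _ (kn_ge0 n') (K_le n')) => x; exact: KK.
rewrite /h.
have -> : P n (S b - b) - P m (S b - b) = K n (S b) - K m (S b).
  by rewrite !KS opprD addrACA subrr addr0.
by rewrite e_sub !eM addKr.
Qed.

(** Replacing [a] by a nearby [S b] costs [eps / 3] for each index, by [e_le]; the last third is
    [yosida_dist], uniform in [t]. *)
Let e_cauchy a eps : 0 < eps -> exists N, forall n m t, (N <= n)%N -> (N <= m)%N ->
  `|e n a t - e m a t| <= eps.
Proof.
move=> eps0; have d0 : 0 < eps / (3 * C) by rewrite divr_gt0 // mulr_gt0.
have [b ab] := range_S_dense a d0.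
pose D := C * (c * (C * kappa)).
have D0 : 0 <= D by rewrite mulr_ge0 // mulr_ge0 // mulr_ge0.
have d1 : 0 < eps / (6 * (D + 1)) by rewrite divr_gt0 // mulr_gt0 // ltr_wpDl.
have /cvgrPdist_le/(_ _ d1)[N _ NP] := @P_cvg (S b - b).
exists N => n m t Nn Nm.
have E : e n a t - e m a t = e n (a - S b) t - e m (a - S b) t + (e n (S b) t - e m (S b) t).
  by rewrite !e_sub; apply: (dot_ext norm_dot) => y; rewrite !(dotE dot); ring.
have Ce k : `|e k (a - S b) t| <= eps / 3.
  apply: le_trans (e_le _ _ _) _; apply: le_trans (ler_wpM2l C_ge0 ab) _.
  by rewrite le_eqVlt; apply/orP; left; apply/eqP; field; rewrite gt_eqF.
have PE : `|P n (S b - b) - P m (S b - b)| <= eps / (3 * (D + 1)).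
  have e1 := NP n Nn; have e2 := NP m Nm; rewrite /= in e1 e2.
  have -> : P n (S b - b) - P m (S b - b) = (S b - b - P m (S b - b)) - (S b - b - P n (S b - b)).
    by apply: (dot_ext norm_dot) => y; rewrite !(dotE dot); ring.
  apply: le_trans (ler_normB _ _) _.
  have -> : eps / (3 * (D + 1)) = eps / (6 * (D + 1)) + eps / (6 * (D + 1)).
    by field; rewrite gt_eqF // ltr_wpDl.
  exact: lerD.
have de := yosida_dist n m b t.
have de' : C * (c * (C * `|P n (S b - b) - P m (S b - b)| * kappa)) <= eps / 3.
  have -> : C * (c * (C * `|P n (S b - b) - P m (S b - b)| * kappa)) =
     D * `|P n (S b - b) - P m (S b - b)| by rewrite /D; ring.
  apply: le_trans (ler_wpM2l D0 PE) _.
  rewrite mulrA ler_pdivrMr ?mulr_gt0 // ?ltr_wpDl //.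
  have -> : eps / 3 * (3 * (D + 1)) = eps * (D + 1) by field.
  by rewrite mulrC ler_wpM2l ?(ltW eps0) // lerDl.
rewrite E; apply: le_trans (ler_normD _ _) _.
have := ler_normB (e n (a - S b) t) (e m (a - S b) t).
have := Ce n; have := Ce m; lra.
Qed.

(** For the initial value [S a] the integrand K n (e n (S a)) equals e n (K n (S a)), and by [KS]
    the vector K n (S a) tends to [z a], which is L + w applied to [S a]. So the equation passes to
    the limit uniformly in time. *)
Lemma yosida_limit : exists E : R -> X -> X, [/\
  forall a, continuous (E ^~ a), forall t a, `|E t a| <= C * `|a|,
  forall t, linear (E t) & (forall t a, E t (S a) = S (E t a)) /\
  forall a t, 0 <= t <= T ->
    E t (S a) = S a + J (fun s => E s (S a - a + w *: S a)) t].
Proof.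
have lim a : exists2 U : R -> X, continuous U &
    forall eps, 0 < eps -> exists N, forall n t, (N <= n)%N -> `|e n a t - U t| <= eps.
  by apply: uniform_cauchy_limit => [n|eps]; [exact: e_cont|exact: e_cauchy].
pose E t a := projT1 (cid2 (lim a)) t.
have cE a : continuous (E ^~ a) by rewrite /E; case: (cid2 _).
have E_unif a eps : 0 < eps -> exists N, forall n t, (N <= n)%N -> `|e n a t - E t a| <= eps.
  by rewrite /E; case: (cid2 _) => U /= _ h; exact: h.
have E_cvg a t : e n a t @[n --> \oo] --> E t a.
  apply/cvgrPdist_le => eps /(E_unif a)[N NP]; exists N => // n /= Nn.
  by rewrite distrC; exact: NP.
exists E; split => //.
- move=> t a.
  by apply: (ler_cvg_to (cvg_norm (E_cvg a t)) (cvg_cst (C * `|a|))); apply: nearW => n; exact: e_le.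
- move=> t k a b.
  have c1 : e n (k *: a + b) t @[n --> \oo] --> k *: E t a + E t b.
    under eq_fun do rewrite e_linear.
    by apply: cvgD; [apply: cvgZr|]; exact: E_cvg.
  exact: (cvg_unique _ (E_cvg _ t) c1).
- split => [t a|a t tT].
    have c1 : e n (S a) t @[n --> \oo] --> S (E t a).
      under eq_fun do rewrite (e_comm _ _ ler01 S_le1 (SK _)).
      apply: (cvg_comp _ _ (E_cvg a t)); exact: (lipschitz_continuous S_le1).
    exact: (cvg_unique _ (E_cvg _ t) c1).
  have c1 : e n (S a) t @[n --> \oo] --> S a + J (fun s => E s (z a)) t.
    apply/cvgrPdist_le => eps eps0.
    pose D := c * kappa; have D0 : 0 <= D by rewrite mulr_ge0.
    have d0 : 0 < eps / (2 * (D + 1)) by rewrite divr_gt0 // mulr_gt0 // ltr_wpDl.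
    have d1 : 0 < eps / (2 * (D + 1) * C) by rewrite divr_gt0 // mulr_gt0 // mulr_gt0 // ltr_wpDl.
    have [N1 N1P] := E_unif (z a) _ d0.
    have /cvgrPdist_le/(_ _ d1)[N2 _ N2P] := @P_cvg (S a - a).
    exists (maxn N1 N2) => // n /=; rewrite geq_max => /andP[nN1 nN2].
    have /andP[t0 _] := tT.
    rewrite (eE n (S a) tT) opprD addrACA subrr add0r.
    rewrite -(JB norm_dot alpha_gt0); [|exact: cE|exact/cK/e_cont|exact: t0].
    have -> : eps = c * (eps / (D + 1) * kappa) + eps / (D + 1).
      have D1 : D + 1 != 0 by rewrite gt_eqF // ltr_wpDl.
      rewrite [c * _](_ : _ = D * (eps / (D + 1))); last by rewrite /D; ring.
      by move: D1; move: (D) => D' D1; field.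
    apply: le_trans (_ : c * (eps / (D + 1) * kappa) <= _); last first.
      by rewrite lerDl divr_ge0 ?(ltW eps0) // addr_ge0.
    apply: J_bound => //.
    - by move=> s; apply: cvgB; [exact: cE|exact/cK/e_cont].
    - by rewrite divr_ge0 ?(ltW eps0) // addr_ge0.
    - move=> s sT; rewrite -(e_comm _ _ (kn_ge0 n) (K_le n)) //.
      have -> : K n (S a) = z a - (S a - a - P n (S a - a)).
        by rewrite KS /z; apply: (dot_ext norm_dot) => y; rewrite !(dotE dot); ring.
      rewrite e_sub opprB addrCA; apply: le_trans (ler_normD _ _) _.
      have -> : eps / (D + 1) = C * (eps / (2 * (D + 1) * C)) + eps / (2 * (D + 1)).
        by field; rewrite !gt_eqF // ltr_wpDl.
      apply: lerD; first by apply: le_trans (e_le _ _ _) _; rewrite ler_wpM2l // N2P.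
      by rewrite distrC N1P.
  exact: (cvg_unique _ (E_cvg _ t) c1).
Qed.
End Approximants.

(** The integrand in the last clause is [E s] applied to (L + w) S a. In this form the equation
    contains no unbounded operator, so the same statement serves the adjoint problem. *)
Theorem solution_family : exists (E : R -> X -> X) (M : R), [/\ 0 < M,
  forall a, continuous (E ^~ a), forall t a, `|E t a| <= M * `|a|,
  forall t, linear (E t) & (forall t a, E t (S a) = S (E t a)) /\
  forall a t, 0 <= t <= T ->
    E t (S a) = S a + J (fun s => E s (S a - a + w *: S a)) t].
Proof.
have KP n : exists K : {linear X -> X},
    (forall x, K x = n.+1%:R *: (P n x - x) + w *: x) /\
    forall x, `|K x| <= (2 * n.+1%:R + w) * `|x|.
  by have [K ? ?] := yosida_exists n; exists K.
have [K {}KP] := choice KP.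
have KE n x : K n x = n.+1%:R *: (P n x - x) + w *: x by have [-> _] := KP n.
have K_le n x : `|K n x| <= (2 * n.+1%:R + w) * `|x| by have [_] := KP n; apply.
have [C C0 gronwall] := fractional_gronwall alpha_gt0 Gamma_gt0 T_gt0 w_ge0.
have sol (na : nat * X) := volterra_exists norm_dot alpha_gt0 alpha_lt1 Gamma_gt0 T_gt0
  na.2 (addr_ge0 (mulr_ge0 (ler0n R 2) (ler0n R na.1.+1)) w_ge0) (K_le na.1).
have [e eP] := choice sol.
have e_cont n a : continuous (e (n, a)) by have [] := eP (n, a).
have e_clamp n a t : e (n, a) t = e (n, a) (clamp T t) by have [_ + _] := eP (n, a); apply.
have eE n a t : 0 <= t <= T -> e (n, a) t = a + J (fun s => K n (e (n, a) s)) t.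
  by have [_ _] := eP (n, a); apply.
have [E [cE E_le E_lin EJ]] := yosida_limit KE K_le C0 gronwall e_cont e_clamp eE.
by exists E, C.
Qed.
End Yosida.

Lemma pl_domB (R : realType) (X : normedModType R) (K : partial_linear X) x y :
  pl_dom K x -> pl_dom K y -> pl_dom K (x - y).
Proof. by move=> Dx Dy; rewrite addrC -scaleN1r; exact: pl_domP. Qed.

Lemma pl_funB (R : realType) (X : normedModType R) (K : partial_linear X) x y :
  pl_dom K x -> pl_dom K y -> K (x - y) = K x - K y.
Proof.
by move=> Dx Dy; rewrite addrC -scaleN1r pl_funP // scaleN1r addrC.
Qed.

Lemma subrACA (V : zmodType) (a b c d : V) : a - b - (c - d) = a - c - (b - d).
Proof. by rewrite !opprB [d - c]addrC addrACA [- b + d]addrC. Qed.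

(** * Resolvents of the perturbed operator *)

Section Resolvent.
Context (R : realType) (X : completeNormedModType R).
Context (A : partial_linear X) (A_dense : densely_defined A).
Hypothesis A_rho : forall l : R, 0 < l -> in_resolvent_set A l.
Hypothesis A_res : forall l : R, 0 < l -> l * opnorm (resolvent A l) <= 1.
Context (B : {linear X -> X}) (w : R) (w_ge0 : 0 <= w).
Hypothesis B_le : forall x, `|B x| <= w * `|x|.
Local Notation D := (pl_dom A).
Local Notation K := (add_bounded A B).

Lemma resolventP l y : 0 < l -> D (resolvent A l y) /\
  l *: resolvent A l y - A (resolvent A l y) = y.
Proof.
move=> l0; have [/(_ y) [x [hx _]] _] := A_rho l0.
by apply: (@xgetPex _ 0 [set x | D x /\ l *: x - A x = y]); exists x.
Qed.

Lemma resolvent_uniq l x : 0 < l -> D x -> resolvent A l (l *: x - A x) = x.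
Proof.
move=> l0 Dx; have [/(_ (l *: x - A x)) [z [hz uz]] _] := A_rho l0.
by rewrite -(uz _ (resolventP (l *: x - A x) l0)) (uz x).
Qed.

Lemma pl_domZ (c : R) x : D x -> D (c *: x).
Proof. by move=> Dx; rewrite -[c *: x]addr0; apply: pl_domP => //; exact: pl_dom0. Qed.

Lemma resolventZ l c y : 0 < l -> resolvent A l (c *: y) = c *: resolvent A l y.
Proof.
move=> l0; have [D1 E1] := resolventP y l0.
have A0 : A 0 = 0.
  have := @pl_funP _ _ A (-1) 0 0 (pl_dom0 A) (pl_dom0 A).
  by rewrite scaler0 addr0 scaleN1r addNr.
have {1}<- : l *: (c *: resolvent A l y) - A (c *: resolvent A l y) = c *: y.
  rewrite -[X in A X]addr0 pl_funP //; last exact: pl_dom0.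
  by rewrite A0 addr0 -{3}E1 scalerBr !scalerA mulrC.
by rewrite resolvent_uniq //; exact: pl_domZ.
Qed.

Lemma resolvent_le l y : 0 < l -> l * `|resolvent A l y| <= `|y|.
Proof.
move=> l0; have [_ [M hM]] := A_rho l0.
have [->|y0] := eqVneq y 0.
  by have := resolventZ 0 0 l0; rewrite !scale0r => ->; rewrite normr0 mulr0.
have ny : 0 < `|y| by rewrite normr_gt0.
have : `|resolvent A l (`|y|^-1 *: y)| <= opnorm (resolvent A l).
  apply: ub_le_sup; last first.
    by exists (`|y|^-1 *: y) => //=; rewrite normrZ gtr0_norm ?invr_gt0 // mulVf ?gt_eqF.
  exists `|M| => _ [x /= x1 <-]; apply: le_trans (hM x) _.
  apply: le_trans (ler_wpM2r (normr_ge0 x) (ler_norm M)) _.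
  exact: ler_piMr.
rewrite resolventZ // normrZ gtr0_norm ?invr_gt0 // ler_pdivrMl // => h.
apply: le_trans (ler_wpM2l (ltW l0) h) _.
by rewrite mulrCA; apply: ler_piMr (ltW ny) (A_res l0).
Qed.

(** The resolvent bound of [A] is used at [l + w]; the surplus w |x| pays for |B x|. *)
Lemma dissipative l x : 0 < l -> D x -> l * `|x| <= `|(l + w) *: x - K x|.
Proof.
move=> l0 Dx; have l1 : 0 < l + w by rewrite ltr_wpDr.
have := resolvent_le ((l + w) *: x - A x) l1; rewrite resolvent_uniq //.
have -> : (l + w) *: x - A x = ((l + w) *: x - K x) + B x by rewrite /= opprD addrA subrK.
move=> h; have := B_le x.
  have := ler_normD ((l + w) *: x - K x) (B x).
lra.
Qed.

(** The equation reads x = (l + w - A)^-1 (B x + y), a contraction of ratio w / (l + w). *)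
Lemma perturbed_surj l y : 0 < l -> exists x, D x /\ (l + w) *: x - K x = y.
Proof.
move=> l0; have l1 : 0 < l + w by rewrite ltr_wpDr.
have [] := @contraction_fixpoint _ X (fun x => resolvent A (l + w) (B x + y)) (w / (l + w)).
- by rewrite divr_ge0 // ltW.
- by rewrite ltr_pdivrMr // mul1r ltrDr.
- move=> x z; have [D1 E1] := resolventP (B x + y) l1.
  have [D2 E2] := resolventP (B z + y) l1.
  set r := resolvent _ _ _ in D1 E1 *; set s := resolvent _ _ _ in D2 E2 *.
  have D3 : D (r - s) by exact: pl_domB.
  have E3 : (l + w) *: (r - s) - A (r - s) = B (x - z).
    rewrite pl_funB // scalerBr subrACA E1 E2 linearB.
    by rewrite opprD addrACA subrr addr0.
  have := resolvent_le (B (x - z)) l1; rewrite -{1}E3 resolvent_uniq // => h.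
  rewrite mulrAC ler_pdivlMr // mulrC; exact: le_trans h (B_le _).
move=> x Ex; have [D1 E1] := resolventP (B x + y) l1.
rewrite -Ex in D1 E1; exists x; split => //=.
by rewrite opprD addrA E1 addrAC subrr add0r.
Qed.

Lemma resolvent_exists : exists S : R -> {linear X -> X},
  [/\ forall l y, 0 < l -> D (S l y) /\ (l + w) *: S l y - K (S l y) = y,
      forall l x, 0 < l -> D x -> S l ((l + w) *: x - K x) = x &
      forall l y, 0 < l -> l * `|S l y| <= `|y|].
Proof.
have /choice[S0 hS0] : forall p : R * X, exists x, 0 < p.1 -> D x /\ (p.1 + w) *: x - K x = p.2.
  move=> [l y] /=; have [l0|] := boolP (0 < l); last by exists 0.
  by have [x hx] := perturbed_surj y l0; exists x.
have uniq l x z : 0 < l -> D x -> D z -> (l + w) *: x - K x = (l + w) *: z - K z -> x = z.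
  move=> l0 Dx Dz e.
  have D3 : D (x - z) by exact: pl_domB.
  have E3 : (l + w) *: (x - z) - K (x - z) = 0.
    by rewrite (@pl_funB _ _ K) // scalerBr subrACA e subrr.
  have := dissipative l0 D3; rewrite E3 normr0 pmulr_rle0 // normr_le0 subr_eq0.
  by move/eqP.
(* [choice] needs a family that is total in [l]: the identity is a placeholder for [l <= 0]. *)
have lin l : exists S : {linear X -> X}, 0 < l -> S =1 (fun y => S0 (l, y)).
  have [l0|] := boolP (0 < l); last by exists idfun.
  have [|S hS] := @linear_pack R X X (fun y => S0 (l, y)); last by exists S.
  move=> c x y; have [D1 E1] := hS0 (l, x) l0; have [D2 E2] := hS0 (l, y) l0.
  have [D3 E3] := hS0 (l, c *: x + y) l0.
  apply: (uniq l) => //; first exact: pl_domP.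
  rewrite E3 (@pl_funP _ _ K) // scalerDr opprD addrACA E2 /= scalerA mulrC -scalerA.
  by rewrite -scalerBr E1.
have {lin}/choice[S hS] := lin.
have SP l y : 0 < l -> D (S l y) /\ (l + w) *: S l y - K (S l y) = y.
  by move=> l0; rewrite hS //; exact: (hS0 (l, y)).
exists S; split => //.
  move=> l x l0 Dx; have [D1 E1] := SP l ((l + w) *: x - K x) l0.
  exact: (uniq l).
by move=> l y l0; have [D1 E1] := SP l y l0; rewrite -{2}E1; exact: dissipative.
Qed.

(* A + B - w is m-dissipative; [S] is its resolvent at 1 and [P n] is n.+1 times
   its resolvent at n.+1. *)
Lemma yosida_family : exists (P : nat -> {linear X -> X}) (S : {linear X -> X}),
  [/\ (forall n x, `|P n x| <= `|x|) /\ (forall x, `|S x| <= `|x|),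
      (forall n m x, P n (P m x) = P m (P n x)) /\ (forall n x, P n (S x) = S (P n x)),
      forall n x, n.+1%:R *: (P n (S x) - S x) = P n (S x - x),
      forall x, P n x @[n --> \oo] --> x &
      (forall x, D (S x) /\ (1 + w) *: S x - K (S x) = x) /\
      forall x, D x -> S ((1 + w) *: x - K x) = x].
Proof.
have [S [SD SK S_le]] := resolvent_exists.
have n0 n : 0 < n.+1%:R :> R by [].
have [P PE] : exists P : nat -> {linear X -> X}, forall n x, P n x = n.+1%:R *: S n.+1%:R x.
  have /choice[P hP] : forall n, exists L : {linear X -> X}, forall x, L x = n.+1%:R *: S n.+1%:R x.
    move=> n; apply: linear_pack => c x y.
    by rewrite linearP scalerDr !scalerA mulrC.
  by exists P.
(* First resolvent identity: apply l + w - K to the left side, which [S l] inverts. *)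
have res l m x : 0 < l -> 0 < m -> (m - l) *: S l (S m x) + S m x = S l x.
  move=> l0 m0; set z := LHS.
  have [D1 E1] := SD l (S m x) l0; have [D2 E2] := SD m x m0.
  have Dz : D z by exact: pl_domP.
  rewrite -(SK l z) //; congr (S l _).
  rewrite (@pl_funP _ _ K) // scalerDr scalerA mulrC -scalerA opprD addrACA -scalerBr E1.
  rewrite addrA -scalerDl -[RHS]E2; congr (_ *: _ - _); ring.
(* Add the resolvent identity to the one with [l] and [m] exchanged, and divide by [m - l]. *)
have comm l m x : 0 < l -> 0 < m -> S l (S m x) = S m (S l x).
  move=> l0 m0; have [->//|lm] := eqVneq l m.
  have e1 := res l m x l0 m0; have e2 := res m l x m0 l0.
  have : (m - l) *: (S l (S m x) - S m (S l x)) = 0.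
    rewrite scalerBr -[X in _ - X]opprK -scaleNr opprB opprK.
    rewrite -[_ *: S l _](addrK (S m x)) e1 -[_ *: S m _](addrK (S l x)) e2.
    by rewrite addrA subrK subrr.
  move/eqP; rewrite scaler_eq0 !subr_eq0 eq_sym (negbTE lm) /= => /eqP.
  exact.
have P_le n x : `|P n x| <= `|x|.
  by rewrite PE normrZ normr_nat; exact: S_le.
exists P, (S 1); split.
- by split => // x; have := S_le 1 x ltr01; rewrite mul1r.
- split; first by move=> n m x; rewrite !PE !linearZ /= comm // !scalerA mulrC.
  by move=> n x; rewrite !PE linearZ /= comm.
- move=> n x; rewrite !PE; congr (_ *: _); rewrite linearB.
  have := res n.+1%:R 1 x (n0 n) ltr01.
  move=> <-; rewrite opprD addrA; congr (_ - _).
  by rewrite scalerBl scale1r opprB addrC subrK.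
- move=> x; apply/cvgrPdist_le => e e0; have e30 : 0 < e / 3 by rewrite divr_gt0.
  have [z [/= zx Dz]] : ball x (e / 3) `&` D !=set0.
    by apply: A_dense; [exists x; exact: ballxx|exact: ball_open].
  move: zx; rewrite -ball_normE /= => zx.
  (* On the domain, P n z - z is the resolvent at n + 1 applied to [y], hence of size at most |y| /
     (n + 1). Density and contractivity do the rest. *)
  set y := K z - w *: z.
  have Py n : P n z - z = S n.+1%:R y.
    have := SK n.+1%:R z (n0 n) Dz.
    have -> : (n.+1%:R + w) *: z - K z = n.+1%:R *: z - y.
      by rewrite /y opprB addrA scalerDl.
    rewrite linearB linearZ /= -PE => h; rewrite -[X in _ - X]h opprB addrC.
    exact: subrK.
  have : `|y| * n.+1%:R^-1 @[n --> \oo] --> 0.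
    by apply: cvg_mulr0; exact: cvg_harmonic.
  move/cvgrPdist_le => /(_ _ e30); apply: filterS => n.
  rewrite sub0r normrN ger0_norm; last by rewrite mulr_ge0 // invr_ge0.
  rewrite ler_pdivrMr // => hn.
  have h1 : `|P n z - z| <= e / 3.
    rewrite Py -(ler_pM2l (n0 n)) [X in _ <= X]mulrC.
    exact: le_trans (S_le _ _ (n0 n)) hn.
  have h2 : `|P n z - P n x| <= e / 3.
    by rewrite -linearB; apply: le_trans (P_le _ _) _; rewrite distrC ltW.
  have -> : x - P n x = (x - z) - (P n z - z) + (P n z - P n x).
    by rewrite opprB !addrA !subrK.
  have := ler_normD (x - z - (P n z - z)) (P n z - P n x).
  have := ler_normB (x - z) (P n z - z).
  lra.
by split => [x|x Dx]; [exact: SD|exact: SK].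
Qed.

End Resolvent.

(** * Reflections of the line and positivity of Gamma *)

Section Reflection.
Context (R : realType).
Local Notation mu := (@lebesgue_measure R).
Local Open Scope ereal_scope.

Lemma measurable_reflect (c : R) :
  measurable_fun setT ((fun s => c - s)%R : measurableTypeR R -> measurableTypeR R).
Proof. exact: measurable_funB. Qed.

Lemma reflect_itv (c : R) (x y : bool) (a b : R) :
  (fun s => c - s)%R @^-1` [set` Interval (BSide x a) (BSide y b)] =
  [set` Interval (BSide (~~ y) (c - b)%R) (BSide (~~ x) (c - a)%R)].
Proof.
by apply/seteqP; split => s; case: x y => -[] /=; rewrite !in_itv /=; lra.
Qed.

Lemma lebesgue_measure_reflect (c : R) (D : set R) : measurable D ->
  pushforward mu ((fun s => c - s)%R : R -> measurableTypeR R) D = mu D.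
Proof.
pose m := isMeasurableFun.Build _ _ _ _ _ (measurable_reflect c).
pose phi : {mfun measurableTypeR R >-> measurableTypeR R} :=
  HB.pack ((fun s => c - s)%R : measurableTypeR R -> measurableTypeR R) m.
move=> mD; apply/esym/(@lebesgue_measure_unique _ (pushforward mu phi)) => //= _ [[a b]] _ <-.
rewrite /pushforward /phi /= reflect_itv /= !lebesgue_measure_itv /= !lte_fin.
by rewrite ltrD2l ltrN2 -!EFinD; case: ifP => // _; congr (_%:E); lra.
Qed.

Lemma integral_reflect (c a b : R) (f : R -> \bar R) : measurable_fun setT f ->
  \int[mu]_(s in `]a, b[) f (c - s)%R = \int[mu]_(s in `](c - b)%R, (c - a)%R[) f s.
Proof.
move=> mf.
have ge0 (g : R -> \bar R) : measurable_fun setT g -> (forall s, 0 <= g s) ->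
    \int[mu]_(s in `]a, b[) g (c - s)%R = \int[mu]_(s in `](c - b)%R, (c - a)%R[) g s.
  move=> mg g0.
  have -> : `]a, b[%classic = (fun s => c - s)%R @^-1` `](c - b)%R, (c - a)%R[.
    by rewrite reflect_itv /= !subKr.
  have := @ge0_integral_pushforward _ _ _ _ R _ (measurable_reflect c) mu `](c - b)%R, (c - a)%R[ g.
  move=> <- //; last exact: measurable_funTS.
  by apply: eq_measure_integral => [|? S mS _]; [exact: measurable_reflect|exact: lebesgue_measure_reflect].
rewrite [LHS]integralE [RHS]integralE; congr (_ - _).
  rewrite -(ge0 (f^\+)%E) => [||s]; [|exact: measurable_funepos|exact: funepos_ge0].
  by congr (integral _ _ _); apply/funext => s; rewrite !funeposE.
rewrite -(ge0 (f^\-)%E) => [||s]; [|exact: measurable_funeneg|exact: funeneg_ge0].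
by congr (integral _ _ _); apply/funext => s; rewrite !funenegE.
Qed.

Lemma Rintegral_reflect (c a b : R) (f : R -> R) : measurable_fun setT f ->
  (\int[mu]_(s in `]a, b[) f (c - s) = \int[mu]_(s in `]c - b, c - a[) f s)%R.
Proof.
move=> mf; rewrite /Rintegral (@integral_reflect c a b (EFin \o f)) //.
exact/measurable_EFinP.
Qed.
End Reflection.

(** [Gamma] would be 0 if its integral were infinite, so finiteness has to be proved along with
    positivity. On ]0, 1[ the integrand lies between multiples of t^(alpha - 1), a reflected kernel;
    beyond 1 it is below the exponential density. *)
Lemma Gamma_gt0 (R : realType) (a : R) : 0 < a -> a < 1 -> 0 < Gamma a.
Proof.
move=> a0 a1; rewrite /Gamma /Rintegral.
pose mu := @lebesgue_measure R.
have mp (D : set R) : measurable_fun D (fun t : R => t `^ (a - 1)).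
  by apply: measurable_funTS; exact: measurable_powR.
have me (D : set R) : measurable_fun D (fun t : R => expR (- t)).
  by apply: measurable_funTS; apply: measurableT_comp => //; exact: measurable_expR.
have mf (D : set R) : measurable_fun D (fun t : R => (t `^ (a - 1) * expR (- t))%:E).
  by apply/measurable_EFinP; exact: measurable_funM.
have f0 (t : R) : (0 <= (t `^ (a - 1) * expR (- t))%:E)%E.
  by rewrite lee_fin mulr_ge0 ?powR_ge0 ?expR_ge0.
have Ip : (\int[mu]_(t in `]0%R, 1%R[) (t `^ (a - 1))%:E = a^-1%:E)%E.
  have := @integral_reflect R 1 0 1 (fun t => (t `^ (a - 1))%:E).
  rewrite subrr subr0 => <-; last exact/measurable_EFinP.
  rewrite (integral_kernel a0) // /kernel_mass subr0 subrr powR1 powR0 ?gt_eqF //.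
  by rewrite subr0 div1r.
have E : `]0, +oo[%classic = `]0, 1[%classic `|` `[1, +oo[%classic :> set R.
  apply/seteqP; split => t /=; rewrite !in_itv /= !andbT.
    by move=> t0; have [t1|t1] := ltP t 1; [left; rewrite t0|right].
  by case => [/andP[]//|]; apply: lt_le_trans.
rewrite {1}E /= ge0_integral_setU //; last first.
  - apply/disj_setPS => t /= [].
    by rewrite !in_itv /= andbT => /andP[_ t1]; rewrite leNgt t1.
  - exact: mf.
apply: fine_gt0; apply/andP; split.
  apply: (@lt_le_trans _ _ (\int[mu]_(t in `]0%R, 1%R[) (expR (-1) * t `^ (a - 1))%:E)%E).
    under eq_integral do rewrite EFinM.
    rewrite ge0_integralZl //; last first.
    - by move=> t _; rewrite lee_fin powR_ge0.
    - by apply/measurable_EFinP; exact: mp.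
    by rewrite Ip -EFinM lte_fin mulr_gt0 ?expR_gt0 ?invr_gt0.
  rewrite -[leLHS]adde0; apply: leeD; last by apply: integral_ge0 => t _.
  apply: ge0_le_integral => //.
  - by move=> t _; rewrite lee_fin mulr_ge0 ?powR_ge0 ?expR_ge0.
  - by apply/measurable_EFinP; apply: measurable_funM => //; exact: mp.
  - exact: mf.
  move=> t /=; rewrite in_itv /= => /andP[t0 t1].
  by rewrite lee_fin mulrC ler_wpM2l ?powR_ge0 // ler_expR lerN2 ltW.
apply: lte_add_pinfty.
  apply: (@le_lt_trans _ _ (\int[mu]_(t in `]0%R, 1%R[) (t `^ (a - 1))%:E)%E).
    apply: ge0_le_integral => //.
    - exact: mf.
    - by apply/measurable_EFinP; exact: mp.
    move=> t /=; rewrite in_itv /= => /andP[t0 t1].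
    by rewrite lee_fin ler_piMr ?powR_ge0 // expR_le1 oppr_le0 ltW.
  by rewrite Ip ltry.
apply: (@le_lt_trans _ _ (\int[mu]_t (exponential_pdf 1 t)%:E)%E).
  apply: (@le_trans _ _ (\int[mu]_(t in `[1%R, +oo[) (exponential_pdf 1 t)%:E)%E).
    apply: ge0_le_integral => //.
    - exact: mf.
    - by apply/measurable_EFinP; apply: measurable_funTS; exact: measurable_exponential_pdf.
    move=> t /=; rewrite in_itv /= andbT => t1.
    have t0 : 0 <= t by apply: le_trans t1.
    rewrite lee_fin exponential_pdfE // mul1r mulN1r ler_piMl ?expR_ge0 //.
    by rewrite -[leRHS](powRr0 t) ler_powR // subr_le0 ltW.
  apply: ge0_subset_integral => //.
  - by apply/measurable_EFinP; exact: measurable_exponential_pdf.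
  - by move=> t _; rewrite lee_fin exponential_pdf_ge0.
by rewrite integral_exponential_pdf // ltry.
Qed.

(** * Adjoints of the resolvents *)

Section AdjointFamily.
Context (R : realType) (X : completeNormedModType R).
Context (dot : {dot X for idfun}) (norm_dot : forall x : X, `|x| ^+ 2 = dot x x).

(** The identities are transposed by pairing. Strong convergence of the adjoints follows from |P' x
    - x|^2 <= 2 |x|^2 - 2 (P x, x) = 2 (x - P x, x), where only |P' x| <= |x| is used. *)
Lemma adjoint_family (P : nat -> {linear X -> X}) (S : {linear X -> X}) :
  (forall n x, `|P n x| <= `|x|) -> (forall x, `|S x| <= `|x|) ->
  (forall n m x, P n (P m x) = P m (P n x)) -> (forall n x, P n (S x) = S (P n x)) ->
  (forall n x, n.+1%:R *: (P n (S x) - S x) = P n (S x - x)) ->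
  (forall x, P n x @[n --> \oo] --> x) ->
  exists (P' : nat -> {linear X -> X}) (S' : {linear X -> X}),
  [/\ (forall n x, `|P' n x| <= `|x|) /\ (forall x, `|S' x| <= `|x|),
      (forall n m x, P' n (P' m x) = P' m (P' n x)) /\ (forall n x, P' n (S' x) = S' (P' n x)),
      forall n x, n.+1%:R *: (P' n (S' x) - S' x) = P' n (S' x - x),
      forall x, P' n x @[n --> \oo] --> x &
      forall x y, dot (S x) y = dot x (S' y)].
Proof.
move=> P_le S_le PP PS yS P_cvg.
have ad (L : {linear X -> X}) : (forall x, `|L x| <= `|x|) -> exists L' : {linear X -> X},
    (forall x y, dot (L x) y = dot x (L' y)) /\ forall y, `|L' y| <= `|y|.
  move=> L_le; have [|L' h1 h2] := @adjoint_exists _ _ _ norm_dot L 1 ler01.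
    by move=> x; rewrite mul1r.
  by exists L'; split => // y; have := h2 y; rewrite mul1r.
have [S' [SS S'_le]] := ad S S_le.
have /choice[P' hP] := fun n => ad (P n) (P_le n).
have PP' n x y : dot (P n x) y = dot x (P' n y) by have [h _] := hP n.
have P'_le n y : `|P' n y| <= `|y| by have [_ h] := hP n.
exists P', S'; split => //.
- split=> [n m x|n x]; apply: (dot_ext norm_dot) => y; rewrite ![dot _ y]dotC.
    by rewrite -!PP' PP.
  by rewrite -PP' -!SS -PP' PS.
- move=> n x; apply: (dot_ext norm_dot) => y; rewrite ![dot _ y]dotC.
  rewrite dotZr dotBr -PP' -SS -SS -PS -dotBl -dotZl yS.
  by rewrite -PP' dotBr -SS -dotBl; congr (dot _ _); rewrite linearB PS.
move=> x; apply/cvgrPdist_le => e e0.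
have x0 : 0 < 2 * (1 + `|x|) by rewrite mulr_gt0 // ltr_wpDr.
have e1 : 0 < e ^+ 2 / (2 * (1 + `|x|)) by rewrite divr_gt0 // exprn_gt0.
move/cvgrPdist_le : (@P_cvg x) => /(_ _ e1); apply: filterS => n.
rewrite ler_pdivlMr // => hn.
rewrite distrC -(ler_pXn2r (n := 2)) ?nnegrE ?(ltW e0) //.
apply: le_trans hn; rewrite norm_dot dotBl !dotBr -!norm_dot -PP'.
have -> : dot (P' n x) x = dot (P n x) x by rewrite dotC -PP'.
have h1 : `|P' n x| ^+ 2 <= `|x| ^+ 2 by rewrite ler_pXn2r ?nnegrE.
have : dot (x - P n x) x <= `|x - P n x| * `|x|.
  by apply: le_trans (ler_norm _) _; exact: dot_le.
rewrite dotBl -norm_dot.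
have : 0 <= `|x - P n x| by [].
nra.
Qed.
End AdjointFamily.

Lemma ge0_le_integral_nomeasurable d (U : measurableType d) (R : realType)
    (m : {measure set U -> \bar R}) (D : set U) (f g : U -> \bar R) :
  (forall x, D x -> 0 <= f x)%E -> (forall x, D x -> f x <= g x)%E ->
  (\int[m]_(x in D) f x <= \int[m]_(x in D) g x)%E.
Proof.
move=> f0 fg; rewrite integral_mkcond [leRHS]integral_mkcond.
apply: ge0_ae_le_integralT => [x|x|].
- by rewrite /patch; case: ifPn => // /set_mem; exact: f0.
- by rewrite /patch; case: ifPn => // /set_mem Dx; exact: le_trans (f0 x Dx) (fg x Dx).
apply: aeW => x; rewrite /patch; case: ifPn => // /set_mem; exact: fg.
Qed.

(** * Square-integrable functions *)

Section L2Facts.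
Context (R : realType) (X : completeNormedModType R).
Context (dot : {dot X for idfun}) (norm_dot : forall x : X, `|x| ^+ 2 = dot x x).
Context (T : R) (T_gt0 : 0 < T).
Local Notation mu := (@lebesgue_measure R).
Local Notation D := (`]0, T[%classic).
Implicit Types (v w : R -> X).

Let half_T : 0 < T / 2 < T.
Proof. by rewrite divr_gt0 // ltr_pdivrMr // ltr_pMr // ltr1n. Qed.

Let mD : measurable (D : set R). Proof. exact: measurable_itv. Qed.

Lemma simple_limitR_continuous v : continuous v -> simple_limitR v.
Proof. by move=> cv; apply: (@simple_limit_continuous _ (measurableTypeR R) R X v id). Qed.

Lemma L2_rep v : L2 T v -> exists v', [/\ simple_limitR v', eq_L2 T v v' & L2 T v'].
Proof.
move=> [sv fv]; have [v' sv' e] := strongly_measurable_rep mD sv.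
exists v'; split => //; split.
  by apply: (strongly_measurableI sv'); exact: ae_true.
rewrite -(lebesgue_integral_ae (f := fun t => (`|v t| ^+ 2)%:E)) //.
by apply: ae_imp e => t h Dt; rewrite h.
Qed.

Lemma L2_eq v w : L2 T v -> eq_L2 T w v -> L2 T w.
Proof.
move=> /L2_rep[v' [sv' e [_ fv]]] wv.
have wv' : {ae mu, forall t, D t -> w t = v' t}.
  by apply: ae_imp2 wv e => t h1 h2 Dt; rewrite h1 // h2.
split; first exact: (strongly_measurableI sv').
rewrite (lebesgue_integral_ae (g := fun t => (`|v' t| ^+ 2)%:E)) //.
by apply: ae_imp wv' => t h Dt; rewrite h.
Qed.

Lemma L2_bounded v (M : R) : simple_limitR v -> (forall t, 0 < t < T -> `|v t| <= M) -> L2 T v.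
Proof.
move=> sv vM; split; first by apply: (strongly_measurableI sv); exact: ae_true.
have M0 : 0 <= M.
  exact: le_trans (vM _ half_T).
apply: (@le_lt_trans _ _ (\int[mu]_(t in D) (M ^+ 2)%:E)%E); last first.
  rewrite integral_cst //; apply: lte_mul_pinfty; [by rewrite lee_fin exprn_ge0|by []|exact: itv_fin].
apply: ge0_le_integral => //.
- by apply/measurable_EFinP/measurable_funTS/measurable_funX; exact: simple_limit_norm.
- by move=> t; rewrite /= in_itv /= => /vM h; rewrite lee_fin lerXn2r ?nnegrE.
Qed.

Lemma L2_continuous v : continuous v -> L2 T v.
Proof.
move=> cv; have [M [M0 h]] := @continuous_bounded _ _ v T cv.
apply: (@L2_bounded v M (simple_limitR_continuous cv)) => t /andP[t0 tT].
by apply: h; rewrite !ltW.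
Qed.

Lemma simple_limitR_sq_integrable v : simple_limitR v -> L2 T v ->
  mu.-integrable D (EFin \o (fun t => `|v t| ^+ 2)).
Proof.
move=> sv [_ fv]; apply/integrableP; split.
  by apply/measurable_EFinP/measurable_funTS/measurable_funX; exact: simple_limit_norm.
by under eq_integral do rewrite /= ger0_norm ?exprn_ge0 //.
Qed.

Lemma L2_norm_integrable v : simple_limitR v -> L2 T v -> mu.-integrable D (EFin \o (fun t => `|v t|)).
Proof.
move=> sv Lv.
have ic : mu.-integrable D (EFin \o (fun=> 1 : R)).
  apply/integrableP; split; first exact: measurable_cst.
  rewrite (_ : (fun x => _) = cst 1%:E); last by apply/funext => t; rewrite /= normr1.
  by rewrite integral_cst // mul1e; exact: itv_fin.
have := integrableD_EFin (m := mu) mD ic (simple_limitR_sq_integrable sv Lv).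
apply: le_integrable => //.
  by apply/measurable_EFinP/measurable_funTS; exact: simple_limit_norm.
move=> t _; rewrite /= lee_fin normr_id.
rewrite [leRHS]ger0_norm; last by rewrite addr_ge0 // exprn_ge0.
have : 0 <= `|v t| by []. nra.
Qed.

Lemma L2_dot_integrable v w : simple_limitR v -> simple_limitR w -> L2 T v -> L2 T w ->
  mu.-integrable D (EFin \o (fun t => dot (v t) (w t))).
Proof.
move=> sv sw Lv Lw.
have := integrableD_EFin (m := mu) mD (simple_limitR_sq_integrable sv Lv)
  (simple_limitR_sq_integrable sw Lw).
apply: le_integrable => //.
  by apply/measurable_EFinP/measurable_funTS; exact: simple_limit_dot.
move=> t _; rewrite /= lee_fin.
rewrite [leRHS]ger0_norm; last by rewrite addr_ge0 // exprn_ge0.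
apply: le_trans (dot_le norm_dot _ _) _.
have : 0 <= `|v t| by []. have : 0 <= `|w t| by []. nra.
Qed.

Lemma dotL2C v w : dotL2 dot T v w = dotL2 dot T w v.
Proof. by apply: eq_Rintegral => t _; rewrite dotC. Qed.

Lemma dotL2_ae v w v' w' : eq_L2 T v v' -> eq_L2 T w w' ->
  dotL2 dot T v w = dotL2 dot T v' w'.
Proof.
move=> ev ew; apply: lebesgue_Rintegral_ae.
by apply: ae_imp2 ev ew => t h1 h2 Dt; rewrite h1 // h2.
Qed.

Lemma dotL2B v w z : L2 T v -> L2 T w -> L2 T z ->
  dotL2 dot T (fun t => v t - w t) z = dotL2 dot T v z - dotL2 dot T w z.
Proof.
move=> /L2_rep[v' [sv ev Lv]] /L2_rep[w' [sw ew Lw]] /L2_rep[z' [sz ez Lz]].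
rewrite (dotL2_ae ev ez) (dotL2_ae ew ez).
rewrite (@dotL2_ae _ z (fun t => v' t - w' t) z') //; last first.
  by apply: ae_imp2 ev ew => t h1 h2 Dt; rewrite h1 // h2.
rewrite /dotL2 -(RintegralB (mu := mu) mD); last 2 first.
- exact: L2_dot_integrable.
- exact: L2_dot_integrable.
by apply: eq_Rintegral => t _; rewrite dotBl.
Qed.

(** Continuity of the pairing for the uniform norm; it carries the weak equation from initial values
    in the domain to all others. *)
Lemma dotL2_small w : L2 T w -> exists2 C, 0 <= C & forall v (e : R), simple_limitR v ->
  (forall t, 0 < t < T -> `|v t| <= e) -> `|dotL2 dot T v w| <= e * C.
Proof.
move=> /L2_rep[w' [sw ew Lw]]; have iw := L2_norm_integrable sw Lw.
exists (\int[mu]_(t in D) `|w' t|); first by apply: Rintegral_ge0 => t _.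
move=> v e sv ve; have e0 : 0 <= e.
  exact: le_trans (ve _ half_T).
have Lv := L2_bounded sv ve.
rewrite (@dotL2_ae v w v w') //; last exact: ae_true.
have ii := L2_dot_integrable sv sw Lv Lw.
apply: le_trans (le_normr_Rintegral (mu := mu) mD ii) _.
rewrite -RintegralZl //; apply: le_Rintegral => //.
- exact: (integrable_norm (mu := mu)).
- exact: (integrableZl_EFin (m := mu)).
move=> t; rewrite /= in_itv /= => /ve h.
by apply: le_trans (dot_le norm_dot _ _) _; rewrite ler_wpM2r.
Qed.

Lemma L2_dom_measurable (K : partial_linear X) v : L2_dom K T v ->
  strongly_measurable setT Num.norm D v /\
  strongly_measurable setT Num.norm D (fun t => K (v t)).
Proof.
move=> [[aD [s [hs cs]]] _].
split; (split; first exact: ae_true).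
  exists s; split; first by move=> n; have [? _] := hs n; split.
  apply: ae_imp cs => t h Dt; have := h Dt; apply: squeeze_cvgr; last exact: cvg_cst.
  by apply: nearW => n; rewrite normr_ge0 /graph_norm lerDl normr_ge0.
exists (fun n t => K (s n t)); split.
  by move=> n; have [ss _] := hs n; split => //; exact: (fsimple_map K ss).
apply: ae_imp2 aD cs => t h1 h2 Dt; have := h2 Dt; apply: squeeze_cvgr; last exact: cvg_cst.
apply: nearW => n; rewrite normr_ge0 -pl_funB; last 2 first.
- exact: h1.
- by have [_] := hs n; apply; exists t.
by rewrite /graph_norm lerDr normr_ge0.
Qed.

Lemma L2_dom_L2 (K : partial_linear X) v : L2_dom K T v -> L2 T v.
Proof.
move=> Lv; have [sv _] := L2_dom_measurable Lv; split => //.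
case: Lv => _; apply: le_lt_trans; apply: ge0_le_integral_nomeasurable => t Dt.
  by rewrite lee_fin exprn_ge0.
by rewrite lee_fin lerXn2r ?nnegrE ?addr_ge0 // lerDl.
Qed.

Lemma graph_norm_ge0 (K : partial_linear X) x : 0 <= graph_norm K x.
Proof. exact: addr_ge0. Qed.

(** Serves to pass from [A] to A + B: the domains coincide, but [L2_dom] refers to two different
    graph norms. *)
Lemma L2_dom_le (K K' : partial_linear X) (M : R) v : pl_dom K `<=` pl_dom K' ->
  (forall x, pl_dom K x -> graph_norm K' x <= M * graph_norm K x) ->
  L2_dom K T v -> L2_dom K' T v.
Proof.
move=> KK' K'M [[aD [s [hs cs]]] fi].
have M0 : 0 <= M \/ forall x, pl_dom K x -> graph_norm K x = 0.
  have [|M0] := leP 0 M; first by left.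
  right => x Kx; apply/eqP; rewrite eq_le graph_norm_ge0 andbT.
  have := K'M x Kx; have := graph_norm_ge0 K' x; nra.
have {}K'M x : pl_dom K x -> graph_norm K' x <= `|M| * graph_norm K x.
  move=> Kx; apply: le_trans (K'M x Kx) _.
  by rewrite ler_wpM2r ?graph_norm_ge0 // ler_norm.
split.
  split; first by apply: ae_imp aD => t h Dt; exact/KK'/h.
  exists s; split; first by move=> n; have [h1 h2] := hs n; split => // x /h2 /KK'.
  apply: ae_imp2 aD cs => t h1 h2 Dt.
  have Ks n : pl_dom K (v t - s n t).
    by apply: pl_domB; [exact: h1|have [_] := hs n; apply; exists t].
  apply: squeeze_cvgr (cvg_mulr0 `|M| (h2 Dt)); last exact: cvg_cst.
  by apply: nearW => n; rewrite graph_norm_ge0 /= K'M.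
apply: (@le_lt_trans _ _ (\int[mu]_(t in D) ((`|M| ^+ 2)%:E * (graph_norm K (v t) ^+ 2)%:E))%E).
  have [N [mN N0 hN]] := aD.
  (* Where [v t] leaves the domain, on a null set, the norms cannot be compared; the integrand is
     replaced by 0 there. *)
  rewrite (lebesgue_integral_ae (g := fun t =>
    if `[< pl_dom K (v t) >] then (graph_norm K' (v t) ^+ 2)%:E else 0%E)); last first.
    by apply: ae_imp aD => t h Dt; rewrite asboolT //; exact: h.
  apply: ge0_le_integral_nomeasurable => t Dt; case: asboolP => Kt //.
  - by rewrite lee_fin exprn_ge0 // graph_norm_ge0.
  - rewrite -EFinM lee_fin -exprMn lerXn2r ?nnegrE ?mulr_ge0 ?graph_norm_ge0 //.
    exact: K'M.
  - by rewrite -EFinM lee_fin mulr_ge0 ?exprn_ge0 ?graph_norm_ge0.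
(* Taking the factor out of the integral uses a measurable integrand, which representatives of [v]
   and of [K (v t)] provide. *)
have [vm km] := L2_dom_measurable (conj (conj aD (ex_intro _ s (conj hs cs))) fi).
have [v' sv' ev] := strongly_measurable_rep mD vm.
have [k' sk' ek] := strongly_measurable_rep mD km.
pose g t := (((`|v' t| + `|k' t|) ^+ 2)%:E : \bar R).
have gE : {ae mu, forall t, D t -> (graph_norm K (v t) ^+ 2)%:E = g t}.
  by apply: ae_imp2 ev ek => t h1 h2 Dt; rewrite /g -h1 // -h2.
rewrite (lebesgue_integral_ae (g := fun t => (`|M| ^+ 2)%:E * g t)%E); last first.
  by apply: ae_imp gE => t h Dt; rewrite h.
rewrite ge0_integralZl //.
- apply: lte_mul_pinfty; [by rewrite lee_fin exprn_ge0|by []|].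
  by rewrite -(lebesgue_integral_ae gE).
- apply/measurable_EFinP/measurable_funTS/measurable_funX.
  by apply: measurable_funD; exact: simple_limit_norm.
- by move=> t _; rewrite lee_fin exprn_ge0 // addr_ge0.
Qed.

(** [S] is bounded from X into the domain with its graph norm, so composing [S] and [b] with simple
    approximations of the identity of the line gives simple functions that converge in the graph
    norm. *)
Lemma L2_dom_continuous (K : partial_linear X) (S : {linear X -> X}) (M : R) b :
  0 <= M -> (forall x, pl_dom K (S x)) -> (forall x, graph_norm K (S x) <= M * `|x|) ->
  continuous b -> L2_dom K T (fun t => S (b t)).
Proof.
move=> M0 SD S_le cb.
have [//|r [fr cr]] := @fsimple_approx _ (measurableTypeR R) R id.
split.
  split; first by apply: ae_true => t _; exact: SD.
  exists (fun n t => S (b (r n t))); split.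
    move=> n; split; first exact: (fsimple_map (fun x => S (b x)) (fr n)).
    by move=> _ [t _ <-]; exact: SD.
  apply: ae_true => t _.
  have h : `|b (r n t) - b t| @[n --> \oo] --> 0.
    by apply: cvg_dist0; exact: (cvg_comp _ _ (cr t) (cb _)).
  apply: squeeze_cvgr (cvg_mulr0 M h); last exact: cvg_cst.
  by apply: nearW => n; rewrite graph_norm_ge0 /= -linearB distrC S_le.
have [C [C0 hC]] : exists C, 0 <= C /\ forall t, 0 <= t <= T -> `|b t| <= C.
  by have [C C0 h] := @continuous_bounded _ _ b T cb; exists C.
apply: (@le_lt_trans _ _ (\int[mu]_(t in D) ((M * C) ^+ 2)%:E)%E); last first.
  rewrite integral_cst //; apply: lte_mul_pinfty;
    [by rewrite lee_fin exprn_ge0 ?mulr_ge0|by []|exact: itv_fin].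
apply: ge0_le_integral_nomeasurable => t; rewrite /= in_itv /=.
  by rewrite lee_fin exprn_ge0 ?graph_norm_ge0.
move=> /andP[t0 tT]; rewrite lee_fin lerXn2r ?nnegrE ?mulr_ge0 ?graph_norm_ge0 //.
by apply: le_trans (S_le _) _; rewrite ler_wpM2l // hC // !ltW.
Qed.

End L2Facts.

(** * Lebesgue differentiation and Fubini's theorem for the singular convolution *)

Section Fubini.
Context (R : realType).
Local Notation mu := (@lebesgue_measure R).
Local Notation RR := (measurableTypeR R * measurableTypeR R)%type.

Lemma Rintegral_fubini (F : RR -> R) : (mu \x mu)%E.-integrable setT (EFin \o F) ->
  \int[mu]_r (\int[mu]_t F (r, t)) = \int[mu]_t (\int[mu]_r F (r, t)).
Proof.
move=> iF; have E := Fubini iF.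
rewrite /Rintegral; congr fine.
rewrite -[LHS](lebesgue_integral_ae (f := fun r => \int[mu]_t (F (r, t))%:E)%E); last first.
  apply: ae_imp (ae_integrable1 iF) => r ir _.
  by rewrite fineK //; apply: integrable_fin_num.
rewrite -[RHS](lebesgue_integral_ae (f := fun t => \int[mu]_r (F (r, t))%:E)%E) //.
apply: ae_imp (ae_integrable2 iF) => r ir _.
by rewrite fineK //; apply: integrable_fin_num.
Qed.

(** Lebesgue differentiation: [f], extended by 0, is almost everywhere the derivative of its
    primitive, which vanishes. *)
Lemma integral0_itv (f : R -> R) (T : R) : mu.-integrable `]0, T[ (EFin \o f) ->
  (forall s, 0 < s <= T -> \int[mu]_(t in `]0, s[) f t = 0) ->
  {ae mu, forall t, 0 < t < T -> f t = 0}.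
Proof.
move=> fi f0; pose g : R -> R := f \_ `]0, T[%classic.
have mD : measurable (`]0, T[%classic : set R) by exact: measurable_itv.
have gi : mu.-integrable setT (EFin \o g).
  by have := fi; rewrite (integrable_mkcond (mu := mu) _ mD) restrict_EFin.
have gl : locally_integrable setT g by apply: integrable_locally => //; exact: openT.
have giy y : mu.-integrable `]-oo, y] (EFin \o g).
  exact: (integrableS (mu := mu) measurableT).
have := FTC1Ny giy gl.
have F0 y : \int[mu]_(t in `]-oo, y]) g t = 0.
  have [y0|y0] := leP y 0.
    rewrite (lebesgue_Rintegral_ae (g := fun=> 0)); first by rewrite Rintegral_cst // mul0r.
    apply: ae_true => t; rewrite /= in_itv /= => ty; rewrite /g patchE memNset //=.
    by rewrite in_itv /=; apply/negP; rewrite negb_and -leNgt (le_trans ty).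
  have s0 : 0 < Num.min y T <= T \/ T <= 0.
    by have [T0|T0] := leP T 0; [right|left; rewrite lt_min y0 T0 ge_min lexx orbT].
  have E : \int[mu]_(t in `]-oo, y]) g t = \int[mu]_(t in `]0, Num.min y T[) f t.
    rewrite Rintegral_mkcond [RHS]Rintegral_mkcond; apply: lebesgue_Rintegral_ae.
    have : {ae mu, forall t, t <> y}.
      exists [set y]; split; [exact: measurable_set1|exact: lebesgue_measure_set1|].
      by move=> t /= /contrapT.
    apply: ae_imp => t ty _; rewrite /patch /g /patch !mem_setE !in_itv /= lt_min.
    have -> : (t <= y) = (t < y) by rewrite le_eqVlt; case: eqP ty.
    by case: (t < y); case: (0 < t); case: (t < T).
  case: s0 => [/f0|T0]; first by rewrite E.
  rewrite E (_ : `]0, Num.min y T[%classic = set0) ?Rintegral_set0 //.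
  by apply/seteqP; split => t //=; rewrite in_itv /= lt_min; lra.
apply: ae_imp => t [_ h] tT; move: h.
have -> : (fun x => \int[mu]_(t in `]-oo, x]) g t) = cst 0 by apply/funext => y; exact: F0.
by rewrite derive1_cst /g patchE mem_set //= in_itv.
Qed.

End Fubini.

Section ConvolutionFubini.
Context (R : realType) (X : completeNormedModType R).
Context (dot : {dot X for idfun}) (norm_dot : forall x : X, `|x| ^+ 2 = dot x x).
Context (alpha : R) (alpha_gt0 : 0 < alpha) (alpha_lt1 : alpha < 1).
Local Notation mu := (@lebesgue_measure R).
Local Notation RR := (measurableTypeR R * measurableTypeR R)%type.

(* The kernel extended by 0, so that the double integrals range over the plane. *)
Definition pkernel (x : R) : R := \1_(`]0, +oo[%classic : set R) x * x `^ (alpha - 1).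

Lemma pkernel_ge0 x : 0 <= pkernel x.
Proof. by rewrite mulr_ge0 ?powR_ge0. Qed.

Lemma pkernelE x : pkernel x = if 0 < x then x `^ (alpha - 1) else 0.
Proof.
rewrite /pkernel indicE mem_setE in_itv /= andbT.
by case: ifP; rewrite ?mul1r ?mul0r.
Qed.

Lemma measurable_pkernel : measurable_fun setT pkernel.
Proof.
by apply: measurable_funM; [exact: measurable_indic|exact: measurable_powR].
Qed.

Lemma integral_pkernel (r s : R) : 0 < r < s ->
  (\int[mu]_t (pkernel (t - r) * \1_(`]0%R, s[%classic : set R) t)%:E = ((s - r) `^ alpha / alpha)%:E)%E.
Proof.
move=> /andP[r0 rs].
have mp : measurable_fun setT (fun t : R => ((t - r) `^ (alpha - 1))%:E).
  apply/measurable_EFinP; apply: (@measurableT_comp _ _ _ _ _ _ (fun x : R => x `^ (alpha - 1))).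
    exact: measurable_powR.
  exact: measurable_funB.
have := integral_reflect s 0 (s - r) mp.
rewrite subKr subr0.
under eq_integral do rewrite addrAC.
have sr : 0 <= s - r by rewrite subr_ge0 ltW.
rewrite (integral_kernel alpha_gt0) // /kernel_mass subr0 subrr powR0 ?gt_eqF // subr0 => ->.
rewrite [RHS]integral_mkcond; apply: eq_integral => t _.
rewrite /patch pkernelE indicE !mem_setE !in_itv /= subr_gt0.
case: (ltP r t) => [rt|tr] /=; last by rewrite mul0r.
by rewrite (lt_trans r0 rt) /=; case: ifP; rewrite ?mulr1 ?mulr0.
Qed.

Section Functions.
Variables (s G : R) (w g : R -> X).
Hypotheses (G_ge0 : 0 <= G) (slw : simple_limitR w) (slg : simple_limitR g).
Hypothesis w0 : forall r, ~ 0 < r < s -> w r = 0.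
Hypothesis g0 : forall t, ~ 0 < t < s -> g t = 0.
Hypothesis gG : forall t, `|g t| <= G.
Hypothesis wi : mu.-integrable setT (EFin \o (fun r => `|w r|)).

Let N (p : RR) : R := pkernel (p.2 - p.1) * \1_(`]0, s[%classic : set R) p.2 * `|w p.1|.

Let measurable_N : measurable_fun setT N.
Proof.
apply: measurable_funM; first apply: measurable_funM.
- apply: (measurableT_comp measurable_pkernel).
  by apply: measurable_funB; [exact: measurable_snd|exact: measurable_fst].
- by apply: (measurableT_comp _ measurable_snd); exact: measurable_indic.
- by apply: (measurableT_comp (simple_limit_norm slw) measurable_fst).
Qed.

Let ind_ge0 t : 0 <= (\1_(`]0, s[%classic : set R) t : R).
Proof. by rewrite indicE. Qed.

Let N_ge0 p : 0 <= N p.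
Proof.
by apply: mulr_ge0 => //; apply: mulr_ge0; [exact: pkernel_ge0|exact: ind_ge0].
Qed.

(** Tonelli: integrated over [t] first, the kernel contributes at most s^alpha / alpha for each [r],
    and the norm of [w] is integrable. *)
Let integrable_N : (mu \x mu)%E.-integrable setT (EFin \o N).
Proof.
apply/integrable12ltyP; first by apply/measurable_EFinP; exact: measurable_N.
have [M ME] : exists M : R, M = s `^ alpha / alpha by eexists.
have M0 : 0 <= M by rewrite ME divr_ge0 ?powR_ge0 // ltW.
move/integrableP : (integrableZl_EFin (m := mu) measurableT wi M) => [_].
apply: le_lt_trans; apply: ge0_le_integral_nomeasurable => r _.
  by apply: integral_ge0.
under eq_integral do rewrite /= ger0_norm ?N_ge0 //.
have [rs|rs] := pselect (0 < r < s); last first.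
  by rewrite integral0_eq // => t _; rewrite /N /= w0 // normr0 mulr0.
under eq_integral do rewrite /N /= mulrC EFinM.
rewrite ge0_integralZl //; last first.
- by move=> t _; rewrite lee_fin mulr_ge0 ?pkernel_ge0 ?ind_ge0.
- apply/measurable_EFinP; apply: measurable_funM; last exact: measurable_indic.
  by apply: (measurableT_comp measurable_pkernel); exact: measurable_funB.
rewrite integral_pkernel // -EFinM lee_fin ger0_norm ?mulr_ge0 // mulrC.
rewrite ler_wpM2r // ME ler_wpM2r ?invr_ge0 ?(ltW alpha_gt0) //.
case/andP: rs => r0 rs.
by rewrite ge0_ler_powR ?nnegrE ?(ltW alpha_gt0) ?subr_ge0 ?(ltW rs) ?(ltW (lt_trans r0 rs)) // gerBl ltW.
Qed.

Lemma convolution_fubini :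
  \int[mu]_r (\int[mu]_t (pkernel (t - r) * dot (w r) (g t))) =
  \int[mu]_t (\int[mu]_r (pkernel (t - r) * dot (w r) (g t))).
Proof.
apply: (@Rintegral_fubini R (fun p => pkernel (p.2 - p.1) * dot (w p.1) (g p.2))).
have := integrableZl_EFin (m := (mu \x mu)%E) measurableT integrable_N G.
apply: le_integrable => //.
  apply/measurable_EFinP; apply: measurable_funM.
    apply: (measurableT_comp measurable_pkernel).
    by apply: measurable_funB; [exact: measurable_snd|exact: measurable_fst].
  apply: (simple_limit_dot norm_dot).
    exact: (simple_limit_comp measurable_fst slw).
  exact: (simple_limit_comp measurable_snd slg).
move=> [r t] _; have GN : 0 <= G * N (r, t) by apply: mulr_ge0 => //; exact: N_ge0.
rewrite /= lee_fin (ger0_norm GN) normrM (ger0_norm (pkernel_ge0 _)).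
have -> : G * N (r, t) = pkernel (t - r) * (\1_(`]0, s[%classic : set R) t * (G * `|w r|)).
  rewrite /N /=; ring.
apply: ler_wpM2l; first exact: pkernel_ge0.
have [ts|ts] := pselect (0 < t < s); last by rewrite g0 // dot0r normr0 !mulr_ge0 ?ind_ge0.
rewrite indicE mem_set /= ?in_itv //= mul1r mulrC.
by apply: le_trans (dot_le norm_dot _ _) _; rewrite ler_wpM2l.
Qed.

(** Boundedness of [w] is not assumed, so finiteness is claimed only almost everywhere; there [J] is
    a true Bochner integral and not the default value 0. *)
Lemma convolution_ae : {ae mu, forall t, 0 < t < s ->
  (\int[mu]_r (pkernel (t - r) * `|w r|)%:E < +oo)%E}.
Proof.
apply: ae_imp (ae_integrable2 integrable_N) => t /integrableP[_ h] ts.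
apply: le_lt_trans h; rewrite le_eqVlt; apply/orP; left; apply/eqP.
apply: eq_integral => r _; rewrite /= ger0_norm ?N_ge0 // /N /= indicE mem_set /= ?in_itv //=.
by rewrite mulr1.
Qed.

End Functions.
End ConvolutionFubini.

(** * Duality between the fractional integral and its time reversal *)

Section Duality.
Context (R : realType) (X : completeNormedModType R).
Context (dot : {dot X for idfun}) (norm_dot : forall x : X, `|x| ^+ 2 = dot x x).
Context (alpha : R) (alpha_gt0 : 0 < alpha) (alpha_lt1 : alpha < 1).
Context (Gamma_gt0 : 0 < Gamma alpha) (T : R) (T_gt0 : 0 < T).
Local Notation mu := (@lebesgue_measure R).
Local Notation D := (`]0, T[%classic).
Local Notation J := (@J R X alpha).
Local Notation c := (Gamma alpha)^-1.
Implicit Types (u v w g : R -> X).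

Lemma J_dot_simple_limit v t y : simple_limitR v ->
  (\int[mu]_(r in `]0%R, t[) (kernel alpha t r * `|v r|)%:E < +oo)%E ->
  dot (J v t) y = \int[mu]_(r in `]0, t[) (kernel alpha t r * dot (v r) (c *: y)).
Proof.
move=> sv fi; rewrite /Defs.J dotZl -dotZr.
have sl : simple_limitR (fun s => (t - s) `^ (alpha - 1) *: v s).
  by apply: simple_limit_scale => //; exact: (@measurable_kernel R alpha t).
rewrite (bochner_dot norm_dot).
- by apply: eq_Rintegral => s _; rewrite dotZl.
- exact: measurable_itv.
- exact: itv_fin.
- by apply: (strongly_measurableI sl); exact: ae_true.
- apply: le_lt_trans fi; rewrite le_eqVlt; apply/orP; left; apply/eqP.
  by apply: eq_integral => s _; rewrite normrZ ger0_norm ?powR_ge0.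
Qed.

(** For fixed [x] the pairing vanishes off a null set depending on [x]. X need not be separable, but
    the simple functions approximating [v] take countably many values in all; off one null set [v t]
    is orthogonal to all of these, hence to their limit [v t]. *)
Lemma L2_eq0 v : L2 T v ->
  (forall s x, 0 < s <= T -> \int[mu]_(t in `]0, s[) dot (v t) x = 0) ->
  eq_L2 T v (fun=> 0).
Proof.
move=> /(L2_rep)[v' [sv' ev Lv']] v0.
have mD : measurable (D : set R) by exact: measurable_itv.
have dot0 x : {ae mu, forall t, 0 < t < T -> dot (v' t) x = 0}.
  have Lx : L2 T (fun=> x) by apply: (L2_continuous T_gt0) => ?; exact: cvg_cst.
  have sx : simple_limitR (fun=> x) by exact: simple_limit_cst.
  apply: (integral0_itv (L2_dot_integrable norm_dot sv' sx Lv' Lx)) => s /andP[s0 sT].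
  apply: etrans (v0 s x _); last by rewrite s0.
  apply: lebesgue_Rintegral_ae; apply: ae_imp ev => t h.
  by rewrite /= !in_itv /= in h * => /andP[t0 ts]; rewrite h // t0 (lt_le_trans ts).
have [r [sr vr]] := sv'.
have fr n : exists e : seq X, forall t, r n t \in e.
  have [/finite_seqP[e E] _] := sr n; exists e => t.
  have : range (r n) (r n t) by exists t.
  by rewrite E.
have /choice[e he] := fr.
have h n i : {ae mu, forall t, 0 < t < T -> dot (v' t) (nth 0 (e n) i) = 0} by exact: dot0.
have {}h : {ae mu, forall t, forall n i, 0 < t < T -> dot (v' t) (nth 0 (e n) i) = 0}.
  by apply: ae_foralln => n; apply: ae_foralln => i; exact: h.
apply: ae_imp2 ev h => t ev h Dt; rewrite ev //.
have tT : 0 < t < T by move: Dt; rewrite /= in_itv.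
apply/eqP; rewrite -normr_eq0 -sqrf_eq0 norm_dot; apply/eqP.
have c1 : dot (v' t) (r n t) @[n --> \oo] --> dot (v' t) (v' t).
  by apply: (dot_cvg norm_dot) => //; exact: cvg_cst.
have c2 : dot (v' t) (r n t) @[n --> \oo] --> (0 : R).
  rewrite (_ : (fun n => _) = cst 0); first exact: cvg_cst.
  by apply/funext => n; rewrite -(nth_index 0 (he n t)) h.
exact: (cvg_unique _ c1 c2).
Qed.

Section Test.
Variables (g : R -> X) (s : R).
Hypotheses (cg : continuous g) (s_gt0 : 0 < s) (sT : s <= T).

Let cgs : continuous (fun t => g (s - t)).
Proof.
move=> t; apply: (@continuous_comp _ _ _ (fun t => s - t) g); last exact: cg.
by apply: cvgB; [exact: cvg_cst|exact: cvg_id].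
Qed.

Let st_itv (t : R) : 0 < t < T -> t < s -> 0 <= s - t <= T.
Proof.
move=> /andP[t0 tT] ts; rewrite subr_ge0 (ltW ts) /= lerBlDr.
by apply: le_trans sT _; rewrite lerDl ltW.
Qed.

Let cutE (t : R) (x : X) :
  (\1_(`]-oo, s[%classic : set R) t : R) *: x = if t < s then x else 0.
Proof.
by rewrite indicE mem_setE in_itv /=; case: ifP; rewrite ?scale1r ?scale0r.
Qed.

Lemma L2_test v : continuous v -> L2 T (fun t => if t < s then v (s - t) else 0).
Proof.
move=> cv; have [M [M0 hM]] : exists M, 0 <= M /\ forall t, 0 <= t <= T -> `|v t| <= M.
  by have [M M0 h] := @continuous_bounded _ _ v T cv; exists M.
have cvs : continuous (fun t => v (s - t)).
  move=> t; apply: (@continuous_comp _ _ _ (fun t => s - t) v); last exact: cv.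
  by apply: cvgB; [exact: cvg_cst|exact: cvg_id].
apply: (L2_bounded T_gt0 (M := M)).
  have := simple_limit_indic (measurable_itv `]-oo, s[) (simple_limitR_continuous cvs).
  by congr (simple_limitR _); apply/funext => t; rewrite cutE.
by move=> t tT; case: ifP => [ts|]; rewrite ?normr0 //; apply/hM/st_itv.
Qed.

(* The adjoint of [J] is [J] conjugated by the time reversal t |-> s - t. *)
Lemma dt_adjoint : adjoint dot T (dt alpha T)
  (fun t => if t < s then J g (s - t) else 0) (fun t => if t < s then g (s - t) else 0).
Proof.
split; last 2 first.
- exact: L2_test.
- move=> u w [Lw uJ].
  have [w1 [sw1 ew Lw1]] := L2_rep Lw.
  have mD : measurable (D : set R) by exact: measurable_itv.
  have mS : measurable (`]0, s[%classic : set R) by exact: measurable_itv.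
  pose w2 r := (\1_(`]0, s[%classic : set R) r : R) *: w1 r.
  pose g1 t := (\1_(`]0, s[%classic : set R) t : R) *: g (s - t).
  pose w3 r := c *: w2 r.
  have indE (t : R) (x : X) :
      (\1_(`]0, s[%classic : set R) t : R) *: x = if 0 < t < s then x else 0.
    by rewrite indicE mem_setE in_itv /=; case: ifP; rewrite ?scale1r ?scale0r.
  have sw2 : simple_limitR w2 by exact: simple_limit_indic.
  have sw3 : simple_limitR w3 by apply: simple_limit_scale => //; exact: measurable_cst.
  have sgs : simple_limitR (fun t => g (s - t)) by exact: simple_limitR_continuous cgs.
  have sg1 : simple_limitR g1 by exact: simple_limit_indic.
  have w20 r : ~ 0 < r < s -> w2 r = 0 by move=> h; rewrite /w2 indE ifN //; exact/negP.
  have w30 r : ~ 0 < r < s -> w3 r = 0 by move=> h; rewrite /w3 w20 // scaler0.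
  have g10 r : ~ 0 < r < s -> g1 r = 0 by move=> h; rewrite /g1 indE ifN //; exact/negP.
  have [G [G0 hG]] : exists G, 0 <= G /\ forall t, 0 <= t <= T -> `|g t| <= G.
    by have [G G0 h] := @continuous_bounded _ _ g T cg; exists G.
  have gG t : `|g1 t| <= G.
    rewrite /g1 indE; case: ifP => [/andP[t0 ts]|_]; last by rewrite normr0.
    by apply/hG/st_itv => //; rewrite t0 (lt_le_trans ts sT).
  have c_ge0 : 0 <= c by rewrite invr_ge0 ltW.
  have w2i : mu.-integrable setT (EFin \o (fun r => `|w2 r|)).
    have i1 : mu.-integrable `]0, s[ (EFin \o (fun r => `|w1 r|)).
      apply: (integrableS (mu := mu) mD) => //; last exact: L2_norm_integrable.
      by move=> t; rewrite /= !in_itv /= => /andP[-> ts]; rewrite (lt_le_trans ts).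
    move: i1; rewrite (integrable_mkcond (mu := mu) _ mS) restrict_EFin.
    congr (mu.-integrable _ (EFin \o _)); apply/funext => r.
    rewrite /w2 indE /patch mem_setE in_itv /=; case: ifP => // _.
    by rewrite normr0.
  have w3i : mu.-integrable setT (EFin \o (fun r => `|w3 r|)).
    rewrite (_ : (fun r => `|w3 r|) = (fun r => c * `|w2 r|)).
      exact: (integrableZl_EFin (m := mu) measurableT w2i c).
    by apply/funext => r; rewrite /w3 normrZ (ger0_norm c_ge0).
  have F := convolution_fubini norm_dot alpha_gt0 G0 sw3 sg1 w30 g10 gG w3i.
  have A := convolution_ae alpha_gt0 sw2 w20 w2i.
  have zero (f : R -> R) : (forall r, f r = 0) -> \int[mu]_r f r = 0.
    move=> f0; rewrite (_ : f = cst 0); first by rewrite Rintegral_cst // mul0r.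
    exact/funext.
  (* For fixed [r], expand [J g (s - r)] and substitute t = s - q: the kernel then depends on
     [t - r]. *)
  transitivity (\int[mu]_r (\int[mu]_t (pkernel alpha (t - r) * dot (w3 r) (g1 t)))).
    rewrite (dotL2_ae dot ew (w' := fun t => if t < s then J g (s - t) else 0)); last exact: ae_true.
    rewrite /dotL2 Rintegral_mkcond; apply: eq_Rintegral => r _.
    have [rs|rs] := pselect (0 < r < s); last first.
      rewrite [RHS]zero; last by move=> t; rewrite w30 // dot0l mulr0.
      rewrite /patch mem_setE in_itv /=; case: ifP => // /andP[r0 rT].
      by rewrite ifN ?dot0r //; apply/negP => rs'; apply: rs; rewrite r0.
    have [r0 r1] := andP rs.
    have rD : r \in D by apply/mem_set; rewrite /= in_itv /= r0 (lt_le_trans r1 sT).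
    rewrite patchE rD r1.
    have sr : 0 <= s - r by rewrite subr_ge0 ltW.
    rewrite dotC (J_dot norm_dot alpha_gt0 (w1 r) cg sr).
    rewrite -(JrZ alpha_gt0 c (continuous_dot norm_dot (y := w1 r) cg) sr) /rl_integral.
    pose f t := (t - r) `^ (alpha - 1) * dot (g (s - t)) (w3 r).
    have mf : measurable_fun setT f.
      apply: measurable_funM.
        apply: (@measurableT_comp _ _ _ _ _ _ (fun x : R => x `^ (alpha - 1))).
          exact: measurable_powR.
        exact: measurable_funB.
      apply: (simple_limit_dot norm_dot); first exact: (simple_limitR_continuous cgs).
      exact: simple_limit_cst.
    transitivity (\int[mu]_(q in `]0, s - r[) f (s - q)).
      apply: eq_Rintegral => q _; rewrite /f subKr /kernel addrAC; congr (_ * _).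
      by rewrite /w3 dotZr /w2 indE rs.
    rewrite (Rintegral_reflect _ _ _ mf) subKr subr0 Rintegral_mkcond.
    apply: eq_Rintegral => t _; rewrite /patch mem_setE in_itv /= pkernelE subr_gt0.
    case: (ltP r t) => [rt|_] /=; last by rewrite mul0r.
    case: ifP => ts; last by rewrite g10 ?dot0r ?mulr0 // => /andP[_]; rewrite ts.
    by rewrite /f /g1 indE (lt_trans r0 rt) ts /= [dot (w3 r) _]dotC.
  (* After Fubini the inner integral is the pairing of [J w t] with [g (s - t)], for almost every
     [t]. *)
  rewrite F /dotL2 [RHS]Rintegral_mkcond; apply: lebesgue_Rintegral_ae.
  apply: ae_imp2 A uJ => t At uJ _.
  have [ts|ts] := pselect (0 < t < s); last first.
    rewrite zero; last by move=> r; rewrite g10 // dot0r mulr0.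
    rewrite /patch mem_setE in_itv /=; case: ifP => // /andP[t0 tT].
    by rewrite ifN ?dot0r //; apply/negP => ts'; apply: ts; rewrite t0.
  have [t0 t1] := andP ts.
  have tD : D t by rewrite /= in_itv /= t0 (lt_le_trans t1 sT).
  rewrite patchE (mem_set tD) t1 (uJ tD).
  rewrite (_ : J w t = J w1 t); last first.
    apply: J_ae; apply: ae_imp ew => q h /andP[q0 qt]; apply: h.
    by rewrite /= in_itv /= q0 (lt_trans qt (lt_le_trans t1 sT)).
  rewrite (J_dot_simple_limit _ sw1); last first.
    apply: le_lt_trans (At ts); rewrite [leLHS]integral_mkcond.
    apply: ge0_le_integral_nomeasurable => r _; rewrite /patch mem_setE in_itv /=.
      by case: ifP => // _; rewrite lee_fin mulr_ge0 ?kernel_ge0.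
    case: ifP => [/andP[r0 rt]|_]; last by rewrite lee_fin mulr_ge0 ?pkernel_ge0.
    by rewrite lee_fin pkernelE subr_gt0 rt /w2 indE r0 (lt_trans rt t1).
  rewrite [RHS]Rintegral_mkcond; apply: eq_Rintegral => r _.
  rewrite /patch mem_setE in_itv /= pkernelE subr_gt0 andbC.
  case: (ltP r t) => [rt|_] /=; last by rewrite mul0r.
  case: (ltP 0 r) => r0; last by rewrite w30 ?dot0l ?mulr0 // => /andP[]; rewrite ltNge r0.
  have w3E : w3 r = c *: w1 r by rewrite /w3 /w2 indE r0 (lt_trans rt t1).
  have g1E : g1 t = g (s - t) by rewrite /g1 indE ts.
  by rewrite w3E g1E dotZl -dotZr.
(* Square integrability of the first test function is obtained from the clamped [J g], which agrees
   with it on the interval and is continuous on the line. *)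
have cJ := J_clamp_continuous norm_dot alpha_gt0 alpha_lt1 Gamma_gt0 (ltW T_gt0) cg.
apply: (L2_eq (L2_test cJ)); apply: ae_true => t.
rewrite /= in_itv /= => tT; case: ifP => [ts|_]; last by [].
by rewrite (clamp_id (st_itv tT ts)).
Qed.

End Test.
End Duality.

Lemma L2B (R : realType) (X : completeNormedModType R) (T : R) (v w : R -> X) :
  L2 T v -> L2 T w -> L2 T (fun t => v t - w t).
Proof.
move=> /L2_rep[v' [sv ev Lv]] /L2_rep[w' [sw ew Lw]].
apply: (@L2_eq _ _ _ (fun t => v' t - w' t)); last first.
  by apply: ae_imp2 ev ew => t h1 h2 Dt; rewrite h1 // h2.
split; first by apply: (strongly_measurableI (simple_limitRB sv sw)); exact: ae_true.
have mD : measurable (`]0, T[%classic : set R) by exact: measurable_itv.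
have i1 := simple_limitR_sq_integrable sv Lv; have i2 := simple_limitR_sq_integrable sw Lw.
have := integrableZl_EFin (m := lebesgue_measure) mD
  (integrableD_EFin (m := lebesgue_measure) mD i1 i2) 2.
move=> /integrableP[_]; apply: le_lt_trans; apply: ge0_le_integral_nomeasurable => t _.
  by rewrite lee_fin exprn_ge0.
rewrite /= lee_fin ger0_norm; last by rewrite mulr_ge0 // addr_ge0 // exprn_ge0.
have h : `|v' t - w' t| <= `|v' t| + `|w' t| by exact: ler_normB.
have h2 : `|v' t - w' t| ^+ 2 <= (`|v' t| + `|w' t|) ^+ 2.
  by rewrite lerXn2r ?nnegrE ?addr_ge0.
have := sqr_ge0 (`|v' t| - `|w' t|); rewrite sqrrB; move: h2; rewrite sqrrD; lra.
Qed.

(** * Weak and strong solutions *)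

Section Solutions.
Context (R : realType) (X : completeNormedModType R).
Context (dot : {dot X for idfun}) (norm_dot : forall x : X, `|x| ^+ 2 = dot x x).
Context (alpha : R) (alpha_gt0 : 0 < alpha) (alpha_lt1 : alpha < 1).
Context (T : R) (T_gt0 : 0 < T).
Context (A : partial_linear X) (A_dense : densely_defined A) (B : {linear X -> X}).
Context (w : R) (w_ge0 : 0 <= w) (B_le : forall x, `|B x| <= w * `|x|).
Local Notation mu := (@lebesgue_measure R).
Local Notation K := (add_bounded A B).
Local Notation J := (@J R X alpha).
Variables (S S' : {linear X -> X}) (E E' : R -> X -> X) (M : R).
Hypothesis SD : forall x, pl_dom A (S x) /\ (1 + w) *: S x - K (S x) = x.
Hypothesis SK : forall x, pl_dom A x -> S ((1 + w) *: x - K x) = x.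
Hypothesis S_le : forall x, `|S x| <= `|x|.
Hypothesis S'_le : forall x, `|S' x| <= `|x|.
Hypothesis SS : forall x y, dot (S x) y = dot x (S' y).
Hypothesis M_gt0 : 0 < M.
Hypothesis E_cont : forall a, continuous (E ^~ a).
Hypothesis E_le : forall t a, `|E t a| <= M * `|a|.
Hypothesis E_lin : forall t, linear (E t).
Hypothesis ES : forall t a, E t (S a) = S (E t a).
Hypothesis EJ : forall a t, 0 <= t <= T ->
  E t (S a) = S a + J (fun s => E s (S a - a + w *: S a)) t.
Hypothesis E'_cont : forall a, continuous (E' ^~ a).
Hypothesis E'_lin : forall t, linear (E' t).
Hypothesis ES' : forall t a, E' t (S' a) = S' (E' t a).
Hypothesis EJ' : forall a t, 0 <= t <= T ->
  E' t (S' a) = S' a + J (fun s => E' s (S' a - a + w *: S' a)) t.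

Let Gamma_gt0 : 0 < Gamma alpha. Proof. exact: Gamma_gt0. Qed.

Lemma operator_resolvent x : K (S x) = S x - x + w *: S x.
Proof.
have [_] := SD x; rewrite scalerDl scale1r => h.
by rewrite addrAC -[X in _ - X]h subKr.
Qed.

Lemma linear_generator (F : R -> X -> X) (L : {linear X -> X}) t a :
  linear (F t) -> (forall a, F t (L a) = L (F t a)) ->
  F t (L a - a + w *: L a) = L (F t a) - F t a + w *: L (F t a).
Proof.
move=> lF FL; have [G GE] := linear_pack lF.
by rewrite -!GE linearD linearB linearZ /= !GE FL.
Qed.

Lemma operator_solution t b : K (E t (S b)) = E t (S b - b + w *: S b).
Proof. by rewrite ES operator_resolvent (linear_generator b (E_lin t) (ES t)). Qed.

Lemma solution_linearB t a z : E t a - E t z = E t (a - z).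
Proof. by have [L LE] := linear_pack (E_lin t); rewrite -!LE linearB. Qed.

(** The vectors [S b] exhaust the domain of [A]. For them [EJ] is the equation itself, its integrand
    being (A + B) u by [operator_solution]. *)
Lemma strong_solutionE b : strong_solution alpha T A B (S b) (E ^~ (S b)).
Proof.
have Ku : (fun t => A (E t (S b)) + B (E t (S b))) = E ^~ (S b - b + w *: S b).
  by apply/funext => t; exact: operator_solution.
have Lz := L2_continuous T_gt0 (@E_cont (S b - b + w *: S b)).
have eJ : eq_L2 T (fun t => E t (S b) - S b) (J (E ^~ (S b - b + w *: S b))).
  apply: ae_true => t; rewrite /= in_itv /= => /andP[t0 tT].
  by rewrite EJ ?(ltW t0) ?(ltW tT) // addrC addKr.
split; last by rewrite Ku.
- rewrite (_ : E ^~ (S b) = (fun t => S (E t b))); last by apply/funext => t; exact: ES.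
  (* [3 + 2 * w] comes from |S x| + |S x - x + w S x - B (S x)| with |S x| <= |x|. *)
  apply: (@L2_dom_continuous R X T A S (3 + 2 * w) (E ^~ b)); last exact: E_cont.
  + by rewrite addr_ge0 // mulr_ge0.
  + by move=> x; have [] := SD x.
  move=> x; rewrite /graph_norm.
  have -> : A (S x) = K (S x) - B (S x) by rewrite /= addrK.
  rewrite operator_resolvent.
  have := ler_normB (S x - x + w *: S x) (B (S x)).
  have := ler_normD (S x - x) (w *: S x).
  have := ler_normB (S x) x.
  rewrite normrZ ger0_norm //; have := B_le (S x); have := S_le x.
  have := normr_ge0 x; have := normr_ge0 (S x).
  have := w_ge0; nra.
- by exists (E ^~ (S b - b + w *: S b)).
Qed.

(** Both adjoint relations are tested with the solution itself; [1 + w] compares the graph norms of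
    A + B and [A]. *)
Lemma strong_solution_weak a u : strong_solution alpha T A B a u ->
  weak_solution dot alpha T K a u.
Proof.
move=> [Lu _ du]; split; first exact: L2_dom_L2 Lu.
move=> phi psi chi [_ _ h1] [_ _ h2].
rewrite -(h1 _ _ du); apply: (h2 u); split; last exact: ae_true.
apply: (L2_dom_le (K := A) (M := 1 + w)) => // x _.
rewrite /graph_norm /=; have := ler_normD (A x) (B x); have := B_le x.
have := normr_ge0 (A x); have := normr_ge0 x; have := w_ge0; nra.
Qed.

(** For fixed test functions both sides depend continuously on [a], and they agree on the dense
    domain of [A], where the solution is strong. *)
Lemma weak_solutionE a : weak_solution dot alpha T K a (E ^~ a).
Proof.
split; first exact: L2_continuous.
move=> phi psi chi h1 h2.
have [_ Lpsi _] := h1; have [_ Lchi _] := h2.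
have [C1 C10 hC1] := dotL2_small norm_dot T_gt0 Lpsi.
have [C2 C20 hC2] := dotL2_small norm_dot T_gt0 Lchi.
set x1 := LHS; set y1 := RHS; apply/eqP; rewrite -subr_eq0 -normr_eq0.
apply: contraT => d0; have {d0}d0 : 0 < `|x1 - y1| by rewrite lt_def d0 normr_ge0.
set d := `|x1 - y1| in d0 *.
(* The Lipschitz constant in [a] of the defect: [M + 1] bounds E(t) - 1 and [M] bounds E(t). A
   defect [d > 0] would satisfy d <= k d / (k + 1). *)
pose k := (M + 1) * C1 + M * C2.
have k0 : 0 <= k by rewrite addr_ge0 // mulr_ge0 // ?addr_ge0 // ltW.
have e0 : 0 < d / (k + 1) by rewrite divr_gt0 // ltr_wpDl.
have [z [/= az Dz]] : ball a (d / (k + 1)) `&` pl_dom A !=set0.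
  by apply: A_dense; [exists a; exact: ballxx|exact: ball_open].
move: az; rewrite -ball_normE /= => az.
have [_ wz] := strong_solution_weak (strong_solutionE ((1 + w) *: z - K z)).
have {}wz := wz phi psi chi h1 h2; rewrite SK // in wz.
have cc (y : X) : continuous (fun t => E t y - y).
  by move=> t; apply: cvgB; [exact: E_cont|exact: cvg_cst].
have e1 : `|x1 - dotL2 dot T (fun t => E t z - z) psi| <= (M + 1) * (d / (k + 1)) * C1.
  rewrite -(dotL2B norm_dot (L2_continuous T_gt0 (@cc a)) (L2_continuous T_gt0 (@cc z)) Lpsi).
  apply: hC1 => [|t _]; first by apply: simple_limitRB; exact: simple_limitR_continuous.
  rewrite subrACA solution_linearB; apply: le_trans (ler_normB _ _) _.
  rewrite mulrDl mul1r lerD ?(ltW az) //; apply: le_trans (E_le _ _) _.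
  by rewrite ler_wpM2l ?(ltW az) // ltW.
have e2 : `|y1 - dotL2 dot T (E ^~ z) chi| <= M * (d / (k + 1)) * C2.
  rewrite -(dotL2B norm_dot (L2_continuous T_gt0 (@E_cont a)) (L2_continuous T_gt0 (@E_cont z)) Lchi).
  apply: hC2 => [|t _]; first by apply: simple_limitRB; exact: simple_limitR_continuous.
  rewrite solution_linearB; apply: le_trans (E_le _ _) _.
  by rewrite ler_wpM2l ?(ltW az) // ltW.
have h : d <= k * (d / (k + 1)).
  rewrite {1}/d.
  have -> : x1 - y1 = (x1 - dotL2 dot T (fun t => E t z - z) psi) - (y1 - dotL2 dot T (E ^~ z) chi).
    by rewrite wz subrACA subrr subr0.
  apply: le_trans (ler_normB _ _) _; apply: le_trans (lerD e1 e2) _.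
  have kE q : (M + 1) * q * C1 + M * q * C2 = k * q by rewrite /k; ring.
  by rewrite kE.
have : k * (d / (k + 1)) < d.
  by rewrite mulrCA gtr_pMr // ltr_pdivrMr ?mul1r ?ltrDl // ltr_wpDl.
by rewrite ltNge h.
Qed.

(* E' solves the equation for the adjoint of A + B. *)
Lemma adjoint_pointwise x z t : pl_dom A z -> 0 <= t <= T ->
  dot (K z) (J (E' ^~ x) t) = dot z (E' t x - x).
Proof.
move=> Dz tT; pose b := (1 + w) *: z - K z; have t0 : 0 <= t by case/andP: tT.
(* The unbounded [K] is removed by writing [z = S b]: then [K z] is the bounded operator S - 1 + w S
   applied to [b], and [Q] is its adjoint. *)
have [Q QE] : exists Q : {linear X -> X}, forall y, Q y = S' y - y + w *: S' y.
  apply: linear_pack => k y y'; rewrite linearP; apply: (dot_ext norm_dot) => q.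
  rewrite !(dotE dot); ring.
have Q_le y : `|Q y| <= (2 + w) * `|y|.
  rewrite QE; have := ler_normD (S' y - y) (w *: S' y); have := ler_normB (S' y) y.
  rewrite normrZ ger0_norm //; have := S'_le y.
  have := normr_ge0 y; have := normr_ge0 (S' y); have := w_ge0; nra.
have w2 : 0 <= 2 + w by rewrite addr_ge0.
have zE : z = S b by rewrite SK.
have -> : dot (K z) (J (E' ^~ x) t) = dot b (Q (J (E' ^~ x) t)).
  have KzE : K z = S b - b + w *: S b by rewrite [in LHS]zE operator_resolvent.
  have QS y : dot (S b - b + w *: S b) y = dot b (Q y).
    by rewrite QE dotDl dotBl dotZl dotDr dotBr dotZr -!SS.
  by rewrite KzE QS.
rewrite -(J_linear norm_dot alpha_gt0 w2 Q_le (@E'_cont x) t0).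
have -> : (fun s => Q (E' s x)) = (fun s => E' s (S' x - x + w *: S' x)).
  by apply/funext => s; rewrite QE (linear_generator x (E'_lin s) (ES' s)).
have -> : J (fun s => E' s (S' x - x + w *: S' x)) t = S' (E' t x - x).
  have h := @EJ' x t tT; rewrite linearB /= -ES'.
  by rewrite h [RHS]addrAC subrr add0r.
by rewrite -SS -zE.
Qed.

Lemma lift_adjoint x s : 0 < s -> s <= T -> adjoint dot T (lift_op K T)
  (fun t => if t < s then J (E' ^~ x) (s - t) else 0)
  (fun t => if t < s then E' (s - t) x - x else 0).
Proof.
move=> s0 sT; split.
- by have [] := dt_adjoint norm_dot alpha_gt0 alpha_lt1 Gamma_gt0 T_gt0 (@E'_cont x) sT.
- apply: (L2_test T_gt0 sT (v := fun t => E' t x - x)).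
  by move=> t; apply: cvgB; [exact: E'_cont|exact: cvg_cst].
move=> u v [[[aD _] _] uv]; apply: lebesgue_Rintegral_ae.
apply: ae_imp2 aD uv => t h1 h2 Dt; rewrite h2 //.
case: ifP => ts; last by rewrite !dot0r.
apply: adjoint_pointwise; first exact: h1.
move: Dt; rewrite /= in_itv /= => /andP[t0 tT].
rewrite subr_ge0 (ltW ts) /= lerBlDr; apply: le_trans sT _.
by rewrite lerDl ltW.
Qed.

(** With these test functions the weak equation reads (u - a, E'(s - t) x) = (u, E'(s - t) x - x)
    over ]0, s[; the terms pairing [u] with E' cancel, and what remains expresses (u, x) through
    [a]. *)
Lemma weak_solution_pairing a u x s : weak_solution dot alpha T K a u ->
  0 < s -> s <= T ->
  dotL2 dot T u (fun t => if t < s then x else 0) =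
  dotL2 dot T (fun=> a) (fun t => if t < s then E' (s - t) x else 0).
Proof.
move=> [Lu hu] s0 sT.
have h1 := dt_adjoint norm_dot alpha_gt0 alpha_lt1 Gamma_gt0 T_gt0 (@E'_cont x) sT.
have := hu _ _ _ h1 (lift_adjoint x s0 sT).
have La : L2 T (fun=> a) by apply: (L2_continuous T_gt0) => ?; exact: cvg_cst.
have Lx : L2 T (fun t => if t < s then x else 0).
  by apply: (L2_test T_gt0 sT (v := fun=> x)) => ?; exact: cvg_cst.
have [_ Lpsi _] := h1.
rewrite (dotL2B norm_dot Lu La Lpsi) [RHS]dotL2C.
have -> : (fun t => if t < s then E' (s - t) x - x else 0) =
    (fun t => (if t < s then E' (s - t) x else 0) - (if t < s then x else 0)).
  by apply/funext => t; case: ifP => // _; rewrite subr0.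
rewrite (dotL2B norm_dot Lpsi Lx Lu) ![dotL2 dot T _ u]dotL2C.
lra.
Qed.

Lemma weak_solution_uniq a u u' : weak_solution dot alpha T K a u ->
  weak_solution dot alpha T K a u' -> eq_L2 T u' u.
Proof.
move=> wu wu'; have [Lu _] := wu; have [Lu' _] := wu'.
have : eq_L2 T (fun t => u' t - u t) (fun=> 0).
  apply: (L2_eq0 norm_dot T_gt0 (L2B Lu' Lu)) => s x /andP[s0 sT].
  have Lx : L2 T (fun t => if t < s then x else 0).
    by apply: (L2_test T_gt0 sT (v := fun=> x)) => ?; exact: cvg_cst.
  transitivity (dotL2 dot T (fun t => u' t - u t) (fun t => if t < s then x else 0)).
    rewrite /dotL2 Rintegral_mkcond [RHS]Rintegral_mkcond; apply: eq_Rintegral => t _.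
    rewrite /patch !mem_setE !in_itv /=.
    case: (ltP t s) => ts; last by rewrite andbF dot0r if_same.
    by rewrite (lt_le_trans ts sT).
  rewrite (dotL2B norm_dot Lu' Lu Lx).
  by rewrite (weak_solution_pairing x wu s0 sT) (weak_solution_pairing x wu' s0 sT) subrr.
by apply: ae_imp => t h Dt; apply/eqP; rewrite -subr_eq0 h.
Qed.

(** On the right no unbounded operator acts on [E t a]: this yields the continuity of A u and its
    bound. *)
Lemma solution_operatorE a t : pl_dom A a -> A (E t a) = E t (K a) - B (E t a).
Proof.
move=> Da; have {1}<- := SK Da; rewrite -[A _](addrK (B (E t (S ((1 + w) *: a - K a))))).
have := operator_solution t ((1 + w) *: a - K a); rewrite /= => ->.
by rewrite -(operator_resolvent ((1 + w) *: a - K a)) SK.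
Qed.

Lemma well_posed :
  ((forall a : X, exists u : R -> X,
      weak_solution dot alpha T K a u /\
      forall u', weak_solution dot alpha T K a u' -> eq_L2 T u' u) /\
   (exists2 C : R, 0 < C & forall (a : X) (u : R -> X),
      weak_solution dot alpha T K a u ->
      {ae lebesgue_measure, forall t : R, 0 < t < T -> `|u t| <= C * `|a|}))
  /\
  ((forall a : X, pl_dom A a -> exists u : R -> X,
      [/\ strong_solution alpha T A B a u,
          forall u', strong_solution alpha T A B a u' -> eq_L2 T u' u,
          continuous_repr T u &
          continuous_repr T (fun t => A (u t))]) /\
   (exists2 C : R, 0 < C & forall (a : X) (u : R -> X), pl_dom A a ->
      strong_solution alpha T A B a u ->
      {ae lebesgue_measure, forall t : R, 0 < t < T ->
        `|A (u t)| + `|u t| <= C * (`|A a| + `|a|)})).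
Proof.
split; split.
- move=> a; exists (E ^~ a); split; first exact: weak_solutionE.
  by move=> u' wu'; exact: (weak_solution_uniq (weak_solutionE a)).
- exists M => // a u wu.
  apply: ae_imp (weak_solution_uniq (weak_solutionE a) wu) => t h tT.
  by rewrite h /= ?in_itv //; exact: E_le.
- move=> a Da; exists (E ^~ a).
  have sa : strong_solution alpha T A B a (E ^~ a).
    by have := strong_solutionE ((1 + w) *: a - K a); rewrite SK.
  split => //.
  + move=> u' /strong_solution_weak; apply: weak_solution_uniq.
    exact: weak_solutionE.
  + by exists (E ^~ a); [exact/continuous_subspaceT|exact: ae_true].
  + exists (fun t => E t (K a) - B (E t a)).
      apply: continuous_subspaceT => t; apply: cvgB; first exact: E_cont.
      apply: (@continuous_comp _ _ _ (E ^~ a) B); first exact: E_cont.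
      exact: (lipschitz_continuous B_le).
    by apply: ae_true => t _; exact: solution_operatorE.
(* One [w] comes from [B (E t a)], the other from [B a] inside [K a]. *)
exists (M * (1 + 2 * w)); first by rewrite mulr_gt0 // ltr_wpDr // mulr_ge0.
move=> a u Da su.
apply: ae_imp (weak_solution_uniq (weak_solutionE a) (strong_solution_weak su)) => t h tT.
rewrite h /= ?in_itv // solution_operatorE //.
have n1 := ler_normB (E t (K a)) (B (E t a)).
have n2 := E_le t (K a); have n3 := E_le t a; have n4 := B_le (E t a).
have n5 : `|K a| <= `|A a| + w * `|a| by apply: le_trans (ler_normD _ _) _; rewrite lerD2l.
have n6 : M * `|K a| <= M * (`|A a| + w * `|a|) by rewrite ler_wpM2l // ltW.
have n7 : w * `|E t a| <= w * (M * `|a|) by rewrite ler_wpM2l.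
have n8 : 0 <= M * w * `|A a| by rewrite !mulr_ge0 // ltW.
have n9 : 0 <= M * w * `|a| by rewrite !mulr_ge0 // ltW.
lra.
Qed.

End Solutions.

Theorem theorem2p8 (R : realType) (X : completeNormedModType R)
    (dot : {dot X for idfun}) (norm_dot : forall x : X, `|x| ^+ 2 = dot x x)
    (alpha T : R) (alpha_gt0 : 0 < alpha) (alpha_lt1 : alpha < 1)
    (T_gt0 : 0 < T)
    (A : partial_linear X) (A_closed : closed_operator A)
    (A_dense : densely_defined A)
    (A_rho : forall l : R, 0 < l -> in_resolvent_set A l)
    (A_res : forall l : R, 0 < l -> l * opnorm (resolvent A l) <= 1)
    (B : {linear X -> X}) (B_bounded : bounded_operator B) :
  ((forall a : X, exists u : R -> X,
      weak_solution dot alpha T (add_bounded A B) a u /\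
      forall u', weak_solution dot alpha T (add_bounded A B) a u' ->
        eq_L2 T u' u) /\
   (exists2 C : R, 0 < C & forall (a : X) (u : R -> X),
      weak_solution dot alpha T (add_bounded A B) a u ->
      {ae lebesgue_measure, forall t : R, 0 < t < T ->
        `|u t| <= C * `|a|}))
  /\
  ((forall a : X, pl_dom A a -> exists u : R -> X,
      [/\ strong_solution alpha T A B a u,
          forall u', strong_solution alpha T A B a u' -> eq_L2 T u' u,
          continuous_repr T u &
          continuous_repr T (fun t => A (u t))]) /\
   (exists2 C : R, 0 < C & forall (a : X) (u : R -> X), pl_dom A a ->
      strong_solution alpha T A B a u ->
      {ae lebesgue_measure, forall t : R, 0 < t < T ->
        `|A (u t)| + `|u t| <= C * (`|A a| + `|a|)})).
Proof.
have [m hm] := B_bounded.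
(* The bound [m] may be negative when X is trivial. *)
have w_ge0 : 0 <= `|m| by [].
have B_le x : `|B x| <= `|m| * `|x|.
  by apply: le_trans (hm x) _; rewrite ler_wpM2r // ler_norm.
have G0 := Gamma_gt0 alpha_gt0 alpha_lt1.
have [P [S [[P_le S_le] [PP PS] yS P_cvg [SD SK]]]] := yosida_family A_dense A_rho A_res w_ge0 B_le.
have [E [M [M0 Ec E_le El [ES EJ]]]] :=
  solution_family norm_dot alpha_gt0 alpha_lt1 G0 T_gt0 w_ge0 P_le S_le PP PS yS P_cvg.
have [P' [S' [[P'_le S'_le] [PP' PS'] yS' P'_cvg SS]]] :=
  adjoint_family norm_dot P_le S_le PP PS yS P_cvg.
have [E' [M' [M'0 Ec' E'_le El' [ES' EJ']]]] :=
  solution_family norm_dot alpha_gt0 alpha_lt1 G0 T_gt0 w_ge0 P'_le S'_le PP' PS' yS' P'_cvg.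
exact: (well_posed norm_dot alpha_gt0 alpha_lt1 T_gt0 A_dense w_ge0 B_le SD SK S_le S'_le SS M0
  Ec E_le El ES EJ Ec' El' ES' EJ').
Qed.
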